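(* Suppose that each $f_i$ is $\mu$-strongly concave in $y$, that each $f_i$ is jointly $L$-smooth with $L$-Lipschitz second derivatives in the sense given in the context, that the stochastic gradients are unbiased and bounded in norm by $C$, and that the weight matrix $W$ is doubly stochastic with $\rho_W<1$. Let $0<\beta<\alpha<1$, $\gamma_x,\gamma_y>0$, $\kappa:=L/\mu$, and let the total number of iterations $K$ satisfy $$K=\Omega\left(\max\left\{\left(\frac{\gamma_x^2\kappa^4}{\gamma_y^2}\right)^{\frac{1}{\alpha-\beta}},\ \left(\frac{1}{(1-\rho_W)^2}\right)^{\max\{\frac1\alpha,\frac1\beta\}}\right\}\right).$$ Then the iterates of D-TiAda satisfy $$\frac1K\sum_{k=0}^{K-1}\mathbb{E}\left[\|\nabla\varPhi(\bar{x}_k)\|^2\right]=\tilde{\mathcal{O}}\left(\frac{1}{K^{1-\alpha}}+\frac{1}{(1-\rho_W)^{\alpha}K^{\alpha}}\right)+\tilde{\mathcal{O}}\left(\frac{1}{K^{1-\beta}}+\frac{1}{(1-\rho_W)K^{\beta}}\right)+\tilde{\mathcal{O}}\left((\zeta_v^2+\kappa^2\zeta_u^2)C^2\right).$$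
   Context: Problem: $\min_{x\in\mathbb{R}^p}\max_{y\in\mathcal{Y}}f(x,y)=\frac1n\sum_{i=1}^nf_i(x,y)$, $f_i(x,y)=\mathbb{E}_{\xi_i\sim\mathcal{D}_i}[F_i(x,y;\xi_i)]$, with $\mathcal{Y}\subset\mathbb{R}^d$ closed and convex. $y^*(x)=\arg\max_{y\in\mathcal{Y}}f(x,y)$ and $\varPhi(x)=f(x,y^*(x))$; $\varPhi^{\max}=\max_x\varPhi(x)$ and $\varPhi^*=\min_x\varPhi(x)$ are assumed finite. Assumptions, for every $i$: (strong concavity) $f_i(x,y)-f_i(x,y')\ge\langle\nabla_yf_i(x,y),y-y'\rangle+\frac\mu2\|y-y'\|^2$ for all $x\in\mathbb{R}^p$, $y,y'\in\mathcal{Y}$, where $\mu>0$; (smoothness) for $z\in\{x,y\}$ and all $x,x'\in\mathbb{R}^p$, $y,y'\in\mathcal{Y}$: $\|\nabla_zf_i(x,y)-\nabla_zf_i(x',y')\|^2\le L^2(\|x-x'\|^2+\|y-y'\|^2)$ and $\|\nabla^2_{zy}f_i(x,y)-\nabla^2_{zy}f_i(x',y')\|^2\le L^2(\|x-x'\|^2+\|y-y'\|^2)$; (stochastic gradients) for i.i.d. samples, $\mathbb{E}_{\xi_i}[\nabla_zF_i(x,y;\xi_i)]=\nabla_zf_i(x,y)$ and $\|\nabla_zF_i(x,y;\xi_i)\|\le C$ for $z\in\{x,y\}$, $x\in\mathbb{R}^p$, $y\in\mathcal{Y}$; (graph) $W\in\mathbb{R}^{n\times n}$, induced by the communication graph,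 is doubly stochastic ($W\mathbf{1}=\mathbf{1}$, $\mathbf{1}^TW=\mathbf{1}^T$) and $\rho_W:=\|W-\mathbf{J}\|_2^2<1$, $\mathbf{J}=\mathbf{1}\mathbf{1}^T/n$. D-TiAda algorithm: node $i$ keeps $x_{i,k}\in\mathbb{R}^p$, $y_{i,k}\in\mathcal{Y}$ and scalars $m^x_{i,k},m^y_{i,k}$, with $m^x_{i,0}=m^y_{i,0}=c>0$. $\mathbf{x}_k,\mathbf{y}_k$ are the matrices with rows $x_{i,k}^T,y_{i,k}^T$. With i.i.d. samples, $g^x_{i,k}=\nabla_xF_i(x_{i,k},y_{i,k};\xi^x_{i,k})$, $g^y_{i,k}=\nabla_yF_i(x_{i,k},y_{i,k};\xi^y_{i,k})$; $\nabla_xF(\mathbf{x}_k,\mathbf{y}_k;\xi^x_k)$, $\nabla_yF(\mathbf{x}_k,\mathbf{y}_k;\xi^y_k)$ are the matrices with rows $(g^x_{i,k})^T$, $(g^y_{i,k})^T$. For $k=0,1,\dots$: $$m^x_{i,k+1}=m^x_{i,k}+\|g^x_{i,k}\|^2,\quad m^y_{i,k+1}=m^y_{i,k}+\|g^y_{i,k}\|^2,$$ $$\mathbf{x}_{k+1}=W(\mathbf{x}_k-\gamma_xV_{k+1}^{-\alpha}\nabla_xF(\mathbf{x}_k,\mathbf{y}_k;\xi^x_k)),\quad\mathbf{y}_{k+1}=\mathcal{P}_{\mathcal{Y}}(W(\mathbf{y}_k+\gamma_yU_{k+1}^{-\beta}\nabla_yF(\mathbf{x}_k,\mathbf{y}_k;\xi^y_k))),$$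 where $V_k=\mathrm{diag}\{v_{i,k}\}$, $U_k=\mathrm{diag}\{u_{i,k}\}$, $v_{i,k}=\max\{m^x_{i,k},m^y_{i,k}\}$, $u_{i,k}=m^y_{i,k}$, and $\mathcal{P}_{\mathcal{Y}}$ is the row-wise Euclidean projection onto $\mathcal{Y}$. Averages: $\bar{x}_k=\frac1n\sum_ix_{i,k}$, $\bar v_k=\frac1n\sum_iv_{i,k}$, $\bar u_k=\frac1n\sum_iu_{i,k}$. Stepsize inconsistency: $\zeta_v^2=\sup_{i\in[n],k>0}(v_{i,k}^{-\alpha}-\bar v_k^{-\alpha})^2/(\bar v_k^{-\alpha})^2$, $\zeta_u^2=\sup_{i\in[n],k>0}(u_{i,k}^{-\beta}-\bar u_k^{-\beta})^2/(\bar u_k^{-\beta})^2$, where $\bar v_k^{-\alpha}=(\bar v_k)^{-\alpha}$ etc.; these are treated as finite deterministic constants. Asymptotic notation: in $\Omega$ and in the first two $\tilde{\mathcal{O}}$ terms, the hidden factors may depend on $L,\mu,C,n,c,\alpha,\beta,\gamma_x,\gamma_y$, $\varPhi^{\max}-\varPhi^*$, the initial point, and $\zeta_v,\zeta_u$, but not otherwise on $K$ or $\rho_W$; $\tilde{\mathcal{O}}$ additionally hides factors polylogarithmic in $K$. In the last term the hidden constant is absolute (up to logarithmic factors). *)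

(* Defs.v *)
(* Points of R^p are row vectors 'rV[R]_p, so that the
   stacked variables of the n nodes are matrices whose i-th row is the vector of
   node i. *)
From HB Require Import structures.
From mathcomp Require Import all_boot all_order all_algebra.
From mathcomp Require Import all_classical all_reals all_analysis ess_sup_inf.
Set Implicit Arguments.
Unset Strict Implicit.
Unset Printing Implicit Defensive.
Import Order.TTheory GRing.Theory Num.Theory.
Import numFieldNormedType.Exports.
Local Open Scope classical_set_scope.
Local Open Scope ring_scope.

(* The norm [`|_|] of the library on matrices is the sup
    norm; it is used below only through its topology (differentiability, open
    and closed sets). *)

Definition l2norm (R : realType) (m n : nat) (A : 'M[R]_(m, n)) : R :=
  Num.sqrt (\sum_i \sum_j A i j ^+ 2).

Definition dotp (R : realType) (n : nat) (u v : 'rV[R]_n) : R :=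
  \sum_j u 0 j * v 0 j.

Definition specnorm (R : realType) (m n : nat) (A : 'M[R]_(m, n)) : R :=
  sup [set l2norm (A *m v) | v in [set v : 'cV[R]_n | l2norm v <= 1]].

(* [xget] returns its first argument when no minimizer exists, which does not
   happen for Y closed, convex and nonempty. *)
Definition proj (R : realType) (d : nat) (Y : set 'rV[R]_d) (v : 'rV[R]_d) :
    'rV[R]_d :=
  xget v [set z | Y z /\ forall y, Y y -> l2norm (v - z) <= l2norm (v - y)].

Definition proj_rows (R : realType) (n d : nat) (Y : set 'rV[R]_d)
    (M : 'M[R]_(n, d)) : 'M[R]_(n, d) :=
  \matrix_(i < n) proj Y (row i M).

Definition avg (R : realType) (n : nat) (a : 'I_n -> R) : R :=
  n%:R^-1 * \sum_i a i.

Definition avg_row (R : realType) (n p : nat) (X : 'M[R]_(n, p)) : 'rV[R]_p :=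
  n%:R^-1 *: \sum_i row i X.

Definition grad (R : realType) (p : nat) (h : 'rV[R]_p -> R) (x : 'rV[R]_p) :
    'rV[R]_p :=
  \row_j 'D_(delta_mx 0 j) h x.

Definition grad_x (R : realType) (p d : nat) (f : 'rV[R]_p -> 'rV[R]_d -> R)
    (x : 'rV[R]_p) (y : 'rV[R]_d) : 'rV[R]_p :=
  grad (fun x' => f x' y) x.

Definition grad_y (R : realType) (p d : nat) (f : 'rV[R]_p -> 'rV[R]_d -> R)
    (x : 'rV[R]_p) (y : 'rV[R]_d) : 'rV[R]_d :=
  grad (f x) y.

Definition hess_xy (R : realType) (p d : nat) (f : 'rV[R]_p -> 'rV[R]_d -> R)
    (x : 'rV[R]_p) (y : 'rV[R]_d) : 'M[R]_(p, d) :=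
  \matrix_(a < p, b < d) grad (fun x' => grad_y f x' y 0 b) x 0 a.

Definition hess_yy (R : realType) (p d : nat) (f : 'rV[R]_p -> 'rV[R]_d -> R)
    (x : 'rV[R]_p) (y : 'rV[R]_d) : 'M[R]_d :=
  \matrix_(a < d, b < d) grad (fun y' => grad_y f x y' 0 b) y 0 a.

Definition local_obj (R : realType) (dXi : measure_display)
    (Xi : measurableType dXi) (n p d : nat) (D : 'I_n -> probability Xi R)
    (F : 'I_n -> Xi -> 'rV[R]_p -> 'rV[R]_d -> R) (i : 'I_n)
    (x : 'rV[R]_p) (y : 'rV[R]_d) : R :=
  fine 'E_(D i)[fun xi => F i xi x y]%E.

Definition global_obj (R : realType) (n p d : nat)
    (f : 'I_n -> 'rV[R]_p -> 'rV[R]_d -> R) (x : 'rV[R]_p) (y : 'rV[R]_d) : R :=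
  avg (fun i => f i x y).

(* Under strong concavity over a nonempty closed Y the maximizer exists and is
   unique, so that the default value of [xget] is never used. *)
Definition ystar (R : realType) (p d : nat) (Y : set 'rV[R]_d)
    (f : 'rV[R]_p -> 'rV[R]_d -> R) (x : 'rV[R]_p) : 'rV[R]_d :=
  xget 0 [set y | Y y /\ forall y', Y y' -> f x y' <= f x y].

Definition Phi (R : realType) (p d : nat) (Y : set 'rV[R]_d)
    (f : 'rV[R]_p -> 'rV[R]_d -> R) (x : 'rV[R]_p) : R :=
  f x (ystar Y f x).

Definition strongly_concave_y (R : realType) (p d : nat) (Y : set 'rV[R]_d)
    (mu : R) (f : 'rV[R]_p -> 'rV[R]_d -> R) : Prop :=
  forall (x : 'rV[R]_p) (y y' : 'rV[R]_d), Y y -> Y y' ->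
    dotp (grad_y f x y) (y - y') + mu / 2 * l2norm (y - y') ^+ 2
      <= f x y - f x y'.

(* The existence of the derivatives in the Lipschitz conditions: f is
   differentiable near every point of R^p x Y (which gives a meaning to the
   derivatives at boundary points of Y), and grad_y f is differentiable there. *)
Definition has_derivatives (R : realType) (p d : nat) (Y : set 'rV[R]_d)
    (f : 'rV[R]_p -> 'rV[R]_d -> R) : Prop :=
  forall (x : 'rV[R]_p) (y : 'rV[R]_d), Y y ->
    (\forall z \near (x, y),
       differentiable (fun t : 'rV[R]_p * 'rV[R]_d => f t.1 t.2) z) /\
    differentiable (fun t : 'rV[R]_p * 'rV[R]_d => grad_y f t.1 t.2) (x, y).

Definition smooth (R : realType) (p d : nat) (Y : set 'rV[R]_d) (L : R)
    (f : 'rV[R]_p -> 'rV[R]_d -> R) : Prop :=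
  has_derivatives Y f /\
  forall (x x' : 'rV[R]_p) (y y' : 'rV[R]_d), Y y -> Y y' ->
    let B := L ^+ 2 * (l2norm (x - x') ^+ 2 + l2norm (y - y') ^+ 2) in
    [/\ l2norm (grad_x f x y - grad_x f x' y') ^+ 2 <= B,
        l2norm (grad_y f x y - grad_y f x' y') ^+ 2 <= B,
        specnorm (hess_xy f x y - hess_xy f x' y') ^+ 2 <= B &
        specnorm (hess_yy f x y - hess_yy f x' y') ^+ 2 <= B].

Definition borel (T : topologicalType) := g_sigma_algebraType (@open T).

(* Joint measurability in (x, y, xi) and local integrability, which are implicit
   in writing f_i = E[F_i] and in evaluating F_i at random points. *)
Definition regular_oracle (R : realType) (dXi : measure_display)
    (Xi : measurableType dXi) (p d : nat) (Y : set 'rV[R]_d)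
    (D : probability Xi R) (F : Xi -> 'rV[R]_p -> 'rV[R]_d -> R) : Prop :=
  measurable_fun [set: borel ('rV[R]_p * 'rV[R]_d)%type * Xi]
    (fun t : borel ('rV[R]_p * 'rV[R]_d)%type * Xi => F t.2 t.1.1 t.1.2) /\
  forall (x : 'rV[R]_p) (y : 'rV[R]_d), Y y ->
    \forall z \near (x, y),
      D.-integrable [set: Xi] (EFin \o (fun xi => F xi z.1 z.2)).

Definition unbiased_bounded (R : realType) (dXi : measure_display)
    (Xi : measurableType dXi) (p d : nat) (Y : set 'rV[R]_d) (C : R)
    (D : probability Xi R) (F : Xi -> 'rV[R]_p -> 'rV[R]_d -> R)
    (f : 'rV[R]_p -> 'rV[R]_d -> R) : Prop :=
  forall (x : 'rV[R]_p) (y : 'rV[R]_d), Y y ->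
    [/\ forall xi, differentiable
          (fun t : 'rV[R]_p * 'rV[R]_d => F xi t.1 t.2) (x, y),
        forall j, 'E_D[fun xi => (grad_x (F xi) x y 0 j)%R]%E
                  = (grad_x f x y 0 j)%:E,
        forall j, 'E_D[fun xi => (grad_y (F xi) x y 0 j)%R]%E
                  = (grad_y f x y 0 j)%:E,
        forall xi, l2norm (grad_x (F xi) x y) <= C &
        forall xi, l2norm (grad_y (F xi) x y) <= C].

Definition mutually_independent (R : realType) (dO : measure_display)
    (Omega : measurableType dO) (P : probability Omega R)
    (dXi : measure_display) (Xi : measurableType dXi) (I : eqType)
    (X : I -> Omega -> Xi) : Prop :=
  forall (s : seq I) (A : I -> set Xi), uniq s ->
    (forall j, measurable (A j)) ->
    (P (\bigcap_(j in [set` s]) (X j @^-1` A j))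
     = \prod_(j <- s) P (X j @^-1` A j))%E.

Definition iid_samples (R : realType) (dO : measure_display)
    (Omega : measurableType dO) (P : probability Omega R)
    (dXi : measure_display) (Xi : measurableType dXi) (n : nat)
    (D : 'I_n -> probability Xi R)
    (xix xiy : 'I_n -> nat -> {RV P >-> Xi}) : Prop :=
  [/\ forall i k A, measurable A -> distribution P (xix i k) A = D i A,
      forall i k A, measurable A -> distribution P (xiy i k) A = D i A &
      mutually_independent P
        (fun j : bool * 'I_n * nat =>
           (if j.1.1 then xix j.1.2 j.2 else xiy j.1.2 j.2) : Omega -> Xi)].

Definition doubly_stochastic (R : realType) (n : nat) (W : 'M[R]_n) : Prop :=
  W *m const_mx 1 = const_mx 1 :> 'cV[R]_n /\
  const_mx 1 *m W = const_mx 1 :> 'rV[R]_n.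

Definition rhoW (R : realType) (n : nat) (W : 'M[R]_n) : R :=
  specnorm (W - const_mx n%:R^-1) ^+ 2.

Record dtiada_params (R : realType) := DTiAdaParams {
  ada_alpha : R; ada_beta : R; ada_gamma_x : R; ada_gamma_y : R }.

Record dtiada_state (R : realType) (n p d : nat) := DTiAdaState {
  st_x : 'M[R]_(n, p);
  st_y : 'M[R]_(n, d);
  st_mx : 'rV[R]_n;
  st_my : 'rV[R]_n }.

Definition st_v (R : realType) (n p d : nat) (s : dtiada_state R n p d)
    (i : 'I_n) : R :=
  Num.max (st_mx s 0 i) (st_my s 0 i).

Definition st_u (R : realType) (n p d : nat) (s : dtiada_state R n p d)
    (i : 'I_n) : R :=
  st_my s 0 i.

Definition dtiada_step (R : realType) (n p d : nat) (Xi : Type)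
    (a : dtiada_params R) (Y : set 'rV[R]_d) (W : 'M[R]_n)
    (F : 'I_n -> Xi -> 'rV[R]_p -> 'rV[R]_d -> R)
    (xix xiy : 'I_n -> Xi) (s : dtiada_state R n p d) : dtiada_state R n p d :=
  let Gx := \matrix_(i < n) grad_x (F i (xix i)) (row i (st_x s)) (row i (st_y s)) in
  let Gy := \matrix_(i < n) grad_y (F i (xiy i)) (row i (st_x s)) (row i (st_y s)) in
  let mx := \row_i (st_mx s 0 i + l2norm (row i Gx) ^+ 2) in
  let my := \row_i (st_my s 0 i + l2norm (row i Gy) ^+ 2) in
  let Valpha := diag_mx (\row_i (Num.max (mx 0 i) (my 0 i) `^ (- ada_alpha a))) in
  let Ubeta := diag_mx (\row_i (my 0 i `^ (- ada_beta a))) in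
  DTiAdaState
    (W *m (st_x s - ada_gamma_x a *: (Valpha *m Gx)))
    (proj_rows Y (W *m (st_y s + ada_gamma_y a *: (Ubeta *m Gy))))
    mx my.

Fixpoint dtiada (R : realType) (n p d : nat) (Xi : Type)
    (a : dtiada_params R) (Y : set 'rV[R]_d) (W : 'M[R]_n)
    (F : 'I_n -> Xi -> 'rV[R]_p -> 'rV[R]_d -> R)
    (c : R) (x0 : 'M[R]_(n, p)) (y0 : 'M[R]_(n, d))
    (xix xiy : 'I_n -> nat -> Xi) (k : nat) : dtiada_state R n p d :=
  if k is k'.+1 then
    dtiada_step a Y W F (xix^~ k') (xiy^~ k')
      (dtiada a Y W F c x0 y0 xix xiy k')
  else DTiAdaState x0 y0 (const_mx c) (const_mx c).

(* The squared stepsize inconsistency of the random sequences b i k with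
   exponent - e.  The supremum over nodes and iterations is a random variable;
   it is turned into a deterministic constant by taking its essential supremum. *)
Definition inconsistency_sq (R : realType) (dO : measure_display)
    (Omega : measurableType dO) (P : probability Omega R) (n : nat) (e : R)
    (b : Omega -> nat -> 'I_n -> R) : \bar R :=
  ess_sup P (fun w => ereal_sup
    [set ((b w ik.2 ik.1 `^ (- e) - avg (b w ik.2) `^ (- e)) ^+ 2
          / (avg (b w ik.2) `^ (- e)) ^+ 2)%:E
    | ik in [set ik : 'I_n * nat | (0 < ik.2)%N]]).

(* The polylogarithmic factor of a soft-O, normalized to be at least 1. *)
Definition polylog (R : realType) (q K : nat) : R := (1 + ln K%:R) ^+ q.

(* Main.v *)
(** The argument is pathwise up to a martingale.  On almost every path three energy
    inequalities hold, each weighted by a reciprocal stepsize and summed over the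
    iterations: descent of Phi along the average primal iterate xb; contraction of
    the distance of xb to an exponentially smoothed copy xh of itself, moving at the
    pace of the dual stepsizes; and, by strong concavity, tracking of y*(xh) by the
    dual iterates.  The ratio of the primal to the dual stepsize is below any given
    eps once the accumulated squared gradients exceed a constant, so the feedback of
    the gradients of Phi into the second inequality can be absorbed, whereas the
    iterations before that contribute only a bounded amount.
    The stepsizes depend on the current sample.  Replacing them by their averages
    before the sample costs relative increments of an accumulator, whose sum is
    logarithmic, and the inconsistency terms zeta.  The consensus errors are sums of
    squared steps over (1 - rho)^2, which the condition on K makes of lower order.
    What is left over are inner products of the errors of the stochastic gradients
    with bounded vectors determined by the past samples; they have mean zero because
    the current sample is independent of the past.  Only first-order smoothness is
    used: y* is Lipschitz and the gradient of Phi is given by the envelope formula. *)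
Require Import Defs.
From HB Require Import structures.
From mathcomp Require Import all_boot all_order all_algebra.
From mathcomp Require Import all_classical all_reals all_analysis.
From mathcomp Require Import measurable_realfun ess_sup_inf.
From mathcomp Require Import ring lra.
Set Implicit Arguments.
Unset Strict Implicit.
Unset Printing Implicit Defensive.
Import Order.TTheory GRing.Theory Num.Theory.
Import numFieldNormedType.Exports.
Local Open Scope classical_set_scope.
Local Open Scope ring_scope.

(** * Vectors and averages *)

(** Under constraints [ys] is in general only Lipschitz, so its displacement under a noisy step of
    [xb] has no controlled mean. Bounding it by the step length would leave an average of order
    K^(-2(alpha - beta)), absent from the claim. The copy [xh] averages the noise out before the
    dual iterates see it; the price is the gap [xb - xh], controlled by the second energy
    inequality. The last term of the claim has an absolute constant, so a contribution of zeta
    linear in K may only carry a numerical factor. In the second inequality zeta_v therefore comes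
    with [eps], chosen against the weight that this inequality receives; where the stepsize ratio
    may be larger, squared sampled gradients pay instead. Strong concavity and bounded gradients
    force the diameter of [Y] to be at most 2 C / mu. Hence [Y] is compact, projections and
    maximizers exist, and the dual energy is bounded, as summation by parts against growing weights
    requires. The range of Phi and [rmax] bound the other two energies. The energy estimates may
    fail on a null set, but the martingale coefficients need deterministic bounds on all paths. *)

Section Euclidean.
Context {R : realType} {n : nat}.
Implicit Types u v w : 'rV[R]_n.

Lemma dotpC u v : dotp u v = dotp v u.
Proof. by apply: eq_bigr => j _; rewrite mulrC. Qed.

Lemma dotpDl u v w : dotp (u + v) w = dotp u w + dotp v w.
Proof. by rewrite -big_split; apply: eq_bigr => j _; rewrite mxE mulrDl. Qed.

Lemma dotpZl a u v : dotp (a *: u) v = a * dotp u v.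
Proof. by rewrite /dotp mulr_sumr; apply: eq_bigr => j _; rewrite mxE mulrA. Qed.

Lemma dotp0l v : dotp 0 v = 0.
Proof. by rewrite /dotp big1// => j _; rewrite mxE mul0r. Qed.

Lemma dotpNl u v : dotp (- u) v = - dotp u v.
Proof. by rewrite -scaleN1r dotpZl mulN1r. Qed.

Lemma dotpBl u v w : dotp (u - v) w = dotp u w - dotp v w.
Proof. by rewrite dotpDl dotpNl. Qed.

Lemma dotpDr u v w : dotp u (v + w) = dotp u v + dotp u w.
Proof. by rewrite dotpC dotpDl !(dotpC _ u). Qed.

Lemma dotpZr a u v : dotp u (a *: v) = a * dotp u v.
Proof. by rewrite dotpC dotpZl dotpC. Qed.

Lemma dotpNr u v : dotp u (- v) = - dotp u v.
Proof. by rewrite dotpC dotpNl dotpC. Qed.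

Lemma dotpBr u v w : dotp u (v - w) = dotp u v - dotp u w.
Proof. by rewrite dotpDr dotpNr. Qed.

Lemma dotp_suml I (r : seq I) (P : pred I) (F : I -> 'rV[R]_n) v :
  dotp (\sum_(i <- r | P i) F i) v = \sum_(i <- r | P i) dotp (F i) v.
Proof. by elim/big_rec2: _ => [|i _ w _ <-]; rewrite ?dotp0l// dotpDl. Qed.

Lemma dotp_sumr I (r : seq I) (P : pred I) (F : I -> 'rV[R]_n) v :
  dotp v (\sum_(i <- r | P i) F i) = \sum_(i <- r | P i) dotp v (F i).
Proof. by rewrite dotpC dotp_suml; apply: eq_bigr => i _; rewrite dotpC. Qed.

Lemma sqr_l2norm u : l2norm u ^+ 2 = dotp u u.
Proof.
rewrite sqr_sqrtr; last by apply: sumr_ge0 => i _; apply: sumr_ge0 => j _; exact: sqr_ge0.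
by rewrite big_ord1; apply: eq_bigr => j _; rewrite expr2.
Qed.

Lemma l2norm_ge0 m (A : 'M[R]_(m, n)) : 0 <= l2norm A.
Proof. exact: sqrtr_ge0. Qed.

Lemma l2norm_sqrt u : l2norm u = Num.sqrt (dotp u u).
Proof. by rewrite -sqr_l2norm sqrtr_sqr ger0_norm// l2norm_ge0. Qed.

Lemma l2norm0 : l2norm (0 : 'rV[R]_n) = 0.
Proof. by rewrite l2norm_sqrt dotp0l sqrtr0. Qed.

Lemma l2normN u : l2norm (- u) = l2norm u.
Proof. by rewrite !l2norm_sqrt dotpNl dotpNr opprK. Qed.

Lemma l2distC u v : l2norm (u - v) = l2norm (v - u).
Proof. by rewrite -l2normN opprB. Qed.

Lemma l2normZ a u : l2norm (a *: u) = `|a| * l2norm u.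
Proof.
rewrite !l2norm_sqrt dotpZl dotpZr mulrA -expr2 sqrtrM ?sqr_ge0//.
by rewrite sqrtr_sqr.
Qed.

Lemma l2norm_eq0 u : l2norm u = 0 -> u = 0.
Proof.
move=> u0; have : dotp u u = 0 by rewrite -sqr_l2norm u0 expr0n.
move=> /eqP; rewrite psumr_eq0; last by move=> j _; rewrite -expr2 sqr_ge0.
move=> /allP h; apply/rowP => j; rewrite mxE; apply/eqP.
by have := h j; rewrite mem_index_enum/= -expr2 sqrf_eq0; apply.
Qed.

Lemma sqr_l2normD u v :
  l2norm (u + v) ^+ 2 = l2norm u ^+ 2 + 2 * dotp u v + l2norm v ^+ 2.
Proof. by rewrite !sqr_l2norm dotpDl !dotpDr (dotpC v u); ring. Qed.

Lemma sqr_l2normB u v :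
  l2norm (u - v) ^+ 2 = l2norm u ^+ 2 - 2 * dotp u v + l2norm v ^+ 2.
Proof. by rewrite sqr_l2normD dotpNr l2normN; ring. Qed.

Lemma cauchy_schwarz u v : dotp u v <= l2norm u * l2norm v.
Proof.
have [u0|u0] := eqVneq (l2norm u) 0.
  by rewrite (l2norm_eq0 u0) dotp0l l2norm0 mul0r.
have [v0|v0] := eqVneq (l2norm v) 0.
  by rewrite (l2norm_eq0 v0) dotpC dotp0l l2norm0 mulr0.
have up : 0 < l2norm u by rewrite lt_def u0 l2norm_ge0.
have vp : 0 < l2norm v by rewrite lt_def v0 l2norm_ge0.
have := sqr_ge0 (l2norm ((l2norm v) *: u - (l2norm u) *: v)).
rewrite sqr_l2normB !l2normZ dotpZl dotpZr !ger0_norm ?l2norm_ge0//.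
have : 0 < l2norm u * l2norm v by rewrite mulr_gt0.
by move: (l2norm u * l2norm v) (mulrC (l2norm u) (l2norm v)) => t e tp; rewrite e; nra.
Qed.

Lemma normr_dotp u v : `|dotp u v| <= l2norm u * l2norm v.
Proof.
rewrite ler_norml cauchy_schwarz andbT lerNl -dotpNl.
by rewrite (le_trans (cauchy_schwarz _ _))// l2normN.
Qed.

Lemma ler_l2normD u v : l2norm (u + v) <= l2norm u + l2norm v.
Proof.
rewrite -ler_sqr ?nnegrE ?addr_ge0 ?l2norm_ge0// sqr_l2normD.
by have := cauchy_schwarz u v; nra.
Qed.

Lemma ler_l2normB u v : l2norm (u - v) <= l2norm u + l2norm v.
Proof. by rewrite (le_trans (ler_l2normD _ _))// l2normN. Qed.

Lemma dotp_young (t : R) u v : 0 < t ->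
  2 * dotp u v <= t * l2norm u ^+ 2 + t^-1 * l2norm v ^+ 2.
Proof.
move=> t0; have := sqr_ge0 (l2norm (t *: u - v)).
rewrite sqr_l2normB l2normZ dotpZl gtr0_norm// => h.
rewrite -(ler_pM2l t0) mulrDr mulrA [t * (t^-1 * _)]mulrA divff ?gt_eqF// mul1r.
by nra.
Qed.

Lemma sqr_l2normD_le u v :
  l2norm (u + v) ^+ 2 <= 2 * (l2norm u ^+ 2 + l2norm v ^+ 2).
Proof.
rewrite sqr_l2normD; have := @dotp_young 1 u v ltr01; rewrite invr1 !mul1r; lra.
Qed.

Lemma sqr_l2normD3_le u v w :
  l2norm (u + v + w) ^+ 2 <= 3 * (l2norm u ^+ 2 + l2norm v ^+ 2 + l2norm w ^+ 2).
Proof.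
rewrite sqr_l2normD (sqr_l2normD u v) dotpDl.
have := @dotp_young 1 u v ltr01; have := @dotp_young 1 u w ltr01.
have := @dotp_young 1 v w ltr01; rewrite invr1 !mul1r; lra.
Qed.

Lemma normr_coord_l2norm u j : `|u 0 j| <= l2norm u.
Proof.
rewrite -ler_sqr ?nnegrE ?l2norm_ge0// sqr_l2norm real_normK ?num_real//.
rewrite /dotp (bigD1 j)//= -expr2 lerDl.
by apply: sumr_ge0 => i _; rewrite -expr2 sqr_ge0.
Qed.

End Euclidean.

Section Averages.
Context {R : realType} {n : nat}.
Hypothesis n0 : (0 < n)%N.

Let nR : 0 < n%:R :> R. Proof. by rewrite ltr0n. Qed.

Lemma ler_avg (a b : 'I_n -> R) : (forall i, a i <= b i) -> avg a <= avg b.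
Proof. by move=> h; rewrite ler_wpM2l ?invr_ge0 ?ler0n// ler_sum. Qed.

Lemma avgD (a b : 'I_n -> R) : avg (fun i => a i + b i) = avg a + avg b.
Proof. by rewrite /avg big_split mulrDr. Qed.

Lemma avgN (a : 'I_n -> R) : avg (fun i => - a i) = - avg a.
Proof. by rewrite /avg sumrN mulrN. Qed.

Lemma avgB (a b : 'I_n -> R) : avg (fun i => a i - b i) = avg a - avg b.
Proof. by rewrite avgD avgN. Qed.

Lemma avgZ (t : R) (a : 'I_n -> R) : avg (fun i => t * a i) = t * avg a.
Proof. by rewrite /avg -mulr_sumr mulrCA. Qed.

Lemma avg_cst (t : R) : avg (fun _ : 'I_n => t) = t.
Proof.
by rewrite /avg sumr_const card_ord -[t *+ n]mulr_natl mulrA mulVf ?mul1r// gt_eqF.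
Qed.

Lemma eq_avg (a b : 'I_n -> R) : a =1 b -> avg a = avg b.
Proof. by move=> ab; congr (_ * _); apply: eq_bigr. Qed.

Lemma avg_ge0 (a : 'I_n -> R) : (forall i, 0 <= a i) -> 0 <= avg a.
Proof. by move=> h; rewrite mulr_ge0 ?invr_ge0 ?ler0n// sumr_ge0. Qed.

Lemma ler_avg_cst (a : 'I_n -> R) (t : R) : (forall i, a i <= t) -> avg a <= t.
Proof. by move=> h; rewrite -[leRHS]avg_cst ler_avg. Qed.

Lemma sum_avg K (a : nat -> 'I_n -> R) :
  \sum_(k < K) avg (a k) = avg (fun i => \sum_(k < K) a k i).
Proof. by rewrite /avg -mulr_sumr exchange_big. Qed.

Definition avgv p (x : 'I_n -> 'rV[R]_p) : 'rV[R]_p := n%:R^-1 *: \sum_i x i.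

Lemma avgvD p (x y : 'I_n -> 'rV[R]_p) : avgv (fun i => x i + y i) = avgv x + avgv y.
Proof. by rewrite /avgv big_split scalerDr. Qed.

Lemma avgvN p (x : 'I_n -> 'rV[R]_p) : avgv (fun i => - x i) = - avgv x.
Proof. by rewrite /avgv sumrN scalerN. Qed.

Lemma avgvB p (x y : 'I_n -> 'rV[R]_p) : avgv (fun i => x i - y i) = avgv x - avgv y.
Proof. by rewrite avgvD avgvN. Qed.

Lemma avgvZ p (t : R) (x : 'I_n -> 'rV[R]_p) : avgv (fun i => t *: x i) = t *: avgv x.
Proof. rewrite /avgv [RHS]scalerA mulrC -[RHS]scalerA; congr (_ *: _); by rewrite scaler_sumr. Qed.

Lemma avgv_cst p (x : 'rV[R]_p) : avgv (fun _ => x) = x.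
Proof.
by rewrite /avgv sumr_const card_ord -[x *+ n]scaler_nat scalerA mulVf ?scale1r// gt_eqF.
Qed.

Lemma eq_avgv p (x y : 'I_n -> 'rV[R]_p) : x =1 y -> avgv x = avgv y.
Proof. by move=> ab; congr (_ *: _); apply: eq_bigr. Qed.

Lemma dotp_avgvr p (x : 'I_n -> 'rV[R]_p) v :
  dotp v (avgv x) = avg (fun i => dotp v (x i)).
Proof. by rewrite /avgv dotpZr dotp_sumr. Qed.

Lemma sqr_avg_le (a : 'I_n -> R) : avg a ^+ 2 <= avg (fun i => a i ^+ 2).
Proof.
have : 0 <= avg (fun i => (a i - avg a) ^+ 2) by apply: avg_ge0 => i; exact: sqr_ge0.
have -> : avg (fun i => (a i - avg a) ^+ 2)
    = avg (fun i => a i ^+ 2 - 2 * avg a * a i + avg a ^+ 2).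
  by apply: eq_avg => i; ring.
rewrite (avgD (fun i => a i ^+ 2 - 2 * avg a * a i)) avgB avgZ avg_cst; nra.
Qed.

(** Bias-variance identity: deviations from the mean average to zero, which removes the cross
    term. *)
Lemma avg_dist2 p (x : 'I_n -> 'rV[R]_p) v :
  avg (fun i => l2norm (x i - v) ^+ 2)
  = avg (fun i => l2norm (x i - avgv x) ^+ 2) + l2norm (avgv x - v) ^+ 2.
Proof.
transitivity (avg (fun i => l2norm (x i - avgv x) ^+ 2 +
    (2 * dotp (avgv x - v) (x i - avgv x) + l2norm (avgv x - v) ^+ 2))).
  apply: eq_avg => i.
  rewrite (_ : x i - v = (x i - avgv x) + (avgv x - v)); last by rewrite addrA subrK.
  by rewrite sqr_l2normD dotpC addrA.
by rewrite avgD (avgD (fun i => 2 * _)) avgZ -dotp_avgvr avgvB avgv_cst subrr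
  dotpC dotp0l mulr0 add0r avg_cst.
Qed.

Lemma avg_var_le p (x : 'I_n -> 'rV[R]_p) v :
  avg (fun i => l2norm (x i - avgv x) ^+ 2) <= avg (fun i => l2norm (x i - v) ^+ 2).
Proof. by rewrite (avg_dist2 x v) lerDl sqr_ge0. Qed.

Lemma sqr_l2norm_avgv p (x : 'I_n -> 'rV[R]_p) :
  l2norm (avgv x) ^+ 2 <= avg (fun i => l2norm (x i) ^+ 2).
Proof.
have := avg_dist2 x 0; rewrite subr0; under eq_avg do rewrite subr0.
by move=> ->; rewrite lerDr avg_ge0// => i; exact: sqr_ge0.
Qed.

Lemma l2norm_avgv p (x : 'I_n -> 'rV[R]_p) : l2norm (avgv x) <= avg (fun i => l2norm (x i)).
Proof.
rewrite /avgv l2normZ ger0_norm ?invr_ge0 ?ler0n// ler_wpM2l ?invr_ge0 ?ler0n//.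
elim/big_ind2: _ => //; first by rewrite l2norm0.
by move=> a b c d ab cd; rewrite (le_trans (ler_l2normD _ _))// lerD.
Qed.

End Averages.

(** * Mixing by a doubly stochastic matrix *)

Section Mixing.
Context {R : realType}.

Lemma sqr_l2norm_mx m p (M : 'M[R]_(m, p)) : l2norm M ^+ 2 = \sum_i \sum_j M i j ^+ 2.
Proof.
by rewrite sqr_sqrtr//; apply: sumr_ge0 => i _; apply: sumr_ge0 => j _; exact: sqr_ge0.
Qed.

Lemma sqr_l2norm_rows m p (M : 'M[R]_(m, p)) :
  l2norm M ^+ 2 = \sum_i l2norm (row i M) ^+ 2.
Proof.
rewrite sqr_l2norm_mx; apply: eq_bigr => i _; rewrite sqr_l2norm_mx big_ord1.
by apply: eq_bigr => j _; rewrite mxE.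
Qed.

Lemma l2norm_tr m p (M : 'M[R]_(m, p)) : l2norm M^T = l2norm M.
Proof.
rewrite /l2norm exchange_big; congr Num.sqrt.
by apply: eq_bigr => i _; apply: eq_bigr => j _; rewrite mxE.
Qed.

(** Cauchy-Schwarz in every row. This crude bound serves to show that the set whose supremum defines
    [specnorm] is bounded above. *)
Lemma l2norm_mulmx_le m p (A : 'M[R]_(m, p)) (v : 'cV[R]_p) :
  l2norm (A *m v) <= l2norm A * l2norm v.
Proof.
rewrite -ler_sqr ?nnegrE ?mulr_ge0 ?l2norm_ge0// exprMn.
rewrite (sqr_l2norm_rows (A *m v)) (sqr_l2norm_rows A) mulr_suml.
apply: ler_sum => i _; rewrite -exprMn -l2norm_tr sqr_l2norm_mx !big_ord1 !mxE.
have -> : \sum_j A i j * v j 0 = dotp (row i A) v^T.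
  by apply: eq_bigr => j _; rewrite !mxE.
rewrite -(l2norm_tr v) -real_normK ?num_real// ler_sqr ?nnegrE ?mulr_ge0 ?l2norm_ge0//.
exact: normr_dotp.
Qed.

Lemma l2norm_mulmx_cV m p (A : 'M[R]_(m, p)) (v : 'cV[R]_p) :
  l2norm (A *m v) <= specnorm A * l2norm v.
Proof.
have [v0|v0] := eqVneq (l2norm v) 0.
  by rewrite (le_trans (l2norm_mulmx_le _ _))// v0 !mulr0.
have vp : 0 < l2norm v by rewrite lt_def v0 l2norm_ge0.
rewrite -ler_pdivrMr//.
have scale q (w : 'cV[R]_q) : (l2norm v)^-1 * l2norm w = l2norm ((l2norm v)^-1 *: w).
  by rewrite -[in RHS]l2norm_tr linearZ/= l2normZ l2norm_tr ger0_norm// invr_ge0 ltW.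
rewrite mulrC scale scalemxAr; apply: ub_le_sup; last first.
  by exists ((l2norm v)^-1 *: v) => //=; rewrite -scale mulVf.
exists (l2norm A) => _ [w w1 <-]; rewrite (le_trans (l2norm_mulmx_le _ _))//.
by rewrite ler_piMr ?l2norm_ge0.
Qed.

Lemma l2norm_mulmx_specnorm m p q (A : 'M[R]_(m, p)) (B : 'M[R]_(p, q)) :
  l2norm (A *m B) ^+ 2 <= specnorm A ^+ 2 * l2norm B ^+ 2.
Proof.
rewrite -(l2norm_tr (A *m B)) -(l2norm_tr B) !sqr_l2norm_rows mulr_sumr.
apply: ler_sum => j _; rewrite -!tr_col !l2norm_tr -exprMn.
have sA : 0 <= specnorm A * l2norm (col j B).
  exact: le_trans (l2norm_ge0 _) (l2norm_mulmx_cV _ _).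
by rewrite ler_sqr ?nnegrE ?l2norm_ge0// colE -mulmxA -colE l2norm_mulmx_cV.
Qed.

Variables (n : nat) (W : 'M[R]_n).
Hypothesis n0 : (0 < n)%N.
Hypothesis dsW : doubly_stochastic W.

Lemma avg_row_mixing p (Z : 'M[R]_(n, p)) : avg_row (W *m Z) = avg_row Z.
Proof.
have sumE (M : 'M[R]_(n, p)) : \sum_i row i M = (const_mx 1 : 'rV_n) *m M.
  apply/rowP => j; rewrite summxE mxE; apply: eq_bigr => i _.
  by rewrite !mxE mul1r.
by rewrite /avg_row !sumE mulmxA dsW.2.
Qed.

(** The centred matrix [D] is annihilated by the averaging matrix [J], so mixing acts on it as
    [W - J], whose squared spectral norm is [rhoW W]. *)
Lemma mixing_variance p (Z : 'M[R]_(n, p)) :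
  avg (fun i => l2norm (row i (W *m Z) - avg_row Z) ^+ 2)
  <= rhoW W * avg (fun i => l2norm (row i Z - avg_row Z) ^+ 2).
Proof.
pose D : 'M[R]_(n, p) := \matrix_i (row i Z - avg_row Z).
pose J : 'M[R]_n := const_mx n%:R^-1.
have nR : n%:R != 0 :> R by rewrite pnatr_eq0 -lt0n.
have JD : J *m D = 0.
  apply/matrixP => i j; rewrite !mxE.
  under eq_bigr do rewrite !mxE.
  rewrite -mulr_sumr sumrB sumr_const card_ord -[(_ * _) *+ n]mulr_natl mulrA divff// mul1r.
  rewrite summxE; under [X in _ - X]eq_bigr do rewrite mxE.
  by rewrite subrr mulr0.
have WD i : row i ((W - J) *m D) = row i (W *m Z) - avg_row Z.
  rewrite mulmxBl JD subr0.
  have -> : D = Z - (const_mx 1 : 'cV_n) *m avg_row Z.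
    by apply/row_matrixP => k; rewrite rowK linearB/= row_mul row_const; congr (_ - _);
      apply/rowP => j; rewrite [in RHS]mxE big_ord1 [const_mx _ _ _]mxE mul1r ?ord1.
  rewrite mulmxBr mulmxA dsW.1 linearB/= [row _ (const_mx _ *m _)]row_mul row_const; congr (_ - _).
  by apply/rowP => j; rewrite [in LHS]mxE big_ord1 [const_mx _ _ _]mxE mul1r ?ord1.
rewrite /avg mulrCA ler_wpM2l ?invr_ge0 ?ler0n//.
under eq_bigr do rewrite -WD.
under [X in _ * X]eq_bigr => i _.
  rewrite (_ : row i Z - _ = row i D); last by rewrite rowK.
  over.
by rewrite -!sqr_l2norm_rows l2norm_mulmx_specnorm.
Qed.

(** Mixing preserves the mean, so the whole decrease takes place in the variance. The negative term
    is kept because [track_mix] spends it. *)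
Lemma mixing_dist2 p (Z : 'M[R]_(n, p)) v :
  avg (fun i => l2norm (row i (W *m Z) - v) ^+ 2)
  <= avg (fun i => l2norm (row i Z - v) ^+ 2)
     - (1 - rhoW W) * avg (fun i => l2norm (row i Z - avg_row Z) ^+ 2).
Proof.
have avgE (M : 'M[R]_(n, p)) : avgv (fun i => row i M) = avg_row M by [].
rewrite (avg_dist2 n0 (fun i => row i (W *m Z)) v) (avg_dist2 n0 (fun i => row i Z) v).
rewrite !avgE avg_row_mixing.
by have := mixing_variance Z; lra.
Qed.

Lemma rhoW_ge0 : 0 <= rhoW W. Proof. exact: sqr_ge0. Qed.

End Mixing.

(** * Sums along accumulators *)

Section ScalarSequences.
Context {R : realType}.
Implicit Types (S w psi : nat -> R).

Lemma powR_homo_ge0 (a b e : R) : 0 < a -> a <= b -> 0 <= e -> a `^ e <= b `^ e.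
Proof.
by move=> a0 ab e0; rewrite ge0_ler_powR// nnegrE ltW// (lt_le_trans a0).
Qed.

Lemma powRN_homo (a b e : R) : 0 < a -> a <= b -> 0 <= e -> b `^ (- e) <= a `^ (- e).
Proof.
move=> a0 ab e0; rewrite !powRN lef_pV2 ?posrE ?powR_gt0 ?(lt_le_trans a0)//.
exact: powR_homo_ge0.
Qed.

(** With t = a / b <= 1 and e <= 1 one has t^e >= t: the relative loss of a stepsize is at most the
    relative increment of its accumulator. *)
Lemma powR_ratio_ge (a b e : R) : 0 < a -> a <= b -> e <= 1 ->
  1 - a `^ e * b `^ (- e) <= (b - a) / b.
Proof.
move=> a0 ab e1; have b0 : 0 < b by exact: lt_le_trans a0 ab.
have -> : a `^ e * b `^ (- e) = (a / b) `^ e.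
  by rewrite powRM ?invr_ge0 ?ltW// -powR_inv1 ?ltW// -powRrM mulN1r.
have ab1 : a / b <= 1 by rewrite ler_pdivrMr// mul1r.
have := @ger1_powR _ (a / b) e; rewrite divr_gt0//= => /(_ ab1 e1) h.
by rewrite mulrBl divff ?gt_eqF// lerD2l lerN2.
Qed.

Lemma powR_ratio_le1 (a b e : R) : 0 < a -> a <= b -> 0 <= e ->
  a `^ e * b `^ (- e) <= 1.
Proof.
move=> a0 ab e0; rewrite powRN ler_pdivrMr ?powR_gt0 ?(lt_le_trans a0)// mul1r.
exact: powR_homo_ge0.
Qed.

Lemma ln_increment (a b : R) : 0 < a -> a <= b -> (b - a) / b <= ln b - ln a.
Proof.
move=> a0 ab; have b0 : 0 < b by exact: lt_le_trans a0 ab.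
have ab0 : 0 < a / b by rewrite divr_gt0.
have := @le_ln1Dx _ (a / b - 1); rewrite ltrBrDl subrr => /(_ ab0).
rewrite addrCA subrr addr0 ln_div ?posrE// mulrBl divff ?gt_eqF//; lra.
Qed.

Lemma sum_log S K : 0 < S 0 -> {homo S : i j / (i <= j)%N >-> i <= j} ->
  \sum_(k < K) (S k.+1 - S k) / S k.+1 <= ln (S K) - ln (S 0).
Proof.
move=> S0 Sm; rewrite -(telescope_sumr (fun k => ln (S k)) (leq0n K)) big_mkord.
apply: ler_sum => k _; apply: ln_increment; last exact: Sm.
by rewrite (lt_le_trans S0)// Sm.
Qed.

Lemma powR_between (a t b e : R) : 0 < a -> a <= t -> t <= b -> t `^ e <= a `^ e + b `^ e.
Proof.
move=> a0 at_ tb; have t0 := lt_le_trans a0 at_.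
have [e0|e0] := leP 0 e.
  by rewrite (le_trans (powR_homo_ge0 t0 tb e0))// lerDr powR_ge0.
have := powRN_homo a0 at_ (_ : 0 <= - e); rewrite opprK oppr_ge0 => /(_ (ltW e0)) h.
by rewrite (le_trans h)// lerDl powR_ge0.
Qed.

(* Writing [S^-e = S^(1-e) / S] reduces every exponent to the logarithmic sum. *)
Lemma sum_powR S K (e b : R) : 0 < S 0 -> {homo S : i j / (i <= j)%N >-> i <= j} ->
  S K <= b ->
  \sum_(k < K) (S k.+1 - S k) * S k.+1 `^ (- e)
  <= (S 0 `^ (1 - e) + b `^ (1 - e)) * (ln b - ln (S 0)).
Proof.
move=> S0 Sm Sb; have Sp k : 0 < S k by rewrite (lt_le_trans S0)// Sm.
apply: (@le_trans _ _ ((S 0 `^ (1 - e) + b `^ (1 - e)) *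
    \sum_(k < K) (S k.+1 - S k) / S k.+1)).
  rewrite mulr_sumr; apply: ler_sum => k _.
  have -> : S k.+1 `^ (- e) = S k.+1 `^ (1 - e) / S k.+1.
    rewrite -[X in _ = _ / X]powRr1 ?ltW// -powRB; last by rewrite (gt_eqF (Sp k.+1)) implybT.
    by congr (_ `^ _); ring.
  rewrite mulrCA ler_wpM2r//; last first.
    by rewrite powR_between// ?Sm// (le_trans _ Sb)// Sm.
  by rewrite divr_ge0 ?subr_ge0 ?Sm// ltW.
rewrite ler_wpM2l ?addr_ge0 ?powR_ge0// (le_trans (sum_log K S0 Sm))//.
by rewrite lerD2r ler_ln ?posrE// (lt_le_trans (Sp K)).
Qed.

(** Summation by parts for an energy in [0, m] against growing weights: each increase of the weight
    meets an energy of at most m. The induction carries the slack [m - psi K]. *)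
Lemma abel_sum w psi K (m : R) : {homo w : i j / (i <= j)%N >-> i <= j} ->
  0 <= w 0 -> (forall k, 0 <= psi k <= m) ->
  \sum_(k < K) w k * (psi k - psi k.+1) <= w K * m.
Proof.
move=> wm w0 psim.
have wp k : 0 <= w k by rewrite (le_trans w0)// wm.
suff : \sum_(k < K) w k * (psi k - psi k.+1) <= w K * (m - psi K).
  move=> h; rewrite (le_trans h)// ler_wpM2l// lerBlDr lerDl.
  by have /andP[] := psim K.
elim: K => [|K IH]; first by rewrite big_ord0 mulr_ge0// subr_ge0; have /andP[] := psim 0.
rewrite big_ord_recr/= (le_trans (lerD IH (lexx _)))//.
have -> : w K * (m - psi K) + w K * (psi K - psi K.+1) = w K * (m - psi K.+1) by ring.
by rewrite ler_wpM2r ?wm// subr_ge0; have /andP[] := psim K.+1.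
Qed.

Lemma sum_below_threshold S K (V b : R) : 0 <= S 0 -> 0 <= V ->
  (forall k, 0 <= S k.+1 - S k <= b) ->
  \sum_(k < K) (S k < V)%R%:R * (S k.+1 - S k) <= V + b.
Proof.
move=> S0 V0 Sb.
have b0 : 0 <= b by have /andP[h1 h2] := Sb 0; exact: le_trans h1 h2.
(* The bound by [S K] loads the induction: at a step that still counts, the sum so far is below [V],
   and one more increment adds at most [b]. *)
suff [] : \sum_(k < K) (S k < V)%R%:R * (S k.+1 - S k) <= S K /\
          \sum_(k < K) (S k < V)%R%:R * (S k.+1 - S k) <= V + b by [].
elim: K => [|K [IH1 IH2]]; first by rewrite !big_ord0 addr_ge0.
rewrite !big_ord_recr/=; have /andP[i0 ib] := Sb K.
case: ltP => SV; rewrite /= ?mul1r ?mul0r ?addr0; last by split=> //; lra.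
by split; lra.
Qed.

Lemma contraction_sum (rho : R) S w K : rho < 1 -> (forall k, 0 <= S k) ->
  (forall k, S k.+1 <= (1 - (1 - rho) / 2) * S k + w k) ->
  \sum_(k < K) S k <= 2 / (1 - rho) * (S 0 + \sum_(k < K) w k).
Proof.
move=> r1 S0 Sw; have r0 : 0 < 1 - rho by rewrite subr_gt0.
rewrite mulrAC ler_pdivlMr// mulrC -ler_pdivrMl ?ltr0n// -/(2^-1).
suff : 2^-1 * ((1 - rho) * \sum_(k < K) S k) + S K <= S 0 + \sum_(k < K) w k.
  by move=> h; rewrite (le_trans _ h)// lerDl.
elim: K => [|K IH]; first by rewrite !big_ord0 mulr0 mulr0 add0r addr0.
rewrite !big_ord_recr/=; have := Sw K; lra.
Qed.

End ScalarSequences.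

Section Accumulators.
Context {R : realType} {n : nat}.
Variables (c b e z : R) (S : nat -> 'I_n -> R).
Hypotheses (n0 : (0 < n)%N) (c0 : 0 < c) (e0 : 0 < e) (e1 : e < 1) (z0 : 0 <= z).
Hypothesis S0 : forall i, S 0 i = c.
Hypothesis Sstep : forall k i, 0 <= S k.+1 i - S k i <= b.
Hypothesis Sz : forall k i,
  `|S k i `^ (- e) - avg (S k) `^ (- e)| <= z * avg (S k) `^ (- e).

Lemma acc_homo i : {homo S ^~ i : k l / (k <= l)%N >-> k <= l}.
Proof.
move=> k l; elim: l => [|l IH]; first by rewrite leqn0 => /eqP->.
rewrite leq_eqVlt => /orP[/eqP->//|]; rewrite ltnS => /IH h.
by rewrite (le_trans h)// -subr_ge0; have /andP[] := Sstep l i.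
Qed.

Lemma acc_ge k i : c <= S k i.
Proof. by rewrite -(S0 i) acc_homo. Qed.

Lemma acc_gt0 k i : 0 < S k i.
Proof. exact: lt_le_trans c0 (acc_ge k i). Qed.

Lemma acc_le K i : (0 < K)%N -> S K i <= (c + b) * K%:R.
Proof.
have b0 : 0 <= b by have /andP[h1 h2] := Sstep 0 i; exact: le_trans h1 h2.
have : forall K, S K i <= c + b * K%:R.
  elim=> [|k IH]; first by rewrite S0 mulr0 addr0.
  by have /andP[_] := Sstep k i; rewrite -natr1; lra.
move=> h K0; rewrite (le_trans (h K))// mulrDl lerD2r.
by rewrite -[leLHS]mulr1 ler_wpM2l ?(ltW c0)// ler1n.
Qed.

Lemma acc_avg_homo : {homo (fun k => avg (S k)) : k l / (k <= l)%N >-> k <= l}.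
Proof. by move=> k l kl; apply: ler_avg => i; exact: acc_homo. Qed.

Lemma acc_avg0 : avg (S 0) = c.
Proof. by rewrite (eq_avg (b := fun=> c))// avg_cst. Qed.

Lemma acc_avg_ge k : c <= avg (S k).
Proof. by rewrite -acc_avg0 acc_avg_homo. Qed.

Lemma acc_avg_gt0 k : 0 < avg (S k).
Proof. exact: lt_le_trans c0 (acc_avg_ge k). Qed.

Lemma acc_avg_le K : (0 < K)%N -> avg (S K) <= (c + b) * K%:R.
Proof. by move=> K0; apply: ler_avg_cst => // i; exact: acc_le. Qed.

Lemma acc_ratio_sum K : (0 < K)%N ->
  \sum_(k < K) (avg (S k.+1) - avg (S k)) / avg (S k.+1)
  <= ln ((c + b) * K%:R) - ln c.
Proof.
move=> K0; have := @sum_log _ (fun k => avg (S k)) K (acc_avg_gt0 0) acc_avg_homo.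
move=> /le_trans; apply; rewrite acc_avg0 lerD2r ler_ln ?posrE ?acc_avg_gt0//.
  exact: acc_avg_le.
exact: lt_le_trans (acc_avg_gt0 K) (acc_avg_le K0).
Qed.

Definition incr k := (avg (S k.+1) - avg (S k)) / avg (S k.+1).

Lemma incr_ge0 k : 0 <= incr k.
Proof. by rewrite divr_ge0 ?subr_ge0 ?acc_avg_homo// ltW// acc_avg_gt0. Qed.

Lemma incr_le1 k : incr k <= 1.
Proof.
by rewrite /incr ler_pdivrMr ?acc_avg_gt0// mul1r gerBl ltW// acc_avg_gt0.
Qed.

(* [step_ratio k i] compares the stepsize of node i, which uses the sample of
   iteration k, with the average stepsize before that sample. *)
Definition step_ratio k i := avg (S k) `^ e * S k.+1 i `^ (- e).

Lemma acc_pow_le k i : S k i `^ (- e) <= (1 + z) * avg (S k) `^ (- e).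
Proof. by have := Sz k i; rewrite ler_norml; lra. Qed.

Lemma step_ratio_ge0 k i : 0 <= step_ratio k i.
Proof. by rewrite mulr_ge0 ?powR_ge0. Qed.

Lemma step_ratio_le k i : step_ratio k i <= 1 + z.
Proof.
have h : avg (S k) `^ e * avg (S k.+1) `^ (- e) <= 1.
  by rewrite powR_ratio_le1 ?acc_avg_gt0 ?acc_avg_homo ?ltW.
rewrite (le_trans (ler_wpM2l (powR_ge0 _ _) (acc_pow_le k.+1 i)))//.
by rewrite mulrCA -[leRHS]mulr1 ler_wpM2l// addr_ge0.
Qed.

(** Two sources of deviation: the current sample moves the averaged accumulator, at a cost of its
    relative increment, and node [i] differs from the average, which is what [z] measures. *)
Lemma step_ratio_dist k i : `|step_ratio k i - 1| <= incr k + z.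
Proof.
have h1 : avg (S k) `^ e * avg (S k.+1) `^ (- e) <= 1.
  by rewrite powR_ratio_le1 ?acc_avg_gt0 ?acc_avg_homo ?ltW.
have h2 : 1 - avg (S k) `^ e * avg (S k.+1) `^ (- e) <= incr k.
  by rewrite powR_ratio_ge ?acc_avg_gt0 ?acc_avg_homo ?ltW.
have -> : step_ratio k i - 1 = (avg (S k) `^ e * avg (S k.+1) `^ (- e) - 1)
    + avg (S k) `^ e * (S k.+1 i `^ (- e) - avg (S k.+1) `^ (- e)).
  by rewrite /step_ratio; ring.
rewrite (le_trans (ler_normD _ _))// lerD//.
  by rewrite ler0_norm ?subr_le0//; lra.
rewrite normrM ger0_norm ?powR_ge0//.
rewrite (le_trans (ler_wpM2l (powR_ge0 _ _) (Sz k.+1 i)))//.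
by rewrite mulrCA -[leRHS]mulr1 ler_wpM2l.
Qed.

Lemma avg_homo_pow : {homo (fun k => avg (S k) `^ e) : k l / (k <= l)%N >-> k <= l}.
Proof. by move=> k l kl; rewrite powR_homo_ge0 ?acc_avg_gt0 ?acc_avg_homo ?ltW. Qed.

Lemma acc_avg_pow_le K : (0 < K)%N -> avg (S K) `^ e <= ((c + b) * K%:R) `^ e.
Proof. by move=> K0; rewrite powR_homo_ge0 ?acc_avg_gt0 ?acc_avg_le ?ltW. Qed.

End Accumulators.

Section AccumulatorSum.
Context {R : realType} {n : nat}.
Variables (c b : R) (S : nat -> 'I_n -> R).
Hypotheses (n0 : (0 < n)%N) (c0 : 0 < c).
Hypothesis S0 : forall i, S 0 i = c.
Hypothesis Sstep : forall k i, 0 <= S k.+1 i - S k i <= b.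

Lemma acc_pow_sum K (e : R) : (0 < K)%N ->
  \sum_(k < K) avg (fun i => S k.+1 i `^ (- e) * (S k.+1 i - S k i))
  <= (c `^ (1 - e) + ((c + b) * K%:R) `^ (1 - e)) * (ln ((c + b) * K%:R) - ln c).
Proof.
move=> K0; rewrite (sum_avg K (fun k i => S k.+1 i `^ (- e) * (S k.+1 i - S k i))); apply: ler_avg_cst => // i.
under eq_bigr do rewrite mulrC.
have := @sum_powR _ (S ^~ i) K e ((c + b) * K%:R); rewrite S0; apply => //.
- exact: (acc_homo Sstep).
- exact: (acc_le c0 S0 Sstep).
Qed.

End AccumulatorSum.

(** * Energy estimates along a path *)

Section Variance.
Context {R : realType} {n : nat}.
Hypothesis n0 : (0 < n)%N.

Definition var p (x : 'I_n -> 'rV[R]_p) : R :=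
  avg (fun i => l2norm (x i - avgv x) ^+ 2).

Lemma var_ge0 p (x : 'I_n -> 'rV[R]_p) : 0 <= var x.
Proof. by apply: avg_ge0 => i; exact: sqr_ge0. Qed.

Lemma sqr_l2normD_young p (t : R) (u w : 'rV[R]_p) : 0 < t ->
  l2norm (u + w) ^+ 2 <= (1 + t) * l2norm u ^+ 2 + (1 + t^-1) * l2norm w ^+ 2.
Proof. by move=> t0; rewrite sqr_l2normD; have := dotp_young u w t0; lra. Qed.

Lemma varD_le p (t : R) (a b : 'I_n -> 'rV[R]_p) : 0 < t ->
  var (fun i => a i + b i)
  <= (1 + t) * var a + (1 + t^-1) * avg (fun i => l2norm (b i) ^+ 2).
Proof.
move=> t0; apply: (@le_trans _ _ ((1 + t) * var a + (1 + t^-1) * var b)); last first.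
  rewrite lerD2l ler_wpM2l ?addr_ge0 ?invr_ge0 ?(ltW t0)//.
  have := avg_var_le n0 b 0; under [leRHS]eq_avg do rewrite subr0.
  by [].
rewrite /var -!avgZ -avgD; apply: ler_avg => i.
rewrite avgvD (_ : _ - _ = (a i - avgv a) + (b i - avgv b)).
  exact: sqr_l2normD_young.
by rewrite opprD addrACA.
Qed.

(** Young's inequality with t = (1 - rho) / 2 spends half of the contraction: rho (1 + t) <= 1 -
    t. *)
Lemma var_contraction p (rho : R) (a b : 'I_n -> 'rV[R]_p) : 0 <= rho -> rho < 1 ->
  rho * var (fun i => a i + b i)
  <= (1 - (1 - rho) / 2) * var a + 3 / (1 - rho) * avg (fun i => l2norm (b i) ^+ 2).
Proof.
move=> r0 r1; have s0 : 0 < 1 - rho by rewrite subr_gt0.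
have := @varD_le p ((1 - rho) / 2) a b (divr_gt0 s0 (ltr0n _ 2)).
have B0 : 0 <= avg (fun i => l2norm (b i) ^+ 2) by apply: avg_ge0 => i; exact: sqr_ge0.
have A0 := var_ge0 a.
move: (var _) (var a) (avg _) A0 B0 => V A B A0 B0 h.
rewrite (le_trans (ler_wpM2l r0 h))// mulrDr !mulrA lerD//.
  by rewrite ler_wpM2r//; nra.
rewrite ler_wpM2r// invf_div.
have -> : 3 / (1 - rho) = 1 / (1 - rho) + 2 / (1 - rho) by lra.
have i1 : 1 <= 1 / (1 - rho) by rewrite ler_pdivlMr// mul1r; lra.
have i2 : 0 <= 2 / (1 - rho) by rewrite divr_ge0// ltW.
nra.
Qed.

End Variance.

Lemma maxB_bounds (R : realType) (a b a' b' t : R) :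
  0 <= a' - a <= t -> 0 <= b' - b <= t -> 0 <= Num.max a' b' - Num.max a b <= t.
Proof.
move=> /andP[? ?] /andP[? ?]; rewrite !maxElt.
by case: (ltP a' b') => ?; case: (ltP a b) => ?; apply/andP; split; lra.
Qed.

Lemma ler_sum_nat (R : realType) K (F G : nat -> R) : (forall k, F k <= G k) ->
  \sum_(k < K) F k <= \sum_(k < K) G k.
Proof. by move=> FG; apply: ler_sum. Qed.

(** Common shape of the three per-iteration estimates: a telescoping part [W], a martingale part
    [M], a constant that grows linearly when summed, and weighted remainders. *)
Lemma ler_sum_lincomb (R : realType) K (F W M G1 G2 G3 G4 G5 : nat -> R)
    (t c1 c2 c3 c4 c5 : R) :
  (forall k, F k <= W k + M k + t +
     (c1 * G1 k + c2 * G2 k + c3 * G3 k + c4 * G4 k + c5 * G5 k)) ->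
  \sum_(k < K) F k <= \sum_(k < K) W k + \sum_(k < K) M k + t * K%:R +
    (c1 * \sum_(k < K) G1 k + c2 * \sum_(k < K) G2 k + c3 * \sum_(k < K) G3 k
     + c4 * \sum_(k < K) G4 k + c5 * \sum_(k < K) G5 k).
Proof.
move=> FG; rewrite (le_trans (ler_sum_nat K FG))//.
by rewrite !big_split/= -!mulr_sumr sumr_const card_ord -[t *+ K]mulr_natr.
Qed.

Lemma powRD_gt0 (R : realType) (a r s : R) : 0 < a -> a `^ (r + s) = a `^ r * a `^ s.
Proof. by move=> a0; rewrite powRD// (gt_eqF a0) implybT. Qed.

Lemma sqr1B_le1 (R : realType) (t : R) : 0 < t -> t <= 1 -> (1 - t) ^+ 2 <= 1.
Proof. by move=> ? ?; nra. Qed.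

Lemma weighted_mean (R : realType) (n p : nat) (t : R) (w : 'rV[R]_p)
    (q : 'I_n -> R) (g : 'I_n -> 'rV[R]_p) : (0 < n)%N ->
  (forall i, `|q i - 1| <= t) ->
  `|dotp w (avgv (fun i => q i *: g i)) - dotp w (avgv g)|
  <= l2norm w * (t * avg (fun i => l2norm (g i))).
Proof.
move=> n0 qt; rewrite -dotpBr -avgvB (le_trans (normr_dotp _ _))//.
rewrite ler_wpM2l ?l2norm_ge0// (le_trans (l2norm_avgv _))// -avgZ.
apply: ler_avg => i; rewrite -[X in _ - X]scale1r -scalerBl l2normZ.
by rewrite ler_wpM2r ?l2norm_ge0.
Qed.

(** * Deterministic estimates on one path where the inconsistency bounds hold *)

Section Path.
Context {R : realType} {n p d : nat}.
Variables (L mu C c al be gx gy zv zu Delta m0 D kap LP rho : R).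
Hypotheses (n0 : (0 < n)%N) (L0 : 0 <= L) (mu0 : 0 < mu) (C0 : 0 <= C) (c0 : 0 < c).
Hypotheses (be0 : 0 < be) (beal : be < al) (al1 : al < 1) (gx0 : 0 < gx) (gy0 : 0 < gy).
Hypotheses (zv0 : 0 <= zv) (zu0 : 0 <= zu) (D0 : 0 <= D) (kap0 : 0 <= kap) (LP0 : 0 <= LP).
Hypotheses (rho0 : 0 <= rho) (rho1 : rho < 1).
Variables (x g : nat -> 'I_n -> 'rV[R]_p) (y h : nat -> 'I_n -> 'rV[R]_d).
Variables (mx my : nat -> 'I_n -> R).
Variables (Gx : 'I_n -> 'rV[R]_p -> 'rV[R]_d -> 'rV[R]_p).
Variables (Gy : 'I_n -> 'rV[R]_p -> 'rV[R]_d -> 'rV[R]_d).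
Variables (Y : set 'rV[R]_d) (ys : 'rV[R]_p -> 'rV[R]_d) (phi : 'rV[R]_p -> R).

Let v k i := Num.max (mx k i) (my k i).
Let vb k := avg (v k).
Let ub k := avg (my k).
Let xb k := avgv (x k).
Let yb k := avgv (y k).
Let zx k i := x k i - gx *: (v k.+1 i `^ (- al) *: g k i).
Let zy k i := y k i + gy *: (my k.+1 i `^ (- be) *: h k i).
Let gphi u := avgv (fun i => Gx i u (ys u)).

Hypothesis mx_0 : forall i, mx 0 i = c.
Hypothesis my_0 : forall i, my 0 i = c.
Hypothesis mxS : forall k i, mx k.+1 i = mx k i + l2norm (g k i) ^+ 2.
Hypothesis myS : forall k i, my k.+1 i = my k i + l2norm (h k i) ^+ 2.
Hypothesis gC : forall k i, l2norm (g k i) <= C.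
Hypothesis hC : forall k i, l2norm (h k i) <= C.
Hypothesis vz : forall k i, `|v k i `^ (- al) - vb k `^ (- al)| <= zv * vb k `^ (- al).
Hypothesis uz : forall k i, `|my k i `^ (- be) - ub k `^ (- be)| <= zu * ub k `^ (- be).
Hypothesis xbS : forall k,
  xb k.+1 = xb k - gx *: avgv (fun i => v k.+1 i `^ (- al) *: g k i).
Hypothesis xvarS : forall k, var (x k.+1) <= rho * var (zx k).
Hypothesis yvarS : forall k, var (y k.+1) <= rho * var (zy k).
Hypothesis ydist : forall k w, Y w ->
  avg (fun i => l2norm (y k.+1 i - w) ^+ 2)
  <= avg (fun i => l2norm (zy k i - w) ^+ 2) - (1 - rho) * var (zy k).
Hypothesis yY : forall k i, Y (y k i).
Hypothesis ybY : forall k, Y (yb k).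
Hypothesis ysY : forall u, Y (ys u).
Hypothesis Ydiam : forall w w', Y w -> Y w' -> l2norm (w - w') <= D.
Hypothesis ys_lip : forall u u', l2norm (ys u - ys u') <= kap * l2norm (u - u').
Hypothesis Gx_lip : forall i u u' w w', Y w -> Y w' ->
  l2norm (Gx i u w - Gx i u' w') ^+ 2
  <= L ^+ 2 * (l2norm (u - u') ^+ 2 + l2norm (w - w') ^+ 2).
Hypothesis Gy_lip : forall i u u' w w', Y w -> Y w' ->
  l2norm (Gy i u w - Gy i u' w') ^+ 2
  <= L ^+ 2 * (l2norm (u - u') ^+ 2 + l2norm (w - w') ^+ 2).
Hypothesis Gx_bd : forall i u w, Y w -> l2norm (Gx i u w) <= C.
Hypothesis Gy_mono : forall u w, Y w ->
  dotp (avgv (fun i => Gy i u w)) (w - ys u) <= - (mu / 2) * l2norm (w - ys u) ^+ 2.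
Hypothesis phi_desc : forall u u',
  phi u' <= phi u + dotp (gphi u) (u' - u) + LP * l2norm (u' - u) ^+ 2.
Hypothesis phi_bd : forall u, m0 <= phi u <= m0 + Delta.

(* The dual iterates track [ys (xh k)], where [xh] is a smoothing of [xb] on the
   timescale of the dual stepsizes: no stochastic gradient enters an increment
   of [xh], so that only the Lipschitz continuity of [ys] is needed. *)
Definition th0 := c `^ be / 2.
Let th k := th0 * ub k `^ (- be).

Fixpoint xh k : 'rV[R]_p :=
  if k is k'.+1 then xh k' + th k' *: (xb k' - xh k') else xb 0.

Let r k := xb k - xh k.
Let e k := yb k - ys (xh k).
Let fx k i := Gx i (x k i) (y k i).
Let fy k i := Gy i (x k i) (y k i).

Definition acc_bound K := (c + C ^+ 2) * K%:R.
Definition log_bound K := ln (acc_bound K) - ln c.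
Definition pow_bound s K := (c `^ (1 - s) + acc_bound K `^ (1 - s)) * log_bound K.

Let al0 : 0 < al. Proof. exact: lt_trans be0 beal. Qed.
Let be1 : be < 1. Proof. exact: lt_trans beal al1. Qed.

Let sq_le a b : 0 <= a -> a <= b -> a ^+ 2 <= b ^+ 2 :> R.
Proof. by move=> a0 ab; rewrite ler_sqr// nnegrE// (le_trans a0). Qed.

Let mxSb k i : 0 <= mx k.+1 i - mx k i <= C ^+ 2.
Proof. by rewrite mxS addrAC subrr add0r sqr_ge0 sq_le ?l2norm_ge0. Qed.

Let mySb k i : 0 <= my k.+1 i - my k i <= C ^+ 2.
Proof. by rewrite myS addrAC subrr add0r sqr_ge0 sq_le ?l2norm_ge0. Qed.

Let v_0 i : v 0 i = c. Proof. by rewrite /v mx_0 my_0 maxxx. Qed.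

Let vSb k i : 0 <= v k.+1 i - v k i <= C ^+ 2.
Proof. exact: maxB_bounds. Qed.

Let vbpos k : 0 < vb k. Proof. exact: (acc_avg_gt0 n0 c0 v_0 vSb). Qed.
Let ubpos k : 0 < ub k. Proof. exact: (acc_avg_gt0 n0 c0 my_0 mySb). Qed.
Let vb_ge k : c <= vb k. Proof. exact: (acc_avg_ge n0 v_0 vSb). Qed.
Let ub_ge k : c <= ub k. Proof. exact: (acc_avg_ge n0 my_0 mySb). Qed.

Let ub_le_vb k : ub k <= vb k.
Proof. by apply: ler_avg => i; rewrite /v le_max lexx orbT. Qed.

Let mx_le_v k i : mx k i <= v k i. Proof. by rewrite /v le_max lexx. Qed.
Let mxpos k i : 0 < mx k i. Proof. exact: (acc_gt0 c0 mx_0 mxSb). Qed.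
Let mypos k i : 0 < my k i. Proof. exact: (acc_gt0 c0 my_0 mySb). Qed.

(** * Sums of squared steps and consensus errors *)

(** The squared gradients are the increments of [mx], and [mx <= v], so for s >= 0 the power of [v]
    may be replaced by that of [mx]. *)
Lemma sum_g_pow K s : (0 < K)%N -> 0 <= s ->
  \sum_(k < K) avg (fun i => v k.+1 i `^ (- s) * l2norm (g k i) ^+ 2) <= pow_bound s K.
Proof.
move=> K0 s0; apply: le_trans (acc_pow_sum n0 c0 mx_0 mxSb s K0).
apply: ler_sum => k _; apply: ler_avg => i.
have -> : mx k.+1 i - mx k i = l2norm (g k i) ^+ 2 by rewrite mxS addrAC subrr add0r.
rewrite ler_wpM2r ?sqr_ge0//.
by rewrite powRN_homo.
Qed.

Lemma sum_h_pow K s : (0 < K)%N ->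
  \sum_(k < K) avg (fun i => my k.+1 i `^ (- s) * l2norm (h k i) ^+ 2) <= pow_bound s K.
Proof.
move=> K0; apply: le_trans (acc_pow_sum n0 c0 my_0 mySb s K0).
apply: ler_sum => k _; apply: ler_avg => i.
suff -> : my k.+1 i - my k i = l2norm (h k i) ^+ 2 by [].
by rewrite myS addrAC subrr add0r.
Qed.

Lemma powR2 (a s : R) : (a `^ (- s)) ^+ 2 = a `^ (- (2 * s)).
Proof. by rewrite -powR_mulrn ?powR_ge0// -powRrM; congr (_ `^ _); ring. Qed.

(** One factor 1 / (1 - rho) comes from summing a contraction, the other from Young's inequality in
    [var_contraction]. *)
Lemma sum_xvar K : (0 < K)%N ->
  \sum_(k < K) var (x k)
  <= 2 / (1 - rho) * (var (x 0) + 3 / (1 - rho) * (gx ^+ 2 * pow_bound (2 * al) K)).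
Proof.
move=> K0; have s0 : 0 < 1 - rho by rewrite subr_gt0.
pose w k := 3 / (1 - rho) * (gx ^+ 2 *
   avg (fun i => v k.+1 i `^ (- (2 * al)) * l2norm (g k i) ^+ 2)).
have step k : var (x k.+1) <= (1 - (1 - rho) / 2) * var (x k) + w k.
  rewrite (le_trans (xvarS k))// (le_trans (var_contraction n0 _ _ rho0 rho1))//.
  rewrite lerD2l /w -avgZ; apply: ler_wpM2l; first by rewrite divr_ge0// ltW.
  apply: ler_avg => i; rewrite l2normN !l2normZ gtr0_norm// ger0_norm ?powR_ge0//.
  by rewrite !exprMn powR2.
rewrite (le_trans (contraction_sum K rho1 (fun k => var_ge0 (x k)) step))//.
rewrite ler_wpM2l ?divr_ge0 ?(ltW s0)// lerD2l /w -mulr_sumr ler_wpM2l ?divr_ge0 ?(ltW s0)//.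
rewrite -mulr_sumr ler_wpM2l ?sqr_ge0//; apply: sum_g_pow => //.
by rewrite mulr_ge0// ltW.
Qed.

Lemma sum_yvar K : (0 < K)%N ->
  \sum_(k < K) var (y k)
  <= 2 / (1 - rho) * (var (y 0) + 3 / (1 - rho) * (gy ^+ 2 * pow_bound (2 * be) K)).
Proof.
move=> K0; have s0 : 0 < 1 - rho by rewrite subr_gt0.
pose w k := 3 / (1 - rho) * (gy ^+ 2 *
   avg (fun i => my k.+1 i `^ (- (2 * be)) * l2norm (h k i) ^+ 2)).
have step k : var (y k.+1) <= (1 - (1 - rho) / 2) * var (y k) + w k.
  rewrite (le_trans (yvarS k))// (le_trans (var_contraction n0 _ _ rho0 rho1))//.
  rewrite lerD2l /w -avgZ; apply: ler_wpM2l; first by rewrite divr_ge0// ltW.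
  apply: ler_avg => i; rewrite !l2normZ gtr0_norm// ger0_norm ?powR_ge0//.
  by rewrite !exprMn powR2.
rewrite (le_trans (contraction_sum K rho1 (fun k => var_ge0 (y k)) step))//.
rewrite ler_wpM2l ?divr_ge0 ?(ltW s0)// lerD2l /w -mulr_sumr ler_wpM2l ?divr_ge0 ?(ltW s0)//.
rewrite -mulr_sumr ler_wpM2l ?sqr_ge0//; exact: sum_h_pow.
Qed.

Let q k i := step_ratio al v k i.
Let io k := incr v k.

Let q0 k i : 0 <= q k i. Proof. exact: step_ratio_ge0. Qed.
Let q1 k i : q k i <= 1 + zv. Proof. exact: (step_ratio_le n0 c0 al0 zv0 v_0 vSb vz). Qed.
Let qd k i : `|q k i - 1| <= io k + zv.
Proof. exact: (step_ratio_dist n0 c0 al0 al1 zv0 v_0 vSb vz). Qed.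
Let io0 k : 0 <= io k. Proof. exact: (incr_ge0 n0 c0 v_0 vSb). Qed.
Let io1 k : io k <= 1. Proof. exact: (incr_le1 n0 c0 v_0 vSb). Qed.

Lemma sum_io K : (0 < K)%N -> \sum_(k < K) io k <= log_bound K.
Proof. exact: (acc_ratio_sum n0 c0 v_0 vSb). Qed.

Let yYs u : l2norm (gphi u) <= C.
Proof.
rewrite (le_trans (l2norm_avgv _))//; apply: ler_avg_cst => // i.
exact: Gx_bd.
Qed.

(** * Descent of Phi along the average iterate *)

(** The distance from the points of the nodes to [xb] and [ys (xb k)] splits into consensus errors,
    the tracking error [e], and the lag [r] of [xh] seen through the Lipschitz map [ys]. The factor
    3 is that of a three-term square. *)
Definition grad_err k :=
  L ^+ 2 * (var (x k) + 3 * (var (y k) + l2norm (e k) ^+ 2 + kap ^+ 2 * l2norm (r k) ^+ 2)).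

Lemma fbar_gphi k : l2norm (avgv (fx k) - gphi (xb k)) ^+ 2 <= grad_err k.
Proof.
rewrite /gphi -avgvB (le_trans (sqr_l2norm_avgv n0 _))//.
have step i : l2norm (fx k i - Gx i (xb k) (ys (xb k))) ^+ 2
    <= L ^+ 2 * (l2norm (x k i - xb k) ^+ 2 + 3 * (l2norm (y k i - yb k) ^+ 2
        + (l2norm (e k) ^+ 2 + kap ^+ 2 * l2norm (r k) ^+ 2))).
  rewrite (le_trans (Gx_lip _ _ _ (yY k i) (ysY _)))// ler_wpM2l ?sqr_ge0// lerD2l.
  have -> : y k i - ys (xb k) = (y k i - yb k) + e k + (ys (xh k) - ys (xb k)).
    by rewrite /e !addrA !subrK.
  rewrite (le_trans (sqr_l2normD3_le _ _ _))// ler_wpM2l// -!addrA !lerD2l.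
  by rewrite -exprMn sq_le ?l2norm_ge0// (le_trans (ys_lip _ _))// l2distC.
rewrite (le_trans (ler_avg step))//.
rewrite avgZ avgD avgZ (avgD (fun i => l2norm (y k i - yb k) ^+ 2)) avg_cst//.
by rewrite /grad_err /var -!addrA lexx.
Qed.

Lemma sqr_l2norm_fbar k :
  l2norm (avgv (fx k)) ^+ 2 <= 2 * l2norm (gphi (xb k)) ^+ 2 + 2 * grad_err k.
Proof.
rewrite -[avgv (fx k)](subrK (gphi (xb k))) (le_trans (sqr_l2normD_le _ _))//.
by have := fbar_gphi k; lra.
Qed.


Let wmean k (w : 'rV[R]_p) :
  `|dotp w (avgv (fun i => q k i *: g k i)) - dotp w (avgv (g k))|
  <= l2norm w * ((io k + zv) * avg (fun i => l2norm (g k i))).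
Proof. exact: (weighted_mean w (g k) n0 (qd k)). Qed.

Definition gPhi k := gphi (xb k).

(** The smoothness inequality of Phi is multiplied by the reciprocal of the stepsize built from
    [vb k], which does not involve the current sample. Of the leading squared gradient one eighth
    absorbs the bias [grad_err] and one eighth the inconsistency [zv]; 3/4 is left. *)
Lemma descent_step k :
  3 / 4 * l2norm (gPhi k) ^+ 2 <=
  vb k `^ al / gx * (phi (xb k) - phi (xb k.+1)) + C ^+ 2 * io k + 2 * (zv ^+ 2 * C ^+ 2)
  + LP * gx * (1 + zv) * avg (fun i => v k.+1 i `^ (- al) * l2norm (g k i) ^+ 2)
  + 2 * grad_err k + dotp (gPhi k) (avgv (fx k) - avgv (g k)).
Proof.
set A := avg _.
have w0 : 0 < vb k `^ al by rewrite powR_gt0.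
have Ag : avg (fun i => l2norm (g k i)) <= C by apply: ler_avg_cst.
have Ag0 : 0 <= avg (fun i => l2norm (g k i)) by apply: avg_ge0 => i; exact: l2norm_ge0.
have dx : xb k.+1 - xb k = - (gx *: avgv (fun i => v k.+1 i `^ (- al) *: g k i)).
  by rewrite xbS addrAC subrr add0r.
have h1 := phi_desc (xb k) (xb k.+1); rewrite dx dotpNr dotpZr l2normN l2normZ in h1.
have h2 : vb k `^ al * dotp (gPhi k) (avgv (fun i => v k.+1 i `^ (- al) *: g k i))
   = dotp (gPhi k) (avgv (fun i => q k i *: g k i)).
  by rewrite -dotpZr -avgvZ; congr dotp; apply: eq_avgv => i; rewrite scalerA.
(* One of the two factors [v^-al] combines with [vb^al] into [q <= 1 + zv]; the other stays with the
   squared gradient, in the form summed by [sum_g_pow]. *)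
have h3 : vb k `^ al * l2norm (avgv (fun i => v k.+1 i `^ (- al) *: g k i)) ^+ 2
   <= (1 + zv) * A.
  apply: (@le_trans _ _ (vb k `^ al *
     avg (fun i => l2norm (v k.+1 i `^ (- al) *: g k i) ^+ 2))).
    by rewrite ler_wpM2l ?(ltW w0)// sqr_l2norm_avgv.
  rewrite /A -!avgZ; apply: ler_avg => i.
  rewrite l2normZ ger0_norm ?powR_ge0// exprMn [(v k.+1 i `^ _) ^+ 2]expr2 !mulrA.
  by rewrite !ler_wpM2r ?l2norm_ge0 ?powR_ge0//; exact: q1.
have h4 : vb k `^ al / gx * (phi (xb k.+1) - phi (xb k)) <=
   - dotp (gPhi k) (avgv (fun i => q k i *: g k i)) + LP * gx * (1 + zv) * A.
  have : phi (xb k.+1) - phi (xb k) <= - gx * dotp (gPhi k) (avgv (fun i => v k.+1 i `^ (- al) *: g k i))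
     + LP * (gx ^+ 2 * l2norm (avgv (fun i => v k.+1 i `^ (- al) *: g k i)) ^+ 2).
    by rewrite exprMn real_normK ?num_real// in h1; rewrite /gPhi; lra.
  move=> /(ler_wpM2l (ltW (divr_gt0 w0 gx0))) /le_trans; apply.
  rewrite mulrDr lerD//.
    by rewrite mulNr mulrN -mulrA [gx^-1 * _]mulrA mulVf ?gt_eqF// mul1r h2.
  have -> : vb k `^ al / gx * (LP * (gx ^+ 2 * l2norm (avgv (fun i => v k.+1 i `^ (- al) *: g k i)) ^+ 2))
    = LP * gx * (vb k `^ al * l2norm (avgv (fun i => v k.+1 i `^ (- al) *: g k i)) ^+ 2).
    by field; rewrite gt_eqF.
  by rewrite -[leRHS]mulrA ler_wpM2l// mulr_ge0// ltW.
have h5 := wmean k (gPhi k).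
have h6 := fbar_gphi k; rewrite -/(gPhi k) in h6.
have h7 := @dotp_young _ _ 4^-1 (gPhi k) (gPhi k - avgv (fx k)) _.
rewrite invrK l2distC invr_gt0 ltr0n in h7; have {}h7 := h7 isT.
have N : l2norm (gPhi k) <= C by exact: yYs.
have N0 := l2norm_ge0 (gPhi k).
have h8 : dotp (gPhi k) (avgv (g k)) = l2norm (gPhi k) ^+ 2 - dotp (gPhi k) (gPhi k - avgv (fx k))
   - dotp (gPhi k) (avgv (fx k) - avgv (g k)).
  by rewrite sqr_l2norm !dotpBr; ring.
have h9 : l2norm (gPhi k) * ((io k + zv) * avg (fun i => l2norm (g k i)))
   <= C ^+ 2 * io k + (8^-1 * l2norm (gPhi k) ^+ 2 + 2 * (zv ^+ 2 * C ^+ 2)).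
  rewrite mulrDl mulrDr lerD//.
    by rewrite mulrCA mulrC ler_wpM2r// expr2 ler_pM.
  apply: (@le_trans _ _ (l2norm (gPhi k) * (zv * C))).
    by rewrite ler_wpM2l// ler_wpM2l.
  rewrite -exprMn; have := sqr_ge0 (l2norm (gPhi k) - 4 * (zv * C)); nra.
move: h5; rewrite ler_norml => /andP[h5 _].
have -> : vb k `^ al / gx * (phi (xb k) - phi (xb k.+1)) =
  - (vb k `^ al / gx * (phi (xb k.+1) - phi (xb k))) by ring.
by move: h4 h5 h6 h7 h8 h9; rewrite -/(fx k) -/(gPhi k); lra.
Qed.

Lemma descent K : (0 < K)%N ->
  3 / 4 * \sum_(k < K) l2norm (gPhi k) ^+ 2 <=
  acc_bound K `^ al / gx * Delta + C ^+ 2 * log_bound K + 2 * (zv ^+ 2 * C ^+ 2) * K%:R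
  + LP * gx * (1 + zv) * pow_bound al K + 2 * \sum_(k < K) grad_err k
  + \sum_(k < K) dotp (gPhi k) (avgv (fx k) - avgv (g k)).
Proof.
move=> K0; rewrite mulr_sumr.
have := @ler_sum_lincomb _ K (fun k => 3 / 4 * l2norm (gPhi k) ^+ 2)
  (fun k => vb k `^ al / gx * (phi (xb k) - phi (xb k.+1)))
  (fun k => dotp (gPhi k) (avgv (fx k) - avgv (g k))) io grad_err
  (fun k => avg (fun i => v k.+1 i `^ (- al) * l2norm (g k i) ^+ 2)) (fun=> 0) (fun=> 0)
  (2 * (zv ^+ 2 * C ^+ 2)) (C ^+ 2) 2 (LP * gx * (1 + zv)) 0 0.
move=> /(_ _)/le_trans; apply; first by move=> k; have := descent_step k; lra.
have hW : \sum_(k < K) vb k `^ al / gx * (phi (xb k) - phi (xb k.+1))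
    <= acc_bound K `^ al / gx * Delta.
  have Dl0 : 0 <= Delta by have /andP[h1 h2] := phi_bd 0; lra.
  have psiD k : 0 <= phi (xb k) - m0 <= Delta.
    by have /andP[h1 h2] := phi_bd (xb k); apply/andP; split; lra.
  have hA := @abel_sum _ (fun k => vb k `^ al / gx) (fun k => phi (xb k) - m0) K Delta.
  have e1 : \sum_(k < K) vb k `^ al / gx * (phi (xb k) - phi (xb k.+1))
    = \sum_(k < K) vb k `^ al / gx * ((phi (xb k) - m0) - (phi (xb k.+1) - m0)).
    by apply: eq_bigr => k _; congr (_ * _); ring.
  rewrite e1; apply: le_trans (hA _ _ psiD) _.
  + move=> i j ij; rewrite ler_wpM2r ?invr_ge0 ?(ltW gx0)//.
    exact: (avg_homo_pow n0 c0 al0 v_0 vSb).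
  + by rewrite divr_ge0 ?powR_ge0// ltW.
  + rewrite ler_wpM2r// ler_wpM2r ?invr_ge0 ?(ltW gx0)//.
    exact: (acc_avg_pow_le n0 c0 al0 v_0 vSb).
have h1 : C ^+ 2 * \sum_(k < K) io k <= C ^+ 2 * log_bound K.
  by rewrite ler_wpM2l ?sqr_ge0// sum_io.
have h2 := ler_wpM2l (mulr_ge0 (mulr_ge0 LP0 (ltW gx0)) (addr_ge0 ler01 zv0))
  (sum_g_pow K0 (ltW al0)).
lra.
Qed.

(** * Lag of the smoothed iterate behind the average iterate *)

Let th0_gt0 : 0 < th0. Proof. by rewrite divr_gt0// powR_gt0. Qed.
Let th_gt0 k : 0 < th k. Proof. by rewrite mulr_gt0// powR_gt0. Qed.
(** The factor [c^be] of [th0] compensates the largest possible value [c^-be] of the power of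
    [ub]. *)
Let th_le k : th k <= 2^-1.
Proof.
have := powR_ratio_le1 c0 (ub_ge k) (ltW be0).
by rewrite /th /th0; lra.
Qed.

Let thV k : (th k)^-1 = ub k `^ be / th0.
Proof. by rewrite /th invfM powRN invrK mulrC. Qed.

(** Coefficients that arise in [track_step]: [track_r] from the motion of the target [ys (xh k)],
    [track_n] from the squared dual steps. *)
Definition track_r := kap ^+ 2 * (th0 / gy + 8 / mu * (th0 / gy) ^+ 2).
Definition track_n := (2 + 2 / (1 - rho) + mu / 4 * (gy * c `^ (- be))) * (gy * (1 + zu)).

(** Twice [grad_err] contains 6 L^2 |e|^2, whereas [track] bounds (mu / 2) |e|^2; [ctrack] is the
    quotient. Once [e] is eliminated with it, [cr], [cx] and [cy] are the coefficients of the lag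
    and of the two consensus errors. *)
Definition ctrack := 12 * L ^+ 2 / mu.
Definition cr := 6 * L ^+ 2 * kap ^+ 2 + ctrack * (8 * L ^+ 2 / mu + track_r).
Definition cx := 2 * L ^+ 2 + ctrack * (8 * L ^+ 2 / mu).
Definition cy := 6 * L ^+ 2 + ctrack * (8 * L ^+ 2 / mu + mu / 4).

(* [eps] is small enough to absorb the feedback of the gradients into the drift,
   [V0] is the stepsize threshold beyond which the stepsize ratio is that small. *)
Definition eps := (128 * (cr + 1))^-1.
Definition V0 := (gx / th0 / Num.sqrt eps) `^ (1 / (al - be)).

Let track_r0 : 0 <= track_r.
Proof.
have h1 := divr_ge0 (ltW th0_gt0) (ltW gy0).
exact: mulr_ge0 (sqr_ge0 _) (addr_ge0 h1 (mulr_ge0 (divr_ge0 (ler0n R 8) (ltW mu0)) (sqr_ge0 _))).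
Qed.

Let ctrack0 : 0 <= ctrack.
Proof. exact: divr_ge0 (mulr_ge0 (ler0n R 12) (sqr_ge0 L)) (ltW mu0). Qed.

Let b10 : 0 <= 8 * L ^+ 2 / mu.
Proof. exact: divr_ge0 (mulr_ge0 (ler0n R 8) (sqr_ge0 L)) (ltW mu0). Qed.

Let cr0 : 0 <= cr.
Proof.
exact: addr_ge0 (mulr_ge0 (mulr_ge0 (ler0n R 6) (sqr_ge0 _)) (sqr_ge0 _))
  (mulr_ge0 ctrack0 (addr_ge0 b10 track_r0)).
Qed.

Let eps_gt0 : 0 < eps. Proof. by rewrite invr_gt0 mulr_gt0// ltr_wpDl. Qed.
Let eps0 : 0 <= eps. Proof. exact: ltW. Qed.
Let V00 : 0 < V0.
Proof.
have sp : 0 < Num.sqrt eps by rewrite sqrtr_gt0.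
exact: powR_gt0 _ (divr_gt0 (divr_gt0 gx0 th0_gt0) sp).
Qed.
Let V0_eps : (gx / th0 * V0 `^ (- (al - be))) ^+ 2 <= eps.
Proof.
have sp : 0 < Num.sqrt eps by rewrite sqrtr_gt0.
have gt : 0 < gx / th0 by rewrite divr_gt0.
rewrite /V0 -powRrM mulrN mul1r mulVf ?gt_eqF ?subr_gt0// powR_inv1; last by rewrite divr_ge0// ltW.
have -> : gx / th0 * (gx / th0 / Num.sqrt eps)^-1 = Num.sqrt eps.
  by move: (gx / th0) gt => t t0; field; rewrite !gt_eqF.
by rewrite sqr_sqrtr.
Qed.

(** Value at vb = c of the bound [a_le] on [a k], the ratio of the primal stepsize to [th k]. *)
Definition amax := gx / th0 * c `^ (- (al - be)).
Let a k := gx * vb k `^ (- al) / th k.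
Let chi k : R := (vb k < V0)%R%:R.
Definition rmax := amax * ((1 + zv) * C).

Let gt_ge0 : 0 <= gx / th0. Proof. by rewrite divr_ge0// ltW. Qed.
Let amax0 : 0 <= amax. Proof. by rewrite mulr_ge0// powR_ge0. Qed.
Let a0 k : 0 <= a k.
Proof. by rewrite /a divr_ge0 ?mulr_ge0 ?powR_ge0// ltW. Qed.
Let chi0 k : 0 <= chi k. Proof. exact: ler0n. Qed.

(** Here it matters that [v] is the maximum of both accumulators: [ub <= vb] turns the ratio of the
    stepsizes into a negative power of [vb] alone, since be < al. *)
Let a_le k : a k <= gx / th0 * vb k `^ (- (al - be)).
Proof.
rewrite /a thV (_ : gx * _ * _ = gx / th0 * (ub k `^ be * vb k `^ (- al))); last by ring.
rewrite ler_wpM2l//; have -> : vb k `^ (- (al - be)) = vb k `^ be * vb k `^ (- al).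
  by rewrite -powRD_gt0//; congr (_ `^ _); ring.
by rewrite ler_wpM2r ?powR_ge0// powR_homo_ge0// ltW.
Qed.

Let albe : 0 <= al - be. Proof. by rewrite subr_ge0 ltW. Qed.

Let a_amax k : a k <= amax.
Proof. by rewrite (le_trans (a_le k))// ler_wpM2l// powRN_homo. Qed.

Let a_sq k : a k ^+ 2 <= eps + amax ^+ 2 * chi k.
Proof.
rewrite /chi; case: (ltP (vb k) V0) => hV /=.
  by rewrite mulr1 (le_trans (sq_le (a0 k) (a_amax k)))// lerDr.
rewrite mulr0 addr0 (le_trans _ V0_eps)// sq_le// (le_trans (a_le k))//.
by rewrite ler_wpM2l// powRN_homo.
Qed.

Let Q k := avgv (fun i => q k i *: g k i).

Let Q_le k : l2norm (Q k) <= (1 + zv) * C.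
Proof.
rewrite (le_trans (l2norm_avgv _))//; apply: ler_avg_cst => // i.
by rewrite l2normZ ger0_norm// ler_pM ?l2norm_ge0.
Qed.

Let dxE k : xb k.+1 - xb k = - ((th k * a k) *: Q k).
Proof.
rewrite xbS addrAC subrr add0r; congr (- _).
have -> : th k * a k = gx * vb k `^ (- al).
  by rewrite /a mulrC divfK// gt_eqF.
rewrite -scalerA; congr (_ *: _); rewrite -avgvZ; apply: eq_avgv => i.
rewrite scalerA /q /step_ratio mulrA -/(vb k) -powRD_gt0//.
by rewrite addNr powRr0 mul1r.
Qed.

(** The next lag is a convex combination of [r k] and [- a k *: Q k]. Hence it never exceeds the
    bound [rmax] of the latter. *)
Let rS k : r k.+1 = (1 - th k) *: r k - (th k * a k) *: Q k.
Proof.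
have ab (A B E F : 'rV[R]_p) : A - (B + E) = (F - B) - E + (A - F).
  by apply/rowP => j; rewrite !mxE; ring.
by rewrite -dxE /r scalerBl scale1r; exact: ab.
Qed.

Let rmax0 : 0 <= rmax. Proof. exact: mulr_ge0 amax0 (mulr_ge0 (addr_ge0 ler01 zv0) C0). Qed.

Let r_le k : l2norm (r k) <= rmax.
Proof.
have t1 k' : 0 <= 1 - th k' by have := th_le k'; lra.
elim: k => [|k IH]; first by rewrite /r /= subrr l2norm0.
rewrite rS (le_trans (ler_l2normB _ _))// (l2normZ (1 - th k)) (l2normZ (th k * a k)).
rewrite ger0_norm// ger0_norm; last first.
  by rewrite mulr_ge0// ltW.
have h1 : (1 - th k) * l2norm (r k) <= (1 - th k) * rmax by rewrite ler_wpM2l.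
have h2 : th k * a k * l2norm (Q k) <= th k * rmax.
  by rewrite -mulrA ler_wpM2l ?(ltW (th_gt0 k))// ler_pM ?l2norm_ge0.
lra.
Qed.

Let drift_mart k := 2 * (1 - th k) * a k * dotp (r k) (avgv (fx k) - avgv (g k))
  + 16 * amax ^+ 2 * chi k * avg (fun i => dotp (fx k i) (fx k i - g k i)).

(* Where the stepsize ratio is large ([chi k = 1]) the squared mean gradients are
   traded for the sampled ones, which sum to at most [V0 + C ^+ 2] before [vb]
   reaches [V0]; this accounts for the second term of [drift_mart]. *)
Lemma drift_step k :
  5 / 8 * l2norm (r k) ^+ 2 <=
  ub k `^ be / th0 * (l2norm (r k) ^+ 2 - l2norm (r k.+1) ^+ 2)
  + 8 * (amax ^+ 2 * C ^+ 2) * io k + 8 * eps * l2norm (avgv (fx k)) ^+ 2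
  + 8 * eps * (zv ^+ 2 * C ^+ 2)
  + 8 * (amax ^+ 2 * (1 + zv ^+ 2)) * (chi k * avg (fun i => l2norm (g k i) ^+ 2))
  + gx * amax * (1 + zv) * avg (fun i => v k.+1 i `^ (- al) * l2norm (g k i) ^+ 2)
  + drift_mart k.
Proof.
set A := avg (fun i => v k.+1 i `^ (- al) * _); set G2 := avg (fun i => l2norm (g k i) ^+ 2).
set G1 := avg (fun i => l2norm (g k i)).
have t0 := th_gt0 k; have t2 := th_le k.
have G10 : 0 <= G1 by apply: avg_ge0 => i; exact: l2norm_ge0.
have G1C : G1 <= C by apply: ler_avg_cst.
have G12 : G1 ^+ 2 <= G2 by exact: sqr_avg_le.
have G20 : 0 <= G2 by apply: avg_ge0 => i; exact: sqr_ge0.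
have h1 : th k * a k ^+ 2 * l2norm (Q k) ^+ 2 <= gx * amax * (1 + zv) * A.
  have -> : th k * a k ^+ 2 * l2norm (Q k) ^+ 2 = gx * a k * (vb k `^ (- al) * l2norm (Q k) ^+ 2).
    by rewrite /a; field; rewrite gt_eqF.
  have A0 : 0 <= (1 + zv) * A.
    by rewrite mulr_ge0 ?addr_ge0// avg_ge0// => i; rewrite mulr_ge0 ?powR_ge0 ?sqr_ge0.
  have : vb k `^ (- al) * l2norm (Q k) ^+ 2 <= (1 + zv) * A.
    rewrite (le_trans (ler_wpM2l (powR_ge0 _ _) (sqr_l2norm_avgv n0 _)))// /A -!avgZ.
    apply: ler_avg => i; rewrite (l2normZ (q k i)) ger0_norm// exprMn.
    have qE : vb k `^ (- al) * q k i = v k.+1 i `^ (- al).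
      rewrite /q /step_ratio mulrA -/(vb k) -powRD_gt0//.
      by rewrite addNr powRr0 mul1r.
    have -> : vb k `^ (- al) * (q k i ^+ 2 * l2norm (g k i) ^+ 2)
       = q k i * (vb k `^ (- al) * q k i * l2norm (g k i) ^+ 2) by ring.
    by rewrite qE ler_wpM2r// mulr_ge0 ?powR_ge0 ?sqr_ge0.
  move=> h2; rewrite -[leRHS]mulrA; apply: ler_pM.
  - exact: mulr_ge0 (ltW gx0) (a0 k).
  - exact: mulr_ge0 (powR_ge0 _ _) (sqr_ge0 _).
  - by rewrite ler_pM2l. 
  - exact: h2.
have h2 := wmean k (r k).
(* The square of the recursion [rS], divided by [th k]; the bound (1 - th)^2 <= 1 - th leaves
   exactly one |r|^2 on the left. *)
have h3 : l2norm (r k) ^+ 2 <= ub k `^ be / th0 * (l2norm (r k) ^+ 2 - l2norm (r k.+1) ^+ 2)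
    - 2 * (1 - th k) * a k * dotp (r k) (Q k) + th k * a k ^+ 2 * l2norm (Q k) ^+ 2.
  have thE : th k * (ub k `^ be / th0) = 1 by rewrite -thV mulfV// gt_eqF.
  rewrite -(ler_pM2l t0) (_ : th k * (_ - _ + _) =
    th k * (ub k `^ be / th0) * (l2norm (r k) ^+ 2 - l2norm (r k.+1) ^+ 2)
    + th k * (th k * a k ^+ 2 * l2norm (Q k) ^+ 2 - 2 * (1 - th k) * a k * dotp (r k) (Q k)));
    last by ring.
  rewrite thE mul1r.
  rewrite rS (sqr_l2normB ((1 - th k) *: r k) ((th k * a k) *: Q k)).
  rewrite (l2normZ (1 - th k)) (l2normZ (th k * a k)) dotpZl (dotpZr (th k * a k)).
  rewrite (exprMn _ _ (l2norm (r k))) (exprMn _ _ (l2norm (Q k))) !real_normK ?num_real//.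
  have s0 := sqr_ge0 (l2norm (r k)).
  have : (1 - th k) ^+ 2 * l2norm (r k) ^+ 2 <= (1 - th k) * l2norm (r k) ^+ 2.
    by rewrite ler_wpM2r// expr2 ler_piMr; lra.
  lra.
(* Here and in [h5] and [h6] one eighth of |r|^2 is spent on Young's inequality, which leaves
   5/8. *)
have h4 : - (2 * (1 - th k) * a k * dotp (r k) (avgv (fx k)))
    <= 8^-1 * l2norm (r k) ^+ 2 + 8 * (a k ^+ 2 * l2norm (avgv (fx k)) ^+ 2).
  have := @dotp_young _ _ 8^-1 (r k) (- ((1 - th k) * a k) *: avgv (fx k)) _.
  rewrite invr_gt0 ltr0n => /(_ isT); rewrite dotpZr l2normZ normrN exprMn real_normK ?num_real//.
  rewrite invrK exprMn.
  have s0 : 0 <= a k ^+ 2 * l2norm (avgv (fx k)) ^+ 2 by rewrite mulr_ge0 ?sqr_ge0.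
  have : (1 - th k) ^+ 2 * (a k ^+ 2 * l2norm (avgv (fx k)) ^+ 2)
     <= a k ^+ 2 * l2norm (avgv (fx k)) ^+ 2.
    by rewrite ler_piMl// sqr1B_le1// (le_trans t2)//; lra.
  lra.
have h5 : 2 * (a k * (l2norm (r k) * (io k * G1)))
    <= 8^-1 * l2norm (r k) ^+ 2 + 8 * (amax ^+ 2 * C ^+ 2) * io k.
  have : a k * (io k * G1) <= amax * C * io k.
    have : io k * G1 <= io k * C by rewrite ler_wpM2l.
    move=> /(ler_pM (a0 k) (mulr_ge0 (io0 k) G10) (a_amax k)); lra.
  have : (amax * C * io k) ^+ 2 <= (amax ^+ 2 * C ^+ 2) * io k.
    have -> : (amax * C * io k) ^+ 2 = amax ^+ 2 * C ^+ 2 * (io k * io k) by ring.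
    have ii : io k * io k <= io k by have := io0 k; have := io1 k; move: (io k) => t; nra.
    exact: ler_wpM2l (mulr_ge0 (sqr_ge0 _) (sqr_ge0 _)) _ _ ii.
  have := l2norm_ge0 (r k); have := mulr_ge0 (mulr_ge0 amax0 C0) (io0 k).
  have -> : a k * (l2norm (r k) * (io k * G1)) = l2norm (r k) * (a k * (io k * G1)) by ring.
  move: (l2norm (r k)) (amax * C * io k) (a k * (io k * G1)) => rr B B' B0 rr0 hB hB'.
  have := ler_wpM2l rr0 hB'; have := sqr_ge0 (rr - 8 * B); lra.
have h6 : 2 * (a k * (l2norm (r k) * (zv * G1)))
    <= 8^-1 * l2norm (r k) ^+ 2 + 8 * (a k ^+ 2 * (zv ^+ 2 * G1 ^+ 2)).
  have := sqr_ge0 (l2norm (r k) - 8 * (a k * (zv * G1))); rewrite -!exprMn; lra.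
have h7 : a k ^+ 2 * (zv ^+ 2 * G1 ^+ 2)
    <= eps * (zv ^+ 2 * C ^+ 2) + amax ^+ 2 * zv ^+ 2 * (chi k * G2).
  have z2 := sqr_ge0 zv.
  apply: le_trans (ler_wpM2r _ (a_sq k)) _; first by rewrite mulr_ge0 ?sqr_ge0.
  rewrite mulrDl lerD//.
    by rewrite ler_wpM2l// ler_wpM2l// sq_le.
  have -> : amax ^+ 2 * zv ^+ 2 * (chi k * G2) = amax ^+ 2 * chi k * (zv ^+ 2 * G2) by ring.
  by have := ler_wpM2l (mulr_ge0 (sqr_ge0 amax) (chi0 k)) (ler_wpM2l z2 G12).
have h8 : a k ^+ 2 * l2norm (avgv (fx k)) ^+ 2
    <= eps * l2norm (avgv (fx k)) ^+ 2
    + amax ^+ 2 * (2 * chi k * avg (fun i => dotp (fx k i) (fx k i - g k i)) + chi k * G2).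
  apply: le_trans (ler_wpM2r (sqr_ge0 _) (a_sq k)) _.
  (* Expanding |f - g|^2 >= 0 at each node gives |f|^2 <= 2 <f, f - g> + |g|^2, where the inner
     product has mean zero given the past. *)
  have hh : l2norm (avgv (fx k)) ^+ 2
      <= 2 * avg (fun i => dotp (fx k i) (fx k i - g k i)) + G2.
    rewrite (le_trans (sqr_l2norm_avgv n0 _))// /G2 -avgZ -avgD; apply: ler_avg => i.
    have := sqr_ge0 (l2norm (fx k i - g k i)).
    by rewrite (sqr_l2normB (fx k i)) (dotpBr (fx k i)) -(sqr_l2norm (fx k i)); lra.
  have := ler_wpM2l (mulr_ge0 (sqr_ge0 amax) (chi0 k)) hh; lra.
have h9 : - (2 * (1 - th k) * a k * dotp (r k) (Q k)) <=
   - (2 * (1 - th k) * a k * dotp (r k) (avgv (g k)))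
   + 2 * (a k * (l2norm (r k) * ((io k + zv) * G1))).
  move: h2; rewrite -/(Q k) -/G1 ler_norml => /andP[h2 _].
  have : (1 - th k) * a k * (dotp (r k) (avgv (g k)) - dotp (r k) (Q k))
     <= a k * (l2norm (r k) * ((io k + zv) * G1)).
    have c1 : 0 <= (1 - th k) * a k by rewrite mulr_ge0//; lra.
    have c2 : (1 - th k) * a k <= a k by rewrite ler_piMl//; lra.
    have c3 : 0 <= l2norm (r k) * ((io k + zv) * G1).
      exact: mulr_ge0 (l2norm_ge0 _) (mulr_ge0 (addr_ge0 (io0 k) zv0) G10).
    have c4 : dotp (r k) (avgv (g k)) - dotp (r k) (Q k) <= l2norm (r k) * ((io k + zv) * G1) by lra.
    by rewrite (le_trans (ler_wpM2l c1 c4))// ler_wpM2r.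
  lra.
rewrite /drift_mart dotpBr; lra.
Qed.

Lemma drift K : (0 < K)%N ->
  5 / 8 * \sum_(k < K) l2norm (r k) ^+ 2 <=
  acc_bound K `^ be / th0 * rmax ^+ 2
  + 8 * (amax ^+ 2 * C ^+ 2) * log_bound K
  + 8 * eps * \sum_(k < K) l2norm (avgv (fx k)) ^+ 2
  + 8 * eps * (zv ^+ 2 * C ^+ 2) * K%:R
  + 8 * (amax ^+ 2 * (1 + zv ^+ 2)) * (V0 + C ^+ 2)
  + gx * amax * (1 + zv) * pow_bound al K
  + \sum_(k < K) drift_mart k.
Proof.
move=> K0; rewrite mulr_sumr.
have := @ler_sum_lincomb _ K (fun k => 5 / 8 * l2norm (r k) ^+ 2)
  (fun k => ub k `^ be / th0 * (l2norm (r k) ^+ 2 - l2norm (r k.+1) ^+ 2))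
  drift_mart io (fun k => l2norm (avgv (fx k)) ^+ 2)
  (fun k => chi k * avg (fun i => l2norm (g k i) ^+ 2))
  (fun k => avg (fun i => v k.+1 i `^ (- al) * l2norm (g k i) ^+ 2)) (fun=> 0)
  (8 * eps * (zv ^+ 2 * C ^+ 2)) (8 * (amax ^+ 2 * C ^+ 2)) (8 * eps)
  (8 * (amax ^+ 2 * (1 + zv ^+ 2))) (gx * amax * (1 + zv)) 0.
move=> /(_ _)/le_trans; apply; first by move=> k; have := drift_step k; lra.
have hW : \sum_(k < K) ub k `^ be / th0 * (l2norm (r k) ^+ 2 - l2norm (r k.+1) ^+ 2)
    <= acc_bound K `^ be / th0 * rmax ^+ 2.
  have psiD k : 0 <= l2norm (r k) ^+ 2 <= rmax ^+ 2.
    by rewrite sqr_ge0 sq_le ?l2norm_ge0.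
  have hA := @abel_sum _ (fun k => ub k `^ be / th0) (fun k => l2norm (r k) ^+ 2) K (rmax ^+ 2).
  apply: le_trans (hA _ _ psiD) _.
  + move=> i j ij; rewrite ler_wpM2r ?invr_ge0 ?(ltW th0_gt0)//.
    exact: (avg_homo_pow n0 c0 be0 my_0 mySb).
  + by rewrite divr_ge0 ?powR_ge0// ltW.
  + rewrite ler_wpM2r ?sqr_ge0// ler_wpM2r ?invr_ge0 ?(ltW th0_gt0)//.
    exact: (acc_avg_pow_le n0 c0 be0 my_0 mySb).
have c1 : 0 <= 8 * (amax ^+ 2 * C ^+ 2).
  exact: mulr_ge0 (ler0n _ 8) (mulr_ge0 (sqr_ge0 _) (sqr_ge0 _)).
have {c1} h1 := ler_wpM2l c1 (sum_io K0).
have h3 : \sum_(k < K) chi k * avg (fun i => l2norm (g k i) ^+ 2) <= V0 + C ^+ 2.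
  have inc k : avg (mx k.+1) - avg (mx k) = avg (fun i => l2norm (g k i) ^+ 2).
    by rewrite -avgB; apply: eq_avg => i; rewrite mxS addrAC subrr add0r.
  have bd k : 0 <= avg (mx k.+1) - avg (mx k) <= C ^+ 2.
    rewrite inc; apply/andP; split; first by apply: avg_ge0 => i; exact: sqr_ge0.
    by apply: ler_avg_cst => // i; rewrite sq_le ?l2norm_ge0.
  have := @sum_below_threshold _ (fun k => avg (mx k)) K V0 (C ^+ 2).
  move=> /(_ (ltW (acc_avg_gt0 n0 c0 mx_0 mxSb 0)) (ltW V00) bd); apply: le_trans.
  apply: ler_sum => k _; rewrite inc ler_wpM2r//.
    by apply: avg_ge0 => i; exact: sqr_ge0.
  (* The threshold is set on [vb], but the summed increments are those of the average of [mx]; since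
     that average is at most [vb], it is below [V0] whenever [chi k] is 1. *)
  rewrite /chi ler_nat; have mv : avg (mx k) <= vb k by apply: ler_avg.
  by case: (ltP (vb k) V0) => // /(le_lt_trans mv) ->.
have c3 : 0 <= 8 * (amax ^+ 2 * (1 + zv ^+ 2)).
  exact: mulr_ge0 (ler0n _ 8) (mulr_ge0 (sqr_ge0 _) (addr_ge0 ler01 (sqr_ge0 _))).
have {c3} h3 := ler_wpM2l c3 h3.
have c4 : 0 <= gx * amax * (1 + zv).
  exact: mulr_ge0 (mulr_ge0 (ltW gx0) amax0) (addr_ge0 ler01 zv0).
have h4 := ler_wpM2l c4 (sum_g_pow K0 (ltW al0)).
lra.
Qed.


(** * Tracking of the maximizer at the smoothed iterate *)

Let qy k i := step_ratio be my k i.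
Let ioy k := incr my k.
Let eta k := gy * ub k `^ (- be).
Let s k i := gy *: (my k.+1 i `^ (- be) *: h k i).
Let Nk k := avg (fun i => l2norm (s k i) ^+ 2).
Let Ek k := avg (fun i => l2norm (y k i - ys (xh k)) ^+ 2).

Let qy0 k i : 0 <= qy k i. Proof. exact: step_ratio_ge0. Qed.
Let qy1 k i : qy k i <= 1 + zu. Proof. exact: (step_ratio_le n0 c0 be0 zu0 my_0 mySb uz). Qed.
Let qyd k i : `|qy k i - 1| <= ioy k + zu.
Proof. exact: (step_ratio_dist n0 c0 be0 be1 zu0 my_0 mySb uz). Qed.
Let ioy0 k : 0 <= ioy k. Proof. exact: (incr_ge0 n0 c0 my_0 mySb). Qed.
Let eta_gt0 k : 0 < eta k. Proof. by rewrite mulr_gt0// powR_gt0. Qed.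
Let etaV k : (eta k)^-1 = ub k `^ be / gy.
Proof. by rewrite /eta invfM powRN invrK mulrC. Qed.
Let Nk0 k : 0 <= Nk k. Proof. by apply: avg_ge0 => i; exact: sqr_ge0. Qed.

Let sumioy K : (0 < K)%N -> \sum_(k < K) ioy k <= log_bound K.
Proof. exact: (acc_ratio_sum n0 c0 my_0 mySb). Qed.

Let EkE k : Ek k = var (y k) + l2norm (e k) ^+ 2.
Proof. exact: (avg_dist2 n0 (y k) (ys (xh k))). Qed.

Let Ek_bd k : 0 <= Ek k <= D ^+ 2.
Proof.
rewrite avg_ge0/=; last by move=> i; exact: sqr_ge0.
by apply: ler_avg_cst => // i; rewrite sq_le ?l2norm_ge0// Ydiam.
Qed.

Let zy_dist k : avg (fun i => l2norm (zy k i - ys (xh k)) ^+ 2)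
  = Ek k + (2 * avg (fun i => dotp (y k i - ys (xh k)) (s k i)) + Nk k).
Proof.
rewrite /Ek /Nk -avgZ -!avgD; apply: eq_avg => i.
have -> : zy k i - ys (xh k) = (y k i - ys (xh k)) + s k i by rewrite /zy addrAC.
by rewrite sqr_l2normD addrA.
Qed.

(** The pairing of the steps with the consensus deviations is only of first order in the stepsize.
    It is paid by the variance that mixing removes, at the cost of Nk / (1 - rho); what survives is
    the pairing of the mean step with [e]. *)
Lemma track_mix k :
  avg (fun i => l2norm (y k.+1 i - ys (xh k)) ^+ 2)
  <= Ek k + 2 * dotp (e k) (avgv (s k)) + (2 + 2 / (1 - rho)) * Nk k.
Proof.
have s0 : 0 < 1 - rho by rewrite subr_gt0.
have h1 := ydist k (ysY (xh k)); rewrite zy_dist in h1.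
have h2 : avg (fun i => dotp (y k i - ys (xh k)) (s k i))
    = avg (fun i => dotp (y k i - yb k) (s k i)) + dotp (e k) (avgv (s k)).
  rewrite dotp_avgvr -avgD; apply: eq_avg => i; rewrite -dotpDl; congr dotp.
  by rewrite /e addrA subrK.
have h3 : 2 * avg (fun i => dotp (y k i - yb k) (s k i))
    <= (1 - rho) / 2 * var (y k) + 2 / (1 - rho) * Nk k.
  rewrite /var /Nk -!avgZ -avgD; apply: ler_avg => i.
  have := @dotp_young _ _ ((1 - rho) / 2) (y k i - yb k) (s k i) (divr_gt0 s0 (ltr0n _ 2)).
  by rewrite invf_div.
have h4 : var (y k) <= 2 * var (zy k) + 2 * Nk k.
  have -> : y k = (fun i => zy k i + - s k i) by apply/funext => i; rewrite /zy addrK.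
  rewrite (le_trans (varD_le n0 (zy k) (fun i => - s k i) ltr01))//.
  have sN : avg (fun i => l2norm (- s k i) ^+ 2) = Nk k.
    by apply: eq_avg => i; rewrite l2normN.
  by rewrite invr1 sN; lra.
have N0 := Nk0 k; have V1 := ler_wpM2l (ltW s0) h4.
have N1 := mulr_ge0 rho0 N0.
move: h1 h2 h3 N0 V1 N1; move: (avg _) (Nk k) (var (y k)) (var (zy k)) => u1 u2 u3 u4.
lra.
Qed.

(** Used only for the surplus (mu / 8) E' that Young's inequality creates in [track_step], where a
    constant factor is affordable. *)
Lemma track_crude k :
  avg (fun i => l2norm (y k.+1 i - ys (xh k)) ^+ 2) <= 2 * (Ek k + Nk k).
Proof.
have s0 : 0 < 1 - rho by rewrite subr_gt0.
have h1 := ydist k (ysY (xh k)); rewrite zy_dist in h1.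
have h2 : 2 * avg (fun i => dotp (y k i - ys (xh k)) (s k i)) <= Ek k + Nk k.
  rewrite /Ek /Nk -avgZ -avgD; apply: ler_avg => i.
  by have := @dotp_young _ _ 1 (y k i - ys (xh k)) (s k i) ltr01; rewrite invr1 !mul1r.
have := mulr_ge0 (ltW s0) (var_ge0 (zy k)); lra.
Qed.

(** Strong concavity at [xh] and [yb] yields - mu |e|^2. The inconsistency [zu] and the displacement
    of the nodes from that point each take back mu / 8, and the diameter [D] bounds the term with
    the relative increment. *)
Lemma track_mean k :
  2 * dotp (e k) (avgv (fun i => qy k i *: h k i)) <=
  - (3 / 4) * mu * l2norm (e k) ^+ 2 + 8 / mu * (zu ^+ 2 * C ^+ 2) + 2 * D * C * ioy k
  + 8 * L ^+ 2 / mu * (var (x k) + l2norm (r k) ^+ 2 + var (y k))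
  + 2 * dotp (e k) (avgv (h k) - avgv (fy k)).
Proof.
have h1 := weighted_mean (e k) (h k) n0 (qyd k).
have H1 : avg (fun i => l2norm (h k i)) <= C by apply: ler_avg_cst.
have H0 : 0 <= avg (fun i => l2norm (h k i)) by apply: avg_ge0 => i; exact: l2norm_ge0.
have eD : l2norm (e k) <= D by exact: Ydiam (ybY k) (ysY _).
have e0 := l2norm_ge0 (e k).
have mp : 0 < mu / 8 by rewrite divr_gt0.
have h2 : 2 * (l2norm (e k) * (ioy k * avg (fun i => l2norm (h k i)))) <= 2 * D * C * ioy k.
  have := ler_pM (mulr_ge0 e0 (ioy0 k)) H0 (ler_wpM2r (ioy0 k) eD) H1; lra.
have h3 : 2 * (l2norm (e k) * (zu * avg (fun i => l2norm (h k i))))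
   <= mu / 8 * l2norm (e k) ^+ 2 + 8 / mu * (zu ^+ 2 * C ^+ 2).
  have a1 := ler_wpM2l e0 (ler_wpM2l zu0 H1).
  have : 2 * (l2norm (e k) * (zu * C)) <= mu / 8 * l2norm (e k) ^+ 2 + 8 / mu * (zu ^+ 2 * C ^+ 2).
    rewrite -(ler_pM2l mp) mulrDr (_ : mu / 8 * (8 / mu * (zu ^+ 2 * C ^+ 2)) = (zu * C) ^+ 2).
      by have := sqr_ge0 (mu / 8 * l2norm (e k) - zu * C); lra.
    by field; rewrite gt_eqF.
  lra.
pose T := avgv (fun i => Gy i (xh k) (yb k)).
have h4 : dotp (e k) T <= - (mu / 2) * l2norm (e k) ^+ 2.
  by rewrite dotpC; exact: Gy_mono (ybY k).
have h5 : l2norm (avgv (fy k) - T) ^+ 2 <= L ^+ 2 * (var (x k) + l2norm (r k) ^+ 2 + var (y k)).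
  rewrite /T -avgvB (le_trans (sqr_l2norm_avgv n0 _))//.
  rewrite (_ : var (x k) + l2norm (r k) ^+ 2 = avg (fun i => l2norm (x k i - xh k) ^+ 2)); last first.
    by rewrite (avg_dist2 n0 (x k) (xh k)).
  rewrite /var -avgD -avgZ; apply: ler_avg => i.
  exact: Gy_lip (yY k i) (ybY k).
have h6 := dotp_young (e k) (avgv (fy k) - T) mp.
rewrite invf_div in h6.
have h7 := ler_wpM2l (ltW (divr_gt0 (ltr0n R 8) mu0)) h5.
move: h1; rewrite ler_norml => /andP[_ h1].
move: h6; rewrite !dotpBr => h6.
by rewrite mulrDl mulrDr in h1; lra.
Qed.

(** The smoothing rate is proportional to the dual stepsize, th = (th0 / gy) eta. A target moving by
    at most kap th |r| therefore costs, after Young's inequality with parameter mu eta / 8 and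
    division by eta, a constant multiple of |r|^2. The surplus of that inequality lowers 3/4 mu to
    mu / 2. *)
Lemma track_step k :
  mu / 2 * l2norm (e k) ^+ 2 <=
  ub k `^ be / gy * (Ek k - Ek k.+1)
  + 8 / mu * (zu ^+ 2 * C ^+ 2) + 2 * D * C * ioy k
  + 8 * L ^+ 2 / mu * var (x k) + (8 * L ^+ 2 / mu + track_r) * l2norm (r k) ^+ 2
  + (8 * L ^+ 2 / mu + mu / 4) * var (y k)
  + track_n * avg (fun i => my k.+1 i `^ (- be) * l2norm (h k i) ^+ 2)
  + 2 * dotp (e k) (avgv (h k) - avgv (fy k)).
Proof.
set A := avg (fun i => my k.+1 i `^ (- be) * _).
set E' := avg (fun i => l2norm (y k.+1 i - ys (xh k)) ^+ 2).
have t0 := eta_gt0 k; have etaNV : (eta k)^-1 * eta k = 1 by rewrite mulVf// gt_eqF.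
have etaVge : 0 <= (eta k)^-1 by rewrite invr_ge0 ltW.
have sE : avgv (s k) = eta k *: avgv (fun i => qy k i *: h k i).
  rewrite -avgvZ; apply: eq_avgv => i; rewrite /s !scalerA; congr (_ *: _).
  rewrite /eta /qy /step_ratio -mulrA; congr (_ * _).
  by rewrite mulrA -/(ub k) -powRD_gt0// addNr powRr0 mul1r.
have NA : (eta k)^-1 * Nk k <= gy * (1 + zu) * A.
  rewrite /Nk /A -!avgZ; apply: ler_avg => i.
  rewrite /s !(l2normZ gy) !(l2normZ (my _ _ `^ _)) !exprMn !real_normK ?num_real//.
  rewrite etaV (_ : _ * _ = gy * (ub k `^ be * my k.+1 i `^ (- be)
     * (my k.+1 i `^ (- be) * l2norm (h k i) ^+ 2))); last by field; rewrite gt_eqF.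
  rewrite -[leRHS]mulrA ler_pM2l//; have := qy1 k i; rewrite /qy /step_ratio -/(ub k) => hq.
  apply: ler_wpM2r => //; by rewrite mulr_ge0 ?powR_ge0 ?sqr_ge0.
have N0 := Nk0 k.
have A0 : 0 <= A by apply: avg_ge0 => i; rewrite mulr_ge0 ?powR_ge0 ?sqr_ge0.
have eta_le : eta k <= gy * c `^ (- be).
  by rewrite /eta ler_wpM2l ?(ltW gy0)// powRN_homo// ltW.
have N1 : Nk k <= gy * c `^ (- be) * (gy * (1 + zu) * A).
  have -> : Nk k = eta k * ((eta k)^-1 * Nk k) by rewrite mulrA divff ?mul1r// gt_eqF.
  by apply: ler_pM eta_le NA; [exact: ltW|exact: mulr_ge0].
have h1 := track_mix k; rewrite -/E' sE dotpZr in h1.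
have {h1} h1 : (eta k)^-1 * E' <= (eta k)^-1 * Ek k
   + 2 * dotp (e k) (avgv (fun i => qy k i *: h k i)) + (2 + 2 / (1 - rho)) * (gy * (1 + zu) * A).
  have s0 : 0 <= 1 - rho by rewrite subr_ge0 ltW.
  have a2 := ler_wpM2l (addr_ge0 (ler0n R 2) (divr_ge0 (ler0n R 2) s0)) NA.
  have a1 := ler_wpM2l etaVge h1.
  have a3 (X : R) : (eta k)^-1 * (2 * (eta k * X)) = 2 * X.
    by rewrite mulrCA [(eta k)^-1 * _]mulrA etaNV mul1r.
  by have a4 := a3 (dotp (e k) (avgv (fun i => qy k i *: h k i))); lra.
have h2 := track_mean k.
have h3 := track_crude k; rewrite -/E' EkE in h3.
have lam0 : 0 < mu * eta k / 8 by rewrite divr_gt0// mulr_gt0.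
have h4 : Ek k.+1 <= (1 + mu * eta k / 8) * E'
    + (1 + (mu * eta k / 8)^-1) * (kap ^+ 2 * (th k ^+ 2 * l2norm (r k) ^+ 2)).
  rewrite /Ek /E' -[X in _ <= _ + X](avg_cst n0) -avgZ -avgD; apply: ler_avg => i.
  have -> : y k.+1 i - ys (xh k.+1) = (y k.+1 i - ys (xh k)) + (ys (xh k) - ys (xh k.+1)).
    by rewrite addrA subrK.
  rewrite (le_trans (sqr_l2normD_young _ _ lam0))// lerD2l ler_wpM2l//.
    by rewrite addr_ge0// invr_ge0 ltW.
  rewrite -!exprMn sq_le ?l2norm_ge0// (le_trans (ys_lip _ _))// ler_wpM2l//.
  have -> : xh k - xh k.+1 = - (th k *: r k) by rewrite /= opprD addrA subrr add0r.
  by rewrite l2normN l2normZ ger0_norm// ltW.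
have h5 : (eta k)^-1 * ((1 + (mu * eta k / 8)^-1) * (kap ^+ 2 * (th k ^+ 2 * l2norm (r k) ^+ 2)))
    <= track_r * l2norm (r k) ^+ 2.
  have thE : th k = th0 / gy * eta k by rewrite /th /eta; field; rewrite gt_eqF.
  have -> : (eta k)^-1 * ((1 + (mu * eta k / 8)^-1) * (kap ^+ 2 * (th k ^+ 2 * l2norm (r k) ^+ 2)))
    = kap ^+ 2 * (th0 / gy * th k + 8 / mu * (th0 / gy) ^+ 2) * l2norm (r k) ^+ 2.
    by rewrite thE; field; rewrite !gt_eqF.
  rewrite ler_wpM2r ?sqr_ge0// /track_r ler_wpM2l ?sqr_ge0// lerD2r.
  have := ler_wpM2l (divr_ge0 (ltW th0_gt0) (ltW gy0)) (th_le k).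
  by have := divr_ge0 (ltW th0_gt0) (ltW gy0); lra.
have h6 := ler_wpM2l etaVge h4; rewrite mulrDr in h6.
have h7 : (eta k)^-1 * ((1 + mu * eta k / 8) * E') = (eta k)^-1 * E' + mu / 8 * E'.
  by field; rewrite gt_eqF.
have h8 := ler_wpM2l (ltW (divr_gt0 mu0 (ltr0n _ 8))) h3.
have h9 := ler_wpM2l (ltW (divr_gt0 mu0 (ltr0n _ 4))) N1.
rewrite -etaV /track_n; lra.
Qed.

Lemma track K : (0 < K)%N ->
  mu / 2 * \sum_(k < K) l2norm (e k) ^+ 2 <=
  acc_bound K `^ be / gy * D ^+ 2
  + 8 / mu * (zu ^+ 2 * C ^+ 2) * K%:R + 2 * D * C * log_bound K
  + 8 * L ^+ 2 / mu * \sum_(k < K) var (x k)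
  + (8 * L ^+ 2 / mu + track_r) * \sum_(k < K) l2norm (r k) ^+ 2
  + (8 * L ^+ 2 / mu + mu / 4) * \sum_(k < K) var (y k)
  + track_n * pow_bound be K
  + \sum_(k < K) 2 * dotp (e k) (avgv (h k) - avgv (fy k)).
Proof.
move=> K0; rewrite mulr_sumr.
have := @ler_sum_lincomb _ K (fun k => mu / 2 * l2norm (e k) ^+ 2)
  (fun k => ub k `^ be / gy * (Ek k - Ek k.+1))
  (fun k => 2 * dotp (e k) (avgv (h k) - avgv (fy k))) ioy (fun k => var (x k))
  (fun k => l2norm (r k) ^+ 2) (fun k => var (y k))
  (fun k => avg (fun i => my k.+1 i `^ (- be) * l2norm (h k i) ^+ 2))
  (8 / mu * (zu ^+ 2 * C ^+ 2)) (2 * D * C) (8 * L ^+ 2 / mu) (8 * L ^+ 2 / mu + track_r)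
  (8 * L ^+ 2 / mu + mu / 4) track_n.
move=> /(_ _)/le_trans; apply; first by move=> k; have := track_step k; lra.
have hW : \sum_(k < K) ub k `^ be / gy * (Ek k - Ek k.+1) <= acc_bound K `^ be / gy * D ^+ 2.
  have hA := @abel_sum _ (fun k => ub k `^ be / gy) Ek K (D ^+ 2).
  apply: le_trans (hA _ _ Ek_bd) _.
  + move=> i j ij; rewrite ler_wpM2r ?invr_ge0 ?(ltW gy0)//.
    exact: (avg_homo_pow n0 c0 be0 my_0 mySb).
  + by rewrite divr_ge0 ?powR_ge0// ltW.
  + rewrite ler_wpM2r ?sqr_ge0// ler_wpM2r ?invr_ge0 ?(ltW gy0)//.
    exact: (acc_avg_pow_le n0 c0 be0 my_0 mySb).
have h1 := ler_wpM2l (mulr_ge0 (mulr_ge0 (ler0n R 2) D0) C0) (sumioy K0).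
have c4 : 0 <= track_n.
  have s0 : 0 <= 1 - rho by rewrite subr_ge0 ltW.
  have g1 := ltW gy0; have m1 := ltW mu0.
  exact: mulr_ge0 (addr_ge0 (addr_ge0 (ler0n R 2) (divr_ge0 (ler0n R 2) s0))
    (mulr_ge0 (divr_ge0 m1 (ler0n R 4)) (mulr_ge0 g1 (powR_ge0 _ _))))
    (mulr_ge0 g1 (addr_ge0 ler01 zu0)).
have h4 := ler_wpM2l c4 (sum_h_pow be K0).
lra.
Qed.


(** * Closing the system of energy inequalities *)

(** Remainders of [descent], [track], [drift] and of the consensus sums. The contributions of [zv]
    and [zu] that are linear in K are kept apart from them. *)
Definition term1 K := acc_bound K `^ al / gx * Delta + C ^+ 2 * log_bound K
  + LP * gx * (1 + zv) * pow_bound al K.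
Definition term2 K := acc_bound K `^ be / gy * D ^+ 2 + 2 * D * C * log_bound K
  + track_n * pow_bound be K.
Definition term3 K := acc_bound K `^ be / th0 * rmax ^+ 2
  + 8 * (amax ^+ 2 * C ^+ 2) * log_bound K
  + 8 * (amax ^+ 2 * (1 + zv ^+ 2)) * (V0 + C ^+ 2)
  + gx * amax * (1 + zv) * pow_bound al K.
Definition term_var gam s v0 K :=
  2 / (1 - rho) * (v0 + 3 / (1 - rho) * (gam ^+ 2 * pow_bound (2 * s) K)).
(** The weights are those of the three inequalities in [path_bound]: the tracking inequality enters
    once directly and once more, with factor 16 eps cr, through the drift. *)
Definition mart k := dotp (gPhi k) (avgv (fx k) - avgv (g k))
  + (1 + 16 * (eps * cr)) * ctrack * (2 * dotp (e k) (avgv (h k) - avgv (fy k)))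
  + 2 * cr * drift_mart k.

(** The system is circular: descent needs [grad_err], this needs the lag, and the bound of the lag
    contains mean gradients, hence again the gradient of Phi and [grad_err]. Since eps cr <= 1/128,
    the gradients return with a factor 32 eps cr <= 1/4, which is taken from the 3/4 of
    [descent]. *)
Lemma path_bound K : (0 < K)%N ->
  2^-1 * \sum_(k < K) l2norm (gPhi k) ^+ 2 <=
  term1 K + 2 * cr * term3 K + 2 * (ctrack * term2 K)
  + 2 * (cx * term_var gx al (var (x 0)) K + cy * term_var gy be (var (y 0)) K)
  + 108 * ((zv ^+ 2 + (L / mu) ^+ 2 * zu ^+ 2) * C ^+ 2) * K%:R
  + \sum_(k < K) mart k.
Proof.
move=> K0; have h1 := descent K0; have h2 := track K0; have h3 := drift K0.
have hx := sum_xvar K0; have hy := sum_yvar K0.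
have hfb : \sum_(k < K) l2norm (avgv (fx k)) ^+ 2
    <= 2 * \sum_(k < K) l2norm (gPhi k) ^+ 2 + 2 * \sum_(k < K) grad_err k.
  by rewrite !mulr_sumr -big_split; apply: ler_sum => k _; exact: sqr_l2norm_fbar.
have hge : \sum_(k < K) grad_err k = L ^+ 2 * (\sum_(k < K) var (x k)
   + 3 * (\sum_(k < K) var (y k) + \sum_(k < K) l2norm (e k) ^+ 2
     + kap ^+ 2 * \sum_(k < K) l2norm (r k) ^+ 2)).
  rewrite (mulr_sumr _ _ _ (kap ^+ 2)) -!big_split/= (mulr_sumr _ _ _ 3) -big_split/=.
  by rewrite mulr_sumr.
have hmart : \sum_(k < K) mart k =
    \sum_(k < K) dotp (gPhi k) (avgv (fx k) - avgv (g k))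
  + (1 + 16 * (eps * cr)) * ctrack * \sum_(k < K) 2 * dotp (e k) (avgv (h k) - avgv (fy k))
  + 2 * cr * \sum_(k < K) drift_mart k.
  by rewrite (mulr_sumr _ _ _ (_ * ctrack)) (mulr_sumr _ _ _ (2 * cr)) -!big_split.
have SG0 : 0 <= \sum_(k < K) l2norm (gPhi k) ^+ 2 by apply: sumr_ge0 => k _; exact: sqr_ge0.
have Sr0 : 0 <= \sum_(k < K) l2norm (r k) ^+ 2 by apply: sumr_ge0 => k _; exact: sqr_ge0.
have SX0 : 0 <= \sum_(k < K) var (x k) by apply: sumr_ge0 => k _; exact: var_ge0.
have SY0 : 0 <= \sum_(k < K) var (y k) by apply: sumr_ge0 => k _; exact: var_ge0.
have lb0 : 0 <= log_bound K by apply: le_trans (sumioy K0); exact: sumr_ge0.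
have tn0 : 0 <= track_n.
  have s0 : 0 <= 1 - rho by rewrite subr_ge0 ltW.
  have g1 := ltW gy0; have m1 := ltW mu0.
  exact: mulr_ge0 (addr_ge0 (addr_ge0 (ler0n R 2) (divr_ge0 (ler0n R 2) s0))
    (mulr_ge0 (divr_ge0 m1 (ler0n R 4)) (mulr_ge0 g1 (powR_ge0 _ _))))
    (mulr_ge0 g1 (addr_ge0 ler01 zu0)).
have T20 : 0 <= term2 K.
  apply: addr_ge0; last exact: mulr_ge0 tn0 (mulr_ge0 (addr_ge0 (powR_ge0 _ _) (powR_ge0 _ _)) lb0).
  apply: addr_ge0; last exact: mulr_ge0 (mulr_ge0 (mulr_ge0 (ler0n R 2) D0) C0) lb0.
  exact: mulr_ge0 (divr_ge0 (powR_ge0 _ _) (ltW gy0)) (sqr_ge0 _).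
have om0 : 0 <= eps * cr := mulr_ge0 eps0 cr0.
have om1 : eps * cr <= 128^-1.
  rewrite /eps invfM -mulrA ler_piMr ?invr_ge0// mulrC ler_pdivrMr ?ltr_wpDl// mul1r lerDl//.
have z0 : 0 <= zv ^+ 2 * C ^+ 2 * K%:R by rewrite !mulr_ge0 ?sqr_ge0.
have w0 : 0 <= (L / mu) ^+ 2 * zu ^+ 2 * C ^+ 2 * K%:R.
  exact: mulr_ge0 (mulr_ge0 (mulr_ge0 (sqr_ge0 _) (sqr_ge0 _)) (sqr_ge0 _)) (ler0n R K).
have cx0 : 0 <= cx := addr_ge0 (mulr_ge0 (ler0n R 2) (sqr_ge0 _)) (mulr_ge0 ctrack0 b10).
have cy0 : 0 <= cy.
  exact: addr_ge0 (mulr_ge0 (ler0n R 6) (sqr_ge0 _))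
    (mulr_ge0 ctrack0 (addr_ge0 b10 (divr_ge0 (ltW mu0) (ler0n R 4)))).
have {}hx := ler_wpM2l cx0 hx; have {}hy := ler_wpM2l cy0 hy.
have {}h2 := ler_wpM2l ctrack0 h2.
rewrite -/(term_var gx al (var (x 0)) K) in hx.
rewrite -/(term_var gy be (var (y 0)) K) in hy.
set Tx := term_var _ _ _ _ in hx *; set Ty := term_var _ _ _ _ in hy *.
rewrite hmart.
set M1 := \sum_(k < K) dotp (gPhi k) _ in h1 *.
set M2 := \sum_(k < K) 2 * dotp (e k) _ in h2 *.
set M3 := \sum_(k < K) drift_mart k in h3 *.
set SG := \sum_(k < K) l2norm (gPhi k) ^+ 2 in h1 hfb SG0 *.
set Sge := \sum_(k < K) grad_err k in h1 hfb hge.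
set Sfb := \sum_(k < K) l2norm (avgv (fx k)) ^+ 2 in h3 hfb.
set SX := \sum_(k < K) var (x k) in h2 hge SX0 hx.
set SY := \sum_(k < K) var (y k) in h2 hge SY0 hy.
set Se := \sum_(k < K) l2norm (e k) ^+ 2 in h2 hge.
set Sr := \sum_(k < K) l2norm (r k) ^+ 2 in h2 h3 hge Sr0.
set z := zv ^+ 2 * C ^+ 2 * K%:R in z0; set w := (L / mu) ^+ 2 * zu ^+ 2 * C ^+ 2 * K%:R in w0.
(* [H] bounds the part of twice [Sge] other than [cr * Sr]. *)
pose H := ctrack * term2 K + 96 * w + cx * SX + cy * SY + ctrack * M2.
have {h1} h1 : 3 / 4 * SG <= term1 K + 2 * z + 2 * Sge + M1.
  by move: h1; rewrite /term1 /z; lra.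
have {h3} h3 : 5 / 8 * Sr <= term3 K + 8 * eps * Sfb + 8 * eps * z + M3.
  by move: h3; rewrite /term3 /z; lra.
have {h2} hH : 2 * Sge <= cr * Sr + H.
  have e1 : ctrack * (mu / 2 * Se) = 6 * L ^+ 2 * Se.
    by rewrite /ctrack; field; rewrite gt_eqF.
  have e2 : ctrack * (8 / mu * (zu ^+ 2 * C ^+ 2) * K%:R) = 96 * w.
    by rewrite /ctrack /w; field; rewrite gt_eqF.
  rewrite e1 in h2; rewrite hge /H /cr /cx /cy; rewrite /term2.
  move: h2 e2; rewrite !mulrDr => h2 e2; lra.
have {h3} h3 : 2^-1 * Sr <= term3 K + 16 * (eps * SG) + 8 * (eps * H) + 8 * (eps * z) + M3.
  have a1 := ler_wpM2l eps0 hfb; have a2 := ler_wpM2l eps0 hH.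
  have a3 := ler_wpM2r Sr0 om1; lra.
have {h3} h3 := ler_wpM2l cr0 h3.
have a1 := ler_wpM2r SG0 om1; have a2 := ler_wpM2r z0 om1.
have a3 : (eps * cr) * (ctrack * term2 K + 96 * w + cx * SX + cy * SY)
   <= 128^-1 * (ctrack * term2 K + 96 * w + cx * SX + cy * SY).
  apply: ler_wpM2r om1; apply: addr_ge0; last exact: mulr_ge0.
  apply: addr_ge0; last exact: mulr_ge0.
  by apply: addr_ge0; apply: mulr_ge0.
have e3 : (eps * cr) * H = (eps * cr) * (ctrack * term2 K + 96 * w + cx * SX + cy * SY)
   + (eps * cr) * (ctrack * M2) by rewrite /H; ring.
have p1 := mulr_ge0 ctrack0 T20; have p2 := mulr_ge0 cx0 SX0; have p3 := mulr_ge0 cy0 SY0.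
(* The tracking inequality contributes 12 * 8 = 96 times w, and its total weight 1 + 16 eps cr is at
   most 9/8; this gives 108. The factor of z is smaller. *)
have -> : 108 * ((zv ^+ 2 + (L / mu) ^+ 2 * zu ^+ 2) * C ^+ 2) * K%:R = 108 * z + 108 * w.
  by rewrite /z /w; ring.
rewrite /H in hH h3 e3.
lra.
Qed.

(* The coefficients of the gradient noise in [mart]; they depend on the past only. *)
Definition cofx k i := gPhi k + (2 * cr * (2 * (1 - th k) * a k)) *: r k
  + (2 * cr * (16 * amax ^+ 2 * chi k)) *: fx k i.
Definition cofy k := (- (2 * (1 + 16 * (eps * cr)) * ctrack)) *: e k.

Lemma martE k : mart k = avg (fun i =>
  dotp (cofx k i) (fx k i - g k i) + dotp (cofy k) (fy k i - h k i)).
Proof.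
have E w : dotp w (avgv (fx k) - avgv (g k)) = avg (fun i => dotp w (fx k i - g k i)).
  by rewrite -avgvB dotp_avgvr.
have E2 : dotp (e k) (avgv (h k) - avgv (fy k)) = - avg (fun i => dotp (e k) (fy k i - h k i)).
  by rewrite -dotp_avgvr avgvB -dotpNr opprB.
transitivity (avg (fun i => dotp (gPhi k) (fx k i - g k i)
   + (2 * cr * (2 * (1 - th k) * a k)) * dotp (r k) (fx k i - g k i)
   + (2 * cr * (16 * amax ^+ 2 * chi k)) * dotp (fx k i) (fx k i - g k i)
   + (- (2 * (1 + 16 * (eps * cr)) * ctrack)) * dotp (e k) (fy k i - h k i))).
  by rewrite !avgD !avgZ /mart /drift_mart !E E2; ring.
apply: eq_avg => i; rewrite /cofx /cofy (dotpDl (gPhi k + _)) (dotpDl (gPhi k)).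
by rewrite (dotpZl _ (r k)) (dotpZl _ (fx k i)) (dotpZl _ (e k)).
Qed.

(* [rmax] bounds [r k] only on the paths where the stepsize inconsistency is
   controlled; this bound holds on every path. *)
Lemma r_le_linear k : l2norm (r k) <= k%:R * (gx * (c `^ (- al) * C)).
Proof.
elim: k => [|k IH]; first by rewrite /r /= subrr l2norm0 mul0r.
have -> : r k.+1 = (1 - th k) *: r k + (xb k.+1 - xb k).
  have ab (A B E F : 'rV[R]_p) : A - (B + E) = (F - B) - E + (A - F).
    by apply/rowP => j; rewrite !mxE; ring.
  by rewrite /r scalerBl scale1r; exact: ab.
have t1 := th_le k; have t0 := th_gt0 k.
rewrite -natr1 mulrDl mul1r (le_trans (ler_l2normD _ _))// lerD//.
  rewrite l2normZ ger0_norm; last lra.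
  by rewrite (le_trans _ IH)// ler_piMl ?l2norm_ge0//; lra.
rewrite xbS addrAC subrr add0r l2normN l2normZ gtr0_norm// ler_wpM2l ?(ltW gx0)//.
rewrite (le_trans (l2norm_avgv _))//; apply: ler_avg_cst => // i.
rewrite l2normZ ger0_norm ?powR_ge0// ler_pM ?powR_ge0 ?l2norm_ge0//.
by rewrite powRN_homo ?(ltW al0)// (acc_ge v_0 vSb).
Qed.

(** A deterministic bound for each [k]; its growth in [k] is harmless, since it serves only for
    integrability. *)
Lemma cofx_bd k i : l2norm (cofx k i) <=
  C + 2 * cr * (2 * amax) * (k%:R * (gx * (c `^ (- al) * C))) + 2 * cr * (16 * amax ^+ 2) * C.
Proof.
have t1 := th_le k; have t0 := th_gt0 k.
have c2 : 0 <= 2 * cr := mulr_ge0 (ler0n R 2) cr0.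
have u0 : 0 <= 2 * (1 - th k) by lra.
have u1 : 0 <= 2 * cr * (2 * (1 - th k) * a k) := mulr_ge0 c2 (mulr_ge0 u0 (a0 k)).
have h0 : 0 <= 16 * amax ^+ 2 := mulr_ge0 (ler0n R 16) (sqr_ge0 _).
have u2 : 0 <= 2 * cr * (16 * amax ^+ 2 * chi k) := mulr_ge0 c2 (mulr_ge0 h0 (chi0 k)).
rewrite (le_trans (ler_l2normD _ _))// lerD//.
  rewrite (le_trans (ler_l2normD _ _))// lerD//; first exact: yYs.
  rewrite l2normZ ger0_norm//; apply: ler_pM => //; [exact: l2norm_ge0| |exact: r_le_linear].
  by rewrite ler_wpM2l// ler_pM//; lra.
rewrite l2normZ ger0_norm//; apply: ler_pM => //; [exact: l2norm_ge0| |exact/Gx_bd/yY].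
by rewrite ler_wpM2l// ler_piMr// /chi lern1; case: (_ < _).
Qed.

Lemma cofy_bd k : l2norm (cofy k) <= `|2 * (1 + 16 * (eps * cr)) * ctrack| * D.
Proof. by rewrite l2normZ normrN ler_wpM2l//; exact: Ydiam (ybY k) (ysY _). Qed.

End Path.

(** * Rate of the deterministic terms *)

Section Rate.
Context {R : realType}.
Variables (C c al be : R).
Hypotheses (C0 : 0 <= C) (c0 : 0 < c) (be0 : 0 < be) (beal : be < al) (al1 : al < 1).

Let M := c + C ^+ 2.

(** K times the sum of the first and the last of the four powers in the claim (see [rate_div]),
    because the estimates are for sums over the iterations. *)
Definition rate rho K : R := K%:R `^ al + K%:R `^ (1 - be) / (1 - rho).

Definition admissible (rho : R) (K : nat) :=
  [/\ 0 <= rho, rho < 1, (0 < K)%N & ((1 - rho)^-1) ^+ 2 <= K%:R `^ be].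

(** [B] is chosen before [rho] and [K]; this is the uniformity demanded of the hidden factors. A
    single logarithm is allowed. *)
Definition dominated (F : R -> nat -> R) := exists2 B : R, 0 <= B &
  forall rho K, admissible rho K -> F rho K <= B * ((1 + ln K%:R) * rate rho K).

Section Facts.
Variables (rho : R) (K : nat).
Hypothesis adm : admissible rho K.

Let K1 : 1 <= K%:R :> R. Proof. by case: adm => _ _ K0 _; rewrite ler1n. Qed.
Let K0 : 0 < K%:R :> R. Proof. exact: lt_le_trans ltr01 K1. Qed.
Let s0 : 0 < 1 - rho. Proof. by case: adm => _ r1 _ _; rewrite subr_gt0. Qed.
Let w1 : 1 <= (1 - rho)^-1.
Proof. by case: adm => r0 _ _ _; rewrite invf_ge1//; lra. Qed.
Let w2 : (1 - rho)^-1 ^+ 2 <= K%:R `^ be. Proof. by case: adm. Qed.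
Let w12 : (1 - rho)^-1 <= (1 - rho)^-1 ^+ 2.
Proof. by rewrite expr2 -[leLHS]mulr1 ler_wpM2l// invr_ge0 ltW. Qed.

Lemma rate_main : K%:R `^ (1 - be) / (1 - rho) <= rate rho K.
Proof. by rewrite /rate lerDr powR_ge0. Qed.

Lemma rate_pow s : s <= al -> K%:R `^ s <= rate rho K.
Proof.
move=> sal; rewrite /rate (@le_trans _ _ (K%:R `^ al))//.
  exact: ler_powR.
by rewrite lerDl divr_ge0 ?powR_ge0// ltW.
Qed.

Lemma rate_ge1 : 1 <= rate rho K.
Proof. by rewrite -(powRr0 (K%:R : R)) rate_pow// ltW// (lt_trans be0). Qed.

Lemma rate_inv2 : (1 - rho)^-1 ^+ 2 <= rate rho K.
Proof. by rewrite (le_trans w2)// rate_pow// ltW. Qed.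

Lemma rate_inv : (1 - rho)^-1 <= rate rho K.
Proof. exact: le_trans w12 rate_inv2. Qed.

Lemma rate_inv_pow s : be <= s -> (1 - rho)^-1 * K%:R `^ (1 - s) <= rate rho K.
Proof.
move=> bes; rewrite (le_trans _ rate_main)// [leRHS]mulrC ler_wpM2l ?invr_ge0 ?(ltW s0)//.
by rewrite ler_powR//; lra.
Qed.

(** The condition on K acts here: one of the two factors (1 - rho)^-1 is at most K^be <= K^s, which
    raises K^(1 - 2s) to K^(1 - s). *)
Lemma rate_inv2_pow s : be <= s -> (1 - rho)^-1 ^+ 2 * K%:R `^ (1 - 2 * s) <= rate rho K.
Proof.
move=> bes; rewrite (le_trans _ (rate_inv_pow bes))// expr2 -mulrA.
rewrite ler_wpM2l ?invr_ge0 ?(ltW s0)//.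
rewrite (le_trans (ler_wpM2r (powR_ge0 _ _) (le_trans w12 w2)))//.
by rewrite -powRD_gt0// ler_powR//; lra.
Qed.

Lemma log1_ge1 : 1 <= 1 + ln K%:R :> R.
Proof. by rewrite lerDl ln_ge0. Qed.

Lemma acc_boundE : acc_bound C c K = M * K%:R. Proof. by []. Qed.

Let M0 : 0 < M. Proof. by rewrite /M ltr_pwDl// sqr_ge0. Qed.

Lemma log_bound_le : log_bound C c K <= (1 + (ln M - ln c)) * (1 + ln K%:R).
Proof.
have cM : 0 <= ln M - ln c.
  by rewrite subr_ge0 ler_ln ?posrE// /M lerDl sqr_ge0.
have l0 := ln_ge0 K1.
rewrite /log_bound acc_boundE lnM ?posrE//; nra.
Qed.

Lemma log_bound_ge0 : 0 <= log_bound C c K.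
Proof.
rewrite /log_bound acc_boundE lnM ?posrE//.
have : 0 <= ln M - ln c by rewrite subr_ge0 ler_ln ?posrE// /M lerDl sqr_ge0.
by have := ln_ge0 K1; lra.
Qed.

End Facts.

Lemma dominated_le F G : dominated G -> (forall rho K, admissible rho K -> F rho K <= G rho K) ->
  dominated F.
Proof.
move=> [B B0 h] FG; exists B => // rho K a.
exact: le_trans (FG _ _ a) (h _ _ a).
Qed.

Lemma dominatedD F G : dominated F -> dominated G -> dominated (fun r K => F r K + G r K).
Proof.
move=> [B B0 h] [B' B'0 h']; exists (B + B'); first exact: addr_ge0.
by move=> r K a; rewrite mulrDl lerD ?h ?h'.
Qed.

Lemma dominatedZ t F : 0 <= t -> dominated F -> dominated (fun r K => t * F r K).
Proof.
move=> t0 [B B0 h]; exists (t * B); first exact: mulr_ge0.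
by move=> r K a; rewrite -mulrA ler_wpM2l ?h.
Qed.

Lemma dominated_rate t F : 0 <= t ->
  (forall r K, admissible r K -> F r K <= t * rate r K) -> dominated F.
Proof.
move=> t0 h; exists t => // r K a; rewrite (le_trans (h _ _ a))// ler_wpM2l//.
rewrite -[leLHS]mul1r ler_wpM2r//; last exact: log1_ge1 a.
exact: le_trans ler01 (rate_ge1 a).
Qed.

Lemma dominated_log t F : 0 <= t ->
  (forall r K, admissible r K -> 0 <= F r K <= t * rate r K) ->
  dominated (fun r K => F r K * log_bound C c K).
Proof.
move=> t0 h; have cM : 0 <= ln (c + C ^+ 2) - ln c.
  by rewrite subr_ge0 ler_ln ?posrE// ?ltr_pwDl ?sqr_ge0// lerDl sqr_ge0.
exists (t * (1 + (ln (c + C ^+ 2) - ln c))); first by rewrite mulr_ge0// addr_ge0.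
move=> r K a; have /andP[F0 Fr] := h _ _ a.
rewrite (le_trans (ler_pM F0 (log_bound_ge0 a) Fr (log_bound_le a)))//.
by rewrite le_eqVlt; apply/orP; left; apply/eqP; rewrite /M; ring.
Qed.

Lemma dominated_cst t : 0 <= t -> dominated (fun _ _ => t).
Proof.
move=> t0; apply: (dominated_rate t0) => r K a.
by rewrite -[leLHS]mulr1 ler_wpM2l// rate_ge1.
Qed.

Let powM K s : (0 < K)%N -> acc_bound C c K `^ s = M `^ s * K%:R `^ s.
Proof. by move=> K0; rewrite powRM// addr_ge0 ?sqr_ge0// ltW. Qed.

Lemma dominated_pow s : s <= al -> dominated (fun _ K => acc_bound C c K `^ s).
Proof.
move=> sal; apply: (@dominated_rate (M `^ s)); first exact: powR_ge0.
move=> r K a; have [_ _ K0 _] := a; rewrite powM// ler_wpM2l ?powR_ge0//.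
exact: rate_pow.
Qed.

Lemma dominated_logb : dominated (fun _ K => log_bound C c K).
Proof.
apply: (@dominated_le _ (fun _ K => 1 * log_bound C c K)); last by move=> *; rewrite mul1r.
apply: (@dominated_log 1 (fun _ _ => 1)) => // r K a.
by rewrite ler01 mul1r rate_ge1.
Qed.

(** The two upper bounds on [w] match the two summands of [pow_bound]; its factor [log_bound] uses
    up the logarithm. *)
Lemma dominated_powb w s :
  (forall r K, admissible r K -> [/\ 0 <= w r, w r <= rate r K &
     w r * K%:R `^ (1 - s) <= rate r K]) ->
  dominated (fun r K => w r * pow_bound C c s K).
Proof.
move=> h; rewrite /pow_bound.
apply: (@dominated_le _ (fun r K => (w r * (c `^ (1 - s) + acc_bound C c K `^ (1 - s)))
   * log_bound C c K)); last by move=> *; rewrite mulrA.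
apply: (@dominated_log (c `^ (1 - s) + M `^ (1 - s))).
  by rewrite addr_ge0 ?powR_ge0.
move=> r K a; have [w0 w1 w2] := h _ _ a; have [_ _ K0 _] := a.
rewrite mulr_ge0 ?addr_ge0 ?powR_ge0//= powM//.
have := ler_wpM2l (powR_ge0 c (1 - s)) w1; have := ler_wpM2l (powR_ge0 M (1 - s)) w2.
lra.
Qed.

Lemma dominated_term_var gam s v0 : be <= s -> 0 <= v0 ->
  dominated (fun r K => term_var C c r gam s v0 K).
Proof.
move=> bes v00; rewrite /term_var.
apply: (@dominated_le _ (fun r K => 2 * v0 * (1 - r)^-1 +
   6 * gam ^+ 2 * ((1 - r)^-1 ^+ 2 * pow_bound C c (2 * s) K))).
  apply: dominatedD.
    apply: (dominatedZ (mulr_ge0 (ler0n R 2) v00)).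
    by apply: (@dominated_rate 1) => // r K a; rewrite mul1r; exact: rate_inv.
  apply: (dominatedZ (mulr_ge0 (ler0n R 6) (sqr_ge0 gam))).
  apply: (@dominated_powb (fun r => (1 - r)^-1 ^+ 2)) => r K a; split.
  - exact: sqr_ge0.
  - exact: rate_inv2.
  - exact: rate_inv2_pow.
move=> r K a; rewrite le_eqVlt; apply/orP; left; apply/eqP.
by ring.
Qed.

Variables (L mu gx gy zv zu Delta D kap LP vx0 vy0 : R).
Hypotheses (L0 : 0 <= L) (mu0 : 0 < mu) (gx0 : 0 < gx) (gy0 : 0 < gy) (zv0 : 0 <= zv)
  (zu0 : 0 <= zu) (Delta0 : 0 <= Delta) (D0 : 0 <= D) (kap0 : 0 <= kap) (LP0 : 0 <= LP)
  (vx00 : 0 <= vx0) (vy00 : 0 <= vy0).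

Let t1 : 1 <= 1 :> R := lexx 1.

Lemma dominated_powb_al : dominated (fun _ K => pow_bound C c al K).
Proof.
apply: (@dominated_le _ (fun _ K => 1 * pow_bound C c al K)); last by move=> *; rewrite mul1r.
apply: (@dominated_powb (fun=> 1)) => r K a; split=> //; first exact: rate_ge1.
rewrite (le_trans _ (rate_inv_pow a (ltW beal)))// ler_wpM2r ?powR_ge0//.
by have [r0 r1 _ _] := a; rewrite invf_ge1 ?subr_gt0//; lra.
Qed.

Lemma dominated_term1 : dominated (fun _ K => term1 C c al gx zv Delta LP K).
Proof.
rewrite /term1; apply: dominatedD; first apply: dominatedD.
- apply: (@dominated_le _ (fun _ K => Delta / gx * acc_bound C c K `^ al)).
    by apply: dominatedZ; [rewrite divr_ge0// ltW|exact: dominated_pow].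
  by move=> r K _; rewrite le_eqVlt; apply/orP; left; apply/eqP; ring.
- by apply: dominatedZ; [exact: sqr_ge0|exact: dominated_logb].
- apply: dominatedZ; last exact: dominated_powb_al.
  exact: mulr_ge0 (mulr_ge0 LP0 (ltW gx0)) (addr_ge0 ler01 zv0).
Qed.

Lemma dominated_term2 : dominated (fun r K => term2 mu C c be gy zu D r K).
Proof.
rewrite /term2; apply: dominatedD; first apply: dominatedD.
- apply: (@dominated_le _ (fun _ K => D ^+ 2 / gy * acc_bound C c K `^ be)).
    apply: dominatedZ; [|exact/dominated_pow/ltW].
    by rewrite divr_ge0 ?sqr_ge0// ltW.
  by move=> r K _; rewrite le_eqVlt; apply/orP; left; apply/eqP; ring.
- by apply: dominatedZ; [rewrite !mulr_ge0|exact: dominated_logb].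
- pose t := (4 + mu / 4 * (gy * c `^ (- be))) * (gy * (1 + zu)).
  have p1 : 0 <= mu / 4 * (gy * c `^ (- be)).
    exact: mulr_ge0 (divr_ge0 (ltW mu0) (ler0n R 4)) (mulr_ge0 (ltW gy0) (powR_ge0 _ _)).
  have p2 : 0 <= gy * (1 + zu) := mulr_ge0 (ltW gy0) (addr_ge0 ler01 zu0).
  apply: (@dominated_le _ (fun r K => t * ((1 - r)^-1 * pow_bound C c be K))).
    apply: dominatedZ; first exact: mulr_ge0 (addr_ge0 (ler0n R 4) p1) p2.
    apply: (@dominated_powb (fun r => (1 - r)^-1)) => r K a; split.
    + by have [_ r1 _ _] := a; rewrite invr_ge0 subr_ge0 ltW.
    + exact: rate_inv.
    + by apply: rate_inv_pow.
  move=> r K a; rewrite [leRHS]mulrA ler_wpM2r//.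
    by rewrite mulr_ge0 ?(log_bound_ge0 a)// addr_ge0 ?powR_ge0.
  have [r0 r1 _ _] := a.
  have w1 : 1 <= (1 - r)^-1 by rewrite invf_ge1 ?subr_gt0//; lra.
  have := ler_wpM2r p2 (ler_wpM2l p1 w1); have := ler_wpM2r p2 w1.
  by rewrite /track_n /t; lra.
Qed.

Let th0_gt0 : 0 < th0 c be. Proof. by rewrite divr_gt0// powR_gt0. Qed.

Lemma dominated_term3 : dominated (fun r K => term3 L mu C c al be gx gy zv kap K).
Proof.
have am0 : 0 <= amax c al be gx.
  exact: mulr_ge0 (divr_ge0 (ltW gx0) (ltW th0_gt0)) (powR_ge0 _ _).
rewrite /term3; apply: dominatedD; first apply: dominatedD; first apply: dominatedD.
- apply: (@dominated_le _ (fun _ K => rmax C c al be gx zv ^+ 2 / th0 c be * acc_bound C c K `^ be)).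
    apply: dominatedZ; [|exact/dominated_pow/ltW].
    exact: divr_ge0 (sqr_ge0 _) (ltW th0_gt0).
  by move=> r K _; rewrite le_eqVlt; apply/orP; left; apply/eqP; ring.
- apply: dominatedZ; last exact: dominated_logb.
  exact: mulr_ge0 (ler0n R 8) (mulr_ge0 (sqr_ge0 _) (sqr_ge0 _)).
- apply: dominated_cst; apply: mulr_ge0.
    exact: mulr_ge0 (ler0n R 8) (mulr_ge0 (sqr_ge0 _) (addr_ge0 ler01 (sqr_ge0 _))).
  exact: addr_ge0 (powR_ge0 _ _) (sqr_ge0 _).
- apply: dominatedZ; last exact: dominated_powb_al.
  exact: mulr_ge0 (mulr_ge0 (ltW gx0) am0) (addr_ge0 ler01 zv0).
Qed.

Lemma rate_bound : dominated (fun rho K =>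
  term1 C c al gx zv Delta LP K
  + 2 * cr L mu c be gy kap * term3 L mu C c al be gx gy zv kap K
  + 2 * (ctrack L mu * term2 mu C c be gy zu D rho K)
  + 2 * (cx L mu * term_var C c rho gx al vx0 K
       + cy L mu * term_var C c rho gy be vy0 K)).
Proof.
have ct0 : 0 <= ctrack L mu := divr_ge0 (mulr_ge0 (ler0n R 12) (sqr_ge0 L)) (ltW mu0).
have b0 : 0 <= 8 * L ^+ 2 / mu := divr_ge0 (mulr_ge0 (ler0n R 8) (sqr_ge0 L)) (ltW mu0).
have tg : 0 <= th0 c be / gy := divr_ge0 (ltW th0_gt0) (ltW gy0).
apply: dominatedD; first apply: dominatedD; first apply: dominatedD.
- exact: dominated_term1.
- apply: dominatedZ; last exact: dominated_term3.
  apply: (mulr_ge0 (ler0n R 2)); apply: addr_ge0.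
    exact: mulr_ge0 (mulr_ge0 (ler0n R 6) (sqr_ge0 _)) (sqr_ge0 _).
  apply: (mulr_ge0 ct0); apply: (addr_ge0 b0); apply: (mulr_ge0 (sqr_ge0 _)).
  exact: addr_ge0 tg (mulr_ge0 (divr_ge0 (ler0n R 8) (ltW mu0)) (sqr_ge0 _)).
- apply: (dominatedZ (ler0n R 2)); apply: (dominatedZ ct0); exact: dominated_term2.
- apply: (dominatedZ (ler0n R 2)); apply: dominatedD; apply: dominatedZ.
  + exact: addr_ge0 (mulr_ge0 (ler0n R 2) (sqr_ge0 _)) (mulr_ge0 ct0 b0).
  + exact: dominated_term_var (ltW beal) vx00.
  + apply: addr_ge0 (mulr_ge0 (ler0n R 6) (sqr_ge0 _)) (mulr_ge0 ct0 _).
    exact: addr_ge0 b0 (divr_ge0 (ltW mu0) (ler0n R 4)).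
  + exact: dominated_term_var (lexx _) vy00.
Qed.

End Rate.

(** * Projections and calculus *)

Section ConvexSets.
Context {R : realType} {d : nat}.
Variable Y : set 'rV[R]_d.
Hypothesis cvxY : convex_set Y.

Lemma convex_comb (t : R) (u w : 'rV[R]_d) : 0 <= t -> t <= 1 -> Y u -> Y w ->
  Y (w + t *: (u - w)).
Proof.
move=> t0 t1 Yu Yw.
have := cvxY (Itv01 t0 t1) (mem_set Yu) (mem_set Yw).
rewrite inE; congr (Y _); rewrite /conv/=.
by apply/rowP => j; rewrite !mxE /unstable.onem; ring.
Qed.

Lemma convex_avgv n (y : 'I_n -> 'rV[R]_d) : (0 < n)%N -> (forall i, Y (y i)) -> Y (avgv y).
Proof.
case: n y => // n y _; elim: n y => [|n IH] y Yy.
  by rewrite /avgv big_ord1 invr1 scale1r.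
have := @convex_comb ((n.+2)%:R^-1) (y ord0) (avgv (fun i => y (lift ord0 i))).
move=> /(_ _ _ (Yy _) (IH _ (fun i => Yy _))).
rewrite invr_ge0 ler0n invf_le1 ?ltr0n// ler1n => /(_ isT isT); congr (Y _).
have -> : avgv y = n.+2%:R^-1 *: (y ord0 + \sum_(i < n.+1) y (lift ord0 i)).
  by rewrite /avgv big_ord_recl.
rewrite /avgv; move: (\sum_(i < n.+1) _) => S; apply/rowP => j; rewrite !mxE.
have n1 : n.+1%:R != 0 :> R by rewrite pnatr_eq0.
have n2 : n.+1%:R + 1 != 0 :> R by rewrite natr1 pnatr_eq0.
rewrite -[n.+2.-1]/n.+1 -[n.+2%:R]natr1.
by move: (n.+1%:R) n1 n2 => a a0 a1; field; rewrite a0 a1.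
Qed.

End ConvexSets.

Section Topology.
Context {R : realType} {d : nat}.

Lemma mx_norm_le_l2norm (u : 'rV[R]_d) : `|u| <= l2norm u.
Proof.
rewrite /Num.norm/= mx_normrE; apply/bigmax_leP; split=> [|[i j] _]; first exact: l2norm_ge0.
by rewrite ord1; exact: normr_coord_l2norm.
Qed.

Lemma l2norm_le_mx_norm (u : 'rV[R]_d) : l2norm u <= d%:R * `|u|.
Proof.
have h j : `|u 0 j| <= `|u|.
  by rewrite [leRHS]/Num.norm/= mx_normrE (le_bigmax _ (fun ij => `|u ij.1 ij.2|) (0, j)).
rewrite -ler_sqr ?nnegrE ?mulr_ge0 ?l2norm_ge0// sqr_l2norm /dotp.
apply: (@le_trans _ _ (\sum_(j < d) `|u| ^+ 2)).
  apply: ler_sum => j _; rewrite -expr2 -(real_normK (num_real (u 0 j))).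
  by rewrite ler_sqr ?nnegrE.
rewrite sumr_const card_ord -[_ *+ d]mulr_natl exprMn ler_wpM2r ?sqr_ge0//.
rewrite -natrX ler_nat; have le_sqr m : (m <= m ^ 2)%N by case: m => // m; rewrite leq_pmulr.
exact: le_sqr.
Qed.

Lemma lipschitz_dist_cvg (f : 'rV[R]_d -> R) (M : R) (x : 'rV[R]_d) :
  0 <= M -> (forall u, `|f u - f x| <= M * l2norm (u - x)) -> {for x, continuous f}.
Proof.
move=> M0 h A /= /nbhs_ballP [e /= e0 eA]; apply/nbhs_ballP.
have Md : 0 <= M * d%:R by rewrite mulr_ge0.
exists (e / (M * d%:R + 1)) => /=; first by rewrite divr_gt0// ltr_wpDl.
move=> u; rewrite -ball_normE /= => xu; apply: eA.
rewrite -ball_normE /= distrC (le_lt_trans (h u))//.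
rewrite (le_lt_trans (ler_wpM2l M0 (l2norm_le_mx_norm _)))// mulrA.
rewrite (@le_lt_trans _ _ ((M * d%:R + 1) * `|u - x|))//.
  by rewrite ler_wpM2r// lerDl.
by rewrite -ltr_pdivlMl ?ltr_wpDl// mulrC distrC.
Qed.

Lemma l2norm_bounded_compact (Y : set 'rV[R]_d) (D : R) : closed Y ->
  (forall u w, Y u -> Y w -> l2norm (u - w) <= D) -> compact Y.
Proof.
move=> cY bY; have [->|/set0P[u0 Yu0]] := eqVneq Y set0; first exact: compact0.
apply: bounded_closed_compact => //.
exists (D + `|u0|); split; first exact: num_real.
move=> M hM u Yu; rewrite /= -[u](subrK u0) (le_trans (ler_normD _ _))//.
by rewrite (le_trans _ (ltW hM))// lerD2r (le_trans (mx_norm_le_l2norm _))// bY.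
Qed.

End Topology.

(** * Projection onto a compact convex set *)

Section Projection.
Context {R : realType} {d : nat}.
Variables (Y : set 'rV[R]_d).
Hypotheses (cvxY : convex_set Y) (compY : compact Y) (Y0 : Y !=set0).

Lemma projP v : Y (Defs.proj Y v) /\ forall w, Y w -> l2norm (v - Defs.proj Y v) <= l2norm (v - w).
Proof.
rewrite /Defs.proj; case: xgetP => [z _ //|noz]; exfalso.
have cf : {within Y, continuous (fun w => l2norm (v - w))}.
  apply: continuous_subspaceT => w; apply: (@lipschitz_dist_cvg _ _ _ 1) => // u.
  have := ler_l2normD (v - u) (u - w); have := ler_l2normD (v - w) (w - u).
  rewrite !addrA !subrK (l2distC w u) mul1r ler_norml => h1 h2.
  by apply/andP; split; lra.
have [z /set_mem Yz zm] := compact_EVT_min Y0 compY cf.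
by apply: (noz z); split=> // w Yw; apply: zm; exact: mem_set.
Qed.

(** The limit t to 0 in a first-order condition, replaced by the single value t = a / (2 b), where a
    <= a / 2 would follow. It serves both variational inequalities. *)
Lemma le0_of_quadratic (a b : R) : (forall t, 0 < t -> t <= 1 -> a <= t * b) -> a <= 0.
Proof.
move=> h; have b0 := h 1 ltr01 (lexx 1); rewrite mul1r in b0.
have [//|a0] := leP a 0; have bp : 0 < b by exact: lt_le_trans a0 b0.
have t0 : 0 < a / (2 * b) by rewrite divr_gt0// mulr_gt0.
have t1 : a / (2 * b) <= 1 by rewrite ler_pdivrMr ?mulr_gt0// mul1r; lra.
have := h _ t0 t1; rewrite (_ : a / (2 * b) * b = a / 2); last by field; rewrite gt_eqF.
lra.
Qed.

Lemma proj_variational v w : Y w -> dotp (v - Defs.proj Y v) (w - Defs.proj Y v) <= 0.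
Proof.
move=> Yw; have [Yp pm] := projP v.
apply: (@le0_of_quadratic _ (2^-1 * l2norm (w - Defs.proj Y v) ^+ 2)) => t t0 t1.
have := pm _ (convex_comb cvxY (ltW t0) t1 Yw Yp).
rewrite -ler_sqr ?nnegrE ?l2norm_ge0// opprD addrA (sqr_l2normB (v - Defs.proj Y v)) l2normZ.
rewrite dotpZr exprMn real_normK ?num_real// => h.
rewrite -(ler_pM2l t0); lra.
Qed.

Lemma proj_nonexpansive u v : l2norm (Defs.proj Y u - Defs.proj Y v) <= l2norm (u - v).
Proof.
have h1 := proj_variational u (projP v).1; have h2 := proj_variational v (projP u).1.
have h3 : l2norm (Defs.proj Y u - Defs.proj Y v) ^+ 2 <= dotp (u - v) (Defs.proj Y u - Defs.proj Y v).
  move: h1 h2; rewrite sqr_l2norm; set a := Defs.proj Y u; set b := Defs.proj Y v.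
  rewrite !(dotpBl, dotpBr) (dotpC b a) ; lra.
have [e0|e0] := eqVneq (l2norm (Defs.proj Y u - Defs.proj Y v)) 0.
  by rewrite e0 l2norm_ge0.
have ep : 0 < l2norm (Defs.proj Y u - Defs.proj Y v) by rewrite lt_def e0 l2norm_ge0.
rewrite -(ler_pM2r ep) -expr2 (le_trans h3)//; exact: cauchy_schwarz.
Qed.

Lemma proj_id w : Y w -> Defs.proj Y w = w.
Proof.
move=> Yw; have [_ /(_ _ Yw)] := projP w; rewrite subrr l2norm0 => h.
by apply/esym/subr0_eq/l2norm_eq0/le_anti; rewrite h l2norm_ge0.
Qed.

Lemma proj_dist v w : Y w -> l2norm (Defs.proj Y v - w) <= l2norm (v - w).
Proof. by move=> Yw; rewrite -[X in l2norm (_ - X) <= _](proj_id Yw) proj_nonexpansive. Qed.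

End Projection.

(** * Derivatives along lines and from quadratic bounds *)

Section Calculus.
Context {R : realType}.

Lemma derive_dotp p (f : 'rV[R]_p -> R) x v :
  differentiable f x -> 'D_v f x = dotp (grad f x) v.
Proof.
move=> df; rewrite deriveE// [in LHS](row_sum_delta v) linear_sum /dotp.
by apply: eq_bigr => j _; rewrite linearZ/= -deriveE// mxE mulrC.
Qed.

Lemma is_derive_line p (f : 'rV[R]_p -> R) x v (s : R) :
  differentiable f (x + s *: v) ->
  is_derive s 1 (fun t : R => f (x + t *: v)) (dotp (grad f (x + s *: v)) v).
Proof.
move=> df; rewrite -derive_dotp//.
have qE : (fun h : R => h^-1 *: (f (x + (h *: (1 : R^o) + s) *: v) - f (x + s *: v)))
   = (fun h : R => h^-1 *: (f (h *: v + (x + s *: v)) - f (x + s *: v))).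
  apply/funext => h; congr (_ *: (f _ - _)).
  by rewrite [h *: _](mulr1 h) scalerDl addrCA.
have dv : derivable f (x + s *: v) v by exact: diff_derivable.
split; last by rewrite /derive /= qE.
by rewrite /derivable /= qE.
Qed.

Lemma mvt_line p (f : 'rV[R]_p -> R) x v :
  (forall s : R, differentiable f (x + s *: v)) ->
  exists2 s : R, 0 <= s <= 1 & f (x + v) - f x = dotp (grad f (x + s *: v)) v.
Proof.
move=> df.
have [||s s01] := @MVT_segment R (fun t => f (x + t *: v))
  (fun t => dotp (grad f (x + t *: v)) v) 0 1 ler01.
- by move=> s _; exact: is_derive_line.
- apply: derivable_within_continuous => s _.
  by have [] := is_derive_line (df s).
rewrite scale1r scale0r addr0 subr0 mulr1 => e.
by exists s => //; rewrite in_itv/= in s01.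
Qed.

Lemma differentiable_partial_l p d (f : 'rV[R]_p -> 'rV[R]_d -> R) x y :
  differentiable (fun t : 'rV[R]_p * 'rV[R]_d => f t.1 t.2) (x, y) ->
  differentiable (fun x' => f x' y) x.
Proof.
move=> df; have di : differentiable (fun x' : 'rV[R]_p => (x', y)) x.
  exact: differentiable_pair.
exact: (differentiable_comp di df).
Qed.

Lemma differentiable_partial_r p d (f : 'rV[R]_p -> 'rV[R]_d -> R) x y :
  differentiable (fun t : 'rV[R]_p * 'rV[R]_d => f t.1 t.2) (x, y) ->
  differentiable (f x) y.
Proof.
move=> df; have di : differentiable (fun y' : 'rV[R]_d => (x, y')) y.
  exact: differentiable_pair.
exact: (differentiable_comp di df).
Qed.

(** The error is o(t) along each axis, so the difference quotients converge to the coordinates of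
    [g]; no differentiability of [f] is assumed. *)
Lemma grad_of_quadratic p (f : 'rV[R]_p -> R) x g (M : R) :
  (forall x', `|f x' - f x - dotp g (x' - x)| <= M * l2norm (x' - x) ^+ 2) ->
  grad f x = g.
Proof.
move=> h; apply/rowP => j; rewrite mxE /derive.
have M0 : 0 <= M.
  have := le_trans (normr_ge0 _) (h (x + delta_mx 0 j)).
  rewrite addrC addKr pmulr_lge0// sqr_l2norm /dotp (bigD1 j)//= !mxE !eqxx mulr1.
  rewrite ltr_pwDl// sumr_ge0// => i _; rewrite -expr2; exact: sqr_ge0.
apply: cvg_lim => //; apply/(@cvgrPdist_lt _ R^o) => e e0.
near=> t.
have t0 : t != 0 by near: t; exact: nbhs_dnbhs_neq.
have := h (t *: delta_mx 0 j + x); rewrite addrK l2normZ dotpZr.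
have -> : dotp g (delta_mx 0 j) = g 0 j.
  rewrite /dotp (bigD1 j)//= mxE !eqxx mulr1 big1 ?addr0// => i ij.
  by rewrite mxE (negPf ij) andbF mulr0.
have -> : l2norm (delta_mx 0 j : 'rV[R]_p) = 1.
  rewrite l2norm_sqrt /dotp (bigD1 j)//= mxE !eqxx mulr1 big1 ?addr0 ?sqrtr1// => i ij.
  by rewrite mxE (negPf ij) andbF mulr0.
rewrite mulr1 => ht; rewrite /= distrC.
have -> : t^-1 *: (f (t *: delta_mx 0 j + x) - f x) - g 0 j
    = t^-1 * (f (t *: delta_mx 0 j + x) - f x - t * g 0 j).
  by rewrite mulrBr mulrA mulVf// mul1r.
rewrite normrM normfV mulrC ltr_pdivrMr ?normr_gt0//.
rewrite (le_lt_trans ht)// expr2 mulrA ltr_pM2r ?normr_gt0//.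
rewrite (@le_lt_trans _ _ ((M + 1) * `|t|))//; first by rewrite ler_wpM2r// lerDl.
rewrite -ltr_pdivlMl ?ltr_wpDl// mulrC.
near: t; apply: dnbhs0_lt; first by rewrite divr_gt0// ltr_wpDl.
Unshelve. all: by end_near. Qed.

End Calculus.

(** * The value function *)

Section ValueFunction.
Context {R : realType} {n p d : nat}.
Variables (L mu C : R) (Y : set 'rV[R]_d) (f : 'I_n -> 'rV[R]_p -> 'rV[R]_d -> R).
Hypotheses (n0 : (0 < n)%N) (L0 : 0 <= L) (mu0 : 0 < mu).
Hypotheses (clY : closed Y) (cvxY : convex_set Y) (Y0 : Y !=set0).
Hypothesis hder : forall i, has_derivatives Y (f i).
Hypothesis sc : forall i, strongly_concave_y Y mu (f i).
Hypothesis gx_lip : forall i u u' w w', Y w -> Y w' ->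
  l2norm (grad_x (f i) u w - grad_x (f i) u' w') ^+ 2
  <= L ^+ 2 * (l2norm (u - u') ^+ 2 + l2norm (w - w') ^+ 2).
Hypothesis gy_lip : forall i u u' w w', Y w -> Y w' ->
  l2norm (grad_y (f i) u w - grad_y (f i) u' w') ^+ 2
  <= L ^+ 2 * (l2norm (u - u') ^+ 2 + l2norm (w - w') ^+ 2).
Hypothesis gy_bd : forall i u w, Y w -> l2norm (grad_y (f i) u w) <= C.

Let G := global_obj f.
Let ys := ystar Y G.
Let Gx u w := avgv (fun i => grad_x (f i) u w).
Let Gy u w := avgv (fun i => grad_y (f i) u w).

Lemma differentiable_obj i x y : Y y ->
  differentiable (fun t : 'rV[R]_p * 'rV[R]_d => f i t.1 t.2) (x, y).
Proof. by move=> Yy; have [/nbhs_singleton] := hder i x Yy. Qed.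

Let sqle a b : 0 <= b -> a ^+ 2 <= b ^+ 2 -> a <= b :> R.
Proof.
by move=> b0 h; rewrite (le_trans (ler_norm a))// -(ger0_norm b0) -ler_sqr ?nnegrE// !real_normK ?num_real.
Qed.

Lemma avg_grad_lip (T : 'I_n -> 'rV[R]_p -> 'rV[R]_d -> 'rV[R]_p) u u' w w' : Y w -> Y w' ->
  (forall i u u' w w', Y w -> Y w' -> l2norm (T i u w - T i u' w') ^+ 2
    <= L ^+ 2 * (l2norm (u - u') ^+ 2 + l2norm (w - w') ^+ 2)) ->
  l2norm (avgv (fun i => T i u w) - avgv (fun i => T i u' w')) ^+ 2
  <= L ^+ 2 * (l2norm (u - u') ^+ 2 + l2norm (w - w') ^+ 2).
Proof.
move=> Yw Yw' h; rewrite -avgvB (le_trans (sqr_l2norm_avgv n0 _))//.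
by apply: ler_avg_cst => // i; exact: h.
Qed.

Lemma Gx_lip_y u w w' : Y w -> Y w' -> l2norm (Gx u w - Gx u w') <= L * l2norm (w - w').
Proof.
move=> Yw Yw'; apply: sqle; first by rewrite mulr_ge0 ?l2norm_ge0.
rewrite (le_trans (avg_grad_lip u u Yw Yw' gx_lip))// subrr l2norm0 expr0n add0r.
by rewrite exprMn.
Qed.

Lemma obj_quadratic_x x x' y : Y y ->
  `|G x' y - G x y - dotp (Gx x y) (x' - x)| <= L * l2norm (x' - x) ^+ 2.
Proof.
move=> Yy.
have h i : `|f i x' y - f i x y - dotp (grad_x (f i) x y) (x' - x)| <= L * l2norm (x' - x) ^+ 2.
  have [s|s /andP[s0 s1]] := @mvt_line _ _ (fun u => f i u y) x (x' - x).
    by apply: differentiable_partial_l; exact: differentiable_obj.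
  rewrite [x + (x' - x)]addrC subrK => ->; rewrite -/(grad_x (f i) _ y) -dotpBl.
  rewrite (le_trans (normr_dotp _ _))// expr2 mulrA ler_wpM2r ?l2norm_ge0//.
  apply: sqle; first by rewrite mulr_ge0 ?l2norm_ge0.
  rewrite (le_trans (gx_lip _ _ _ Yy Yy))// subrr l2norm0 expr0n addr0 exprMn.
  rewrite ler_wpM2l ?sqr_ge0// [x + _]addrC addrK l2normZ exprMn real_normK ?num_real//.
  by rewrite ler_piMl ?sqr_ge0// expr_le1.
have -> : G x' y - G x y - dotp (Gx x y) (x' - x)
    = avg (fun i => f i x' y - f i x y - dotp (grad_x (f i) x y) (x' - x)).
  rewrite avgB avgB; congr (_ - _); rewrite dotpC dotp_avgvr.
  by apply: eq_avg => i; rewrite dotpC.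
rewrite ler_norml; apply/andP; split.
  rewrite lerNl -avgN; apply: ler_avg_cst => // i.
  by rewrite (le_trans _ (h i))// -normrN ler_norm.
by apply: ler_avg_cst => // i; rewrite (le_trans _ (h i))// ler_norm.
Qed.

Lemma obj_strongly_concave x y y' : Y y -> Y y' ->
  dotp (Gy x y) (y - y') + mu / 2 * l2norm (y - y') ^+ 2 <= G x y - G x y'.
Proof.
move=> Yy Yy'.
have -> : dotp (Gy x y) (y - y') + mu / 2 * l2norm (y - y') ^+ 2
    = avg (fun i => dotp (grad_y (f i) x y) (y - y') + mu / 2 * l2norm (y - y') ^+ 2).
  rewrite avgD avg_cst//; congr (_ + _); rewrite dotpC dotp_avgvr.
  by apply: eq_avg => i; rewrite dotpC.
by rewrite /G /global_obj -avgB; apply: ler_avg => i; exact: sc.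
Qed.

(** Adding strong concavity at [y] and at [y'] gives mu |y - y'|^2 <= <grad(y') - grad(y), y - y'>,
    and bounded gradients make the right side at most 2 C |y - y'|. *)
Lemma feasible_diam y y' : Y y -> Y y' -> l2norm (y - y') <= 2 * C / mu.
Proof.
move=> Yy Yy'; pose i := Ordinal n0.
have h1 := sc i 0 Yy Yy'; have h2 := sc i 0 Yy' Yy.
rewrite (l2distC y' y) -(opprB y y') dotpNr in h2.
have [e0|e0] := eqVneq (l2norm (y - y')) 0.
  rewrite e0 divr_ge0 ?(ltW mu0)// mulr_ge0//.
  exact: le_trans (l2norm_ge0 _) (gy_bd i 0 Yy).
have ep : 0 < l2norm (y - y') by rewrite lt_def e0 l2norm_ge0.
rewrite ler_pdivlMr// mulrC -(ler_pM2r ep).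
have c1 := cauchy_schwarz (grad_y (f i) 0 y') (y - y').
have c2 := cauchy_schwarz (- grad_y (f i) 0 y) (y - y').
rewrite dotpNl l2normN in c2.
have b1 := ler_wpM2r (ltW ep) (gy_bd i 0 Yy).
have b2 := ler_wpM2r (ltW ep) (gy_bd i 0 Yy').
lra.
Qed.

Lemma feasible_compact : compact Y.
Proof. exact: l2norm_bounded_compact clY feasible_diam. Qed.

Lemma ystarP x : Y (ys x) /\ forall y, Y y -> G x y <= G x (ys x).
Proof.
rewrite /ys /ystar; case: xgetP => [y _ //|noy]; exfalso.
have cf : {within Y, continuous (G x)}.
  apply: continuous_in_subspaceT => y /set_mem Yy.
  apply: differentiable_continuous.
  have -> : G x = (fun y => n%:R^-1 *: \sum_(i < n) f i x y : R^o) by [].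
  apply: differentiableZ; rewrite -fct_sumE; apply: differentiable_sum => i.
  by apply: differentiable_partial_r; exact: differentiable_obj.
have [y /set_mem Yy ym] := compact_EVT_max Y0 feasible_compact cf.
by apply: (noy y); split=> // w Yw; apply: ym; exact: mem_set.
Qed.

Lemma ystar_in x : Y (ys x). Proof. exact: (ystarP x).1. Qed.

Lemma ystar_max x y : Y y -> G x y <= G x (ys x). Proof. exact: (ystarP x).2. Qed.

(** The gradient is taken at [yt], between [ys x] and [y]: there strong concavity and maximality
    give <Gy x yt, y - ys x> <= 0. The Lipschitz bound compares this with the gradient at [ys x] up
    to a multiple of t. *)
Lemma ystar_variational x y : Y y -> dotp (Gy x (ys x)) (y - ys x) <= 0.
Proof.
move=> Yy; have Ys := ystar_in x.
apply: (@le0_of_quadratic _ _ (L * l2norm (y - ys x) ^+ 2)) => t t0 t1.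
pose yt := ys x + t *: (y - ys x).
have Yt : Y yt by have := convex_comb cvxY (ltW t0) t1 Yy Ys.
have dt : yt - ys x = t *: (y - ys x) by rewrite /yt addrC addKr.
have h1 := obj_strongly_concave x Yt Ys; have h2 := ystar_max x Yt.
have h3 : dotp (Gy x yt) (y - ys x) <= 0.
  rewrite -(ler_pM2l t0) mulr0 -dotpZr -dt.
  have : 0 <= mu / 2 * l2norm (yt - ys x) ^+ 2 by rewrite mulr_ge0 ?sqr_ge0 ?divr_ge0 ?(ltW mu0).
  lra.
have h4 : l2norm (Gy x (ys x) - Gy x yt) <= L * (t * l2norm (y - ys x)).
  apply: sqle; first by rewrite !mulr_ge0 ?l2norm_ge0// ltW.
  rewrite /Gy -avgvB (le_trans (sqr_l2norm_avgv n0 _))//; apply: ler_avg_cst => // i.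
  rewrite (le_trans (gy_lip _ _ _ Ys Yt))// subrr l2norm0 expr0n add0r.
  by rewrite l2distC dt l2normZ (gtr0_norm t0) !exprMn.
have := cauchy_schwarz (Gy x (ys x) - Gy x yt) (y - ys x); rewrite dotpBl.
have := ler_wpM2r (l2norm_ge0 (y - ys x)) h4; lra.
Qed.

(** Maximality at [x] gives growth mu / 2, and the variational inequality at [x'] leaves only the
    change of the gradient from [x'] to [x]. The growth mu / 2 is the origin of the factor 2 in the
    constant. *)
Lemma ystar_lip x x' : l2norm (ys x - ys x') <= 2 * L / mu * l2norm (x - x').
Proof.
have Ys := ystar_in x; have Ys' := ystar_in x'.
have h1 := obj_strongly_concave x Ys' Ys; have h2 := ystar_max x Ys'.
have h3 := ystar_variational x' Ys.
have h4 : l2norm (Gy x (ys x') - Gy x' (ys x')) <= L * l2norm (x - x').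
  apply: sqle; first by rewrite !mulr_ge0 ?l2norm_ge0// ltW.
  rewrite /Gy -avgvB (le_trans (sqr_l2norm_avgv n0 _))//; apply: ler_avg_cst => // i.
  rewrite (le_trans (gy_lip _ _ _ Ys' Ys'))// subrr l2norm0 expr0n addr0.
  by rewrite exprMn.
have [e0|e0] := eqVneq (l2norm (ys x - ys x')) 0.
  by rewrite e0 !mulr_ge0 ?l2norm_ge0 ?invr_ge0 ?(ltW mu0).
have ep : 0 < l2norm (ys x - ys x') by rewrite lt_def e0 l2norm_ge0.
rewrite mulrAC ler_pdivlMr// mulrC -(ler_pM2r ep).
have c1 := cauchy_schwarz (Gy x (ys x') - Gy x' (ys x')) (ys x - ys x').
rewrite dotpBl in c1; have b1 := ler_wpM2r (ltW ep) h4.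
rewrite (l2distC (ys x') (ys x)) -(opprB (ys x)) dotpNr in h1.
lra.
Qed.

Lemma Gy_monotone x y : Y y ->
  dotp (Gy x y) (y - ys x) <= - (mu / 2) * l2norm (y - ys x) ^+ 2.
Proof.
by move=> Yy; have := obj_strongly_concave x Yy (ystar_in x); have := ystar_max x Yy; lra.
Qed.

Let LP := L + L * (2 * L / mu).

(** Danskin's argument as a two-sided estimate: the increment of Phi is at most that of the
    objective with [ys x'] frozen and at least that with [ys x] frozen. The two gradients differ by
    what [ystar_lip] allows. Both [grad_Phi] and [Phi_descent] follow. *)
Lemma Phi_quadratic x x' :
  `|Phi Y G x' - Phi Y G x - dotp (Gx x (ys x)) (x' - x)| <= LP * l2norm (x' - x) ^+ 2.
Proof.
rewrite /Phi -/ys; have Ys := ystar_in x; have Ys' := ystar_in x'.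
have := obj_quadratic_x x x' Ys; have := obj_quadratic_x x x' Ys'.
rewrite !ler_norml => /andP[_ h1] /andP[h2 _].
have h3 := ystar_max x Ys'; have h4 := ystar_max x' Ys.
have h5 : dotp (Gx x (ys x') - Gx x (ys x)) (x' - x) <= L * (2 * L / mu) * l2norm (x' - x) ^+ 2.
  rewrite (le_trans (cauchy_schwarz _ _))// [leRHS]mulrA ler_wpM2r ?l2norm_ge0//.
  rewrite (le_trans (Gx_lip_y _ Ys' Ys))// -mulrA ler_wpM2l//; exact: ystar_lip.
rewrite dotpBl in h5.
have h6 : 0 <= L * (2 * L / mu) * l2norm (x' - x) ^+ 2.
  exact: mulr_ge0 (mulr_ge0 L0 (divr_ge0 (mulr_ge0 (ler0n R 2) L0) (ltW mu0))) (sqr_ge0 _).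
by rewrite /LP mulrDl; apply/andP; split; lra.
Qed.

Lemma grad_Phi x : grad (Phi Y G) x = Gx x (ys x).
Proof. exact: grad_of_quadratic (Phi_quadratic x). Qed.

Lemma Phi_descent x x' :
  Phi Y G x' <= Phi Y G x + dotp (Gx x (ys x)) (x' - x) + LP * l2norm (x' - x) ^+ 2.
Proof. by have := Phi_quadratic x x'; rewrite ler_norml => /andP[_]; lra. Qed.

End ValueFunction.

(** * Measurability *)

Definition mvec {d} {T : measurableType d} {R : realType} {p} (u : T -> 'rV[R]_p) :=
  forall j, measurable_fun [set: T] (fun t => u t 0 j).

Section VectorMeasurability.
Context {dT} {T : measurableType dT} {R : realType} {p d : nat}.
Implicit Types (u : T -> 'rV[R]_p) (w : T -> 'rV[R]_d).

Let box (q : 'rV[rat]_p * 'rV[rat]_d * nat) : set ('rV[R]_p * 'rV[R]_d) :=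
  [set z : 'rV[R]_p * 'rV[R]_d | (forall j, `|z.1 0 j - ratr (q.1.1 0 j)| < q.2.+1%:R^-1) /\
           (forall j, `|z.2 0 j - ratr (q.1.2 0 j)| < q.2.+1%:R^-1)].

Let rat_approx (e : R) k (x : 'rV[R]_k) : 0 < e ->
  exists q : 'rV[rat]_k, forall j, `|x 0 j - ratr (q 0 j)| < e.
Proof.
move=> e0; have h j : exists q : rat, `|x 0 j - ratr q| < e.
  have [|q] := @rat_in_itvoo R (x 0 j - e) (x 0 j + e); first lra.
  by rewrite in_itv/= => /andP[h1 h2]; exists q; rewrite ltr_norml; lra.
have [q hq] := choice h; exists (\row_j q j) => j.
by rewrite mxE.
Qed.

(* Open sets are countable unions of rational boxes. *)
Lemma measurable_open_preimage u w (O : set ('rV[R]_p * 'rV[R]_d)) :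
  mvec u -> mvec w -> open O -> measurable [set t | O (u t, w t)].
Proof.
move=> mu mw oO.
have mbox q : measurable [set t | box q (u t, w t)].
  have -> : [set t | box q (u t, w t)] =
      (\bigcap_(j in [set: 'I_p]) [set t | `|u t 0 j - ratr (q.1.1 0 j)| < q.2.+1%:R^-1]) `&`
      (\bigcap_(j in [set: 'I_d]) [set t | `|w t 0 j - ratr (q.1.2 0 j)| < q.2.+1%:R^-1]).
    by apply/seteqP; split=> t /=; [move=> [h1 h2]; split=> j _; [exact: h1|exact: h2]|
      move=> [h1 h2]; split=> j; [exact: h1|exact: h2]].
  have mabs (f : T -> R) (a b : R) : measurable_fun setT f ->
      measurable [set t | `|f t - a| < b].
    move=> mf; have mg : measurable_fun setT (fun t => `|f t - a|).
      by apply: measurableT_comp => //; apply: measurable_funB.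
    have := mg measurableT `]-oo, b[%classic (measurable_itv _).
    rewrite setTI; congr (measurable _); apply/seteqP; split=> t /=; by rewrite in_itv.
  by apply: measurableI; apply: fin_bigcap_measurable => // j _; exact: mabs.
have -> : [set t | O (u t, w t)] =
   \bigcup_(q : 'rV[rat]_p * 'rV[rat]_d * nat)
     [set t | box q `<=` O /\ box q (u t, w t)].
  apply/seteqP; split=> t /=; last by move=> [q _ [qO]]; exact: qO.
  move=> Ot; have : nbhs (u t, w t) O by exact: open_nbhs_nbhs.
  move=> /nbhs_ballP [e /= e0 eO].
  have [m me] : exists m : nat, m.+1%:R^-1 < e / 2.
    exists (Num.truncn (e / 2)^-1); rewrite invf_plt ?posrE ?divr_gt0//.
    exact: truncnS_gt.
  have m0 : 0 < m.+1%:R^-1 :> R by rewrite invr_gt0.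
  have [q1 h1] := rat_approx (u t) m0; have [q2 h2] := rat_approx (w t) m0.
  exists (q1, q2, m) => //; split; last by split=> j.
  move=> z [z1 z2]; apply: eO.
  have close (a b c : R) : `|a - c| < m.+1%:R^-1 -> `|b - c| < m.+1%:R^-1 -> ball a e b.
    rewrite -ball_normE /= => ac bc; rewrite (_ : a - b = (a - c) - (b - c)); last by ring.
    by rewrite (le_lt_trans (ler_normB _ _))// [ltRHS]splitr ltrD// (lt_trans _ me).
  split; split=> // i j; rewrite ord1; first exact: close (h1 j) (z1 j).
  exact: close (h2 j) (z2 j).
apply: countable_bigcupT_measurable; first exact: countableP.
move=> q; have [bO|bO] := pselect (box q `<=` O).
  rewrite (_ : mkset _ = [set t | box q (u t, w t)])//.
  by apply/seteqP; split=> t /=; [case|].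
rewrite (_ : mkset _ = set0)//.
by apply/seteqP; split=> t /=; case.
Qed.

(** Leads from coordinates to the sigma-algebra generated by the open sets, on which
    [regular_oracle] makes [F] jointly measurable. *)
Lemma measurable_borel_pair u w : mvec u -> mvec w ->
  measurable_fun [set: T] ((fun t => (u t, w t)) : T -> borel ('rV[R]_p * 'rV[R]_d)%type).
Proof.
move=> mu mw.
apply: (@measurability _ _ T (borel ('rV[R]_p * 'rV[R]_d)%type) setT
  (fun t => (u t, w t)) (@open ('rV[R]_p * 'rV[R]_d)%type)) => //.
by move=> _ [V oV <-]; rewrite setTI; exact: measurable_open_preimage.
Qed.

Lemma lipschitz_measurable (phi : 'rV[R]_p -> 'rV[R]_d -> R) (M : R) u w : 0 <= M ->
  (forall a a' b b', `|phi a b - phi a' b'| <= M * (l2norm (a - a') + l2norm (b - b'))) ->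
  mvec u -> mvec w -> measurable_fun [set: T] (fun t => phi (u t) (w t)).
Proof.
move=> M0 lip mu mw; apply: (measurability _ (RGenOInfty.measurableE R)).
move=> _ [_ [c ->] <-]; rewrite setTI.
rewrite (_ : _ @^-1` _ = [set t | [set z | c < phi z.1 z.2] (u t, w t)]); last first.
  by apply/seteqP; split=> t /=; rewrite in_itv/= andbT.
apply: measurable_open_preimage => //; rewrite openE => -[a b] /= cab.
pose K := M * (p%:R + d%:R) + 1.
have K0 : 0 < K by rewrite ltr_wpDl// mulr_ge0// addr_ge0.
apply/nbhs_ballP; exists ((phi a b - c) / K) => /=; first by rewrite divr_gt0// subr_gt0.
move=> [a' b'] []; rewrite -!ball_normE /= => ha hb.
have ha' := l2norm_le_mx_norm (a - a'); have hb' := l2norm_le_mx_norm (b - b').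
set e := (phi a b - c) / K in ha hb.
have e0 : 0 < e by rewrite divr_gt0// subr_gt0.
have h1 : l2norm (a - a') + l2norm (b - b') <= (p%:R + d%:R) * e.
  have := ler_wpM2l (ler0n R p) (ltW ha); have := ler_wpM2l (ler0n R d) (ltW hb).
  lra.
have h2 := le_trans (lip a a' b b') (ler_wpM2l M0 h1).
have eK : e * K = phi a b - c by rewrite /e divfK// gt_eqF.
move: h2; rewrite ler_norml => /andP[_ h2].
have : M * ((p%:R + d%:R) * e) < e * K by rewrite /K; lra.
lra.
Qed.

End VectorMeasurability.

Section DeriveMeasurability.
Context {dT} {T : measurableType dT} {R : realType} {p : nat}.

Lemma derive_measurable (g : T -> 'rV[R]_p -> R) (x : T -> 'rV[R]_p) (v : 'rV[R]_p) :
  (forall h : R, measurable_fun [set: T] (fun t => g t (h *: v + x t))) ->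
  (forall t, derivable (g t) (x t) v) ->
  measurable_fun [set: T] (fun t => 'D_v (g t) (x t)).
Proof.
move=> mg dg.
(* Difference quotients with steps 1 / (m + 1) converge pointwise to the derivative. Writing
   [0 *: v + x t] for [x t] lets the hypothesis at h = 0 apply. *)
pose q (m : nat) t := (m.+1%:R^-1)^-1 * (g t (m.+1%:R^-1 *: v + x t) - g t (0 *: v + x t)).
apply: (@measurable_fun_cvg _ _ _ _ q) => [m|t _].
  by apply: measurable_funM => //; apply: measurable_funB.
have h0 : (fun m : nat => m.+1%:R^-1 : R) @ \oo --> (0 : R)^'.
  move=> A /= hA; have := @cvg_harmonic R _ hA.
  rewrite /= !nbhs_filterE /= => hB; near=> m.
  have : harmonic m != 0 :> R by rewrite /= invr_eq0 pnatr_eq0.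
  by near: m.
have := cvg_comp _ _ h0 (dg t).
suff -> : (fun h : R => h^-1 *: ((g t \o shift (x t)) (h *: v) - g t (x t))) \o
    (fun m : nat => m.+1%:R^-1) = q ^~ t by [].
by apply/funext => m /=; rewrite /q scale0r add0r.
Unshelve. all: by end_near. Qed.

End DeriveMeasurability.

(** * Stochastic gradients given the past *)

Section BoundedIntegrable.
Context {d} {T : measurableType d} {R : realType} (P : probability T R).

Lemma bounded_integrable (f : T -> R) (M : R) : measurable_fun [set: T] f ->
  (forall t, `|f t| <= M) -> P.-integrable [set: T] (EFin \o f).
Proof.
move=> mf fM; apply: measurable_bounded_integrable => //.
  by rewrite (le_lt_trans (probability_le1 P measurableT))// ltry.
exists M; split; first exact: num_real.
by move=> x Mx t _ /=; rewrite (le_trans (fM t))// ltW.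
Qed.

End BoundedIntegrable.

Definition mfun_of {d d'} {T : measurableType d} {T' : measurableType d'} (f : T -> T')
    (mf : measurable_fun [set: T] f) : {mfun T >-> T'} :=
  MeasurableFun.Pack (MeasurableFun.Class (isMeasurableFun.Build _ _ _ _ _ mf)).

(* [G] generates the past, from which the fresh sample [xi] is independent:
   conditionally on the past, [xi] may be integrated out. *)
Section Freezing.
Context {dO} {Omega : measurableType dO} {R : realType} (P : probability Omega R).
Context {dX} {Xi : measurableType dX} (D : probability Xi R).
Variables (G : set (set Omega)) (xi : {RV P >-> Xi}).
Hypothesis Gm : G `<=` measurable.
Hypothesis GI : setI_closed G.
Hypothesis GT : G setT.
Hypothesis law : forall A, measurable A -> distribution P xi A = D A.
Hypothesis indep : forall A B, G A -> measurable B ->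
  (P (A `&` xi @^-1` B) = P A * P (xi @^-1` B))%E.

Let OmG := g_sigma_algebraType G.

Let sGm : <<s G >> `<=` @measurable _ Omega.
Proof. exact: smallest_sub (@sigma_algebra_measurable _ Omega) Gm. Qed.

(** Uniqueness of measures: [P] restricted to the event on [xi] and the corresponding multiple of
    [P] agree on the pi-system [G], hence on the sigma-algebra it generates. *)
Lemma indep_sigma A B : <<s G >> A -> measurable B ->
  (P (A `&` xi @^-1` B) = P A * P (xi @^-1` B))%E.
Proof.
move=> sA mB; have mxB : measurable (xi @^-1` B).
  by rewrite -[_ @^-1` _]setTI; apply: measurable_funPT.
have r0 : 0 <= fine (P (xi @^-1` B)) by rewrite fine_ge0.
have rE : (fine (P (xi @^-1` B)))%:E = P (xi @^-1` B).
  by rewrite fineK// fin_num_measure.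
pose m1 := mrestr P mxB; pose m2 := mscale (NngNum r0) P.
have m2E X : m2 X = (P X * P (xi @^-1` B))%E by rewrite muleC -[in RHS]rE.
have : m1 A = m2 A; last by move=> m12; apply: etrans m12 _; exact: m2E.
apply: (@g_sigma_algebra_measure_unique _ _ _ G Gm (fun=> setT)) => //.
- by rewrite bigcup_const.
- move=> X GX; apply: etrans (esym (m2E X)); exact: indep.
- move=> _; have : (P ([set: Omega] `&` xi @^-1` B) < +oo)%E; last by [].
  by rewrite setTI (le_lt_trans (probability_le1 P mxB))// ltry.
Qed.

Let mid : measurable_fun [set: Omega] (id : Omega -> OmG).
Proof. by move=> _ A sA; rewrite setTI; exact: sGm. Qed.

Let mpair : measurable_fun [set: Omega] (fun w => (w : OmG, xi w)).
Proof. by apply: measurable_fun_pair => //; exact: mid. Qed.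

Lemma past_measurable (f : OmG -> R) : measurable_fun [set: OmG] f ->
  measurable_fun [set: Omega] f.
Proof. by move=> mf; apply: (measurableT_comp mf mid). Qed.

(** The identity is regarded as a random variable with values in the past. Its joint law with [xi]
    agrees with the product measure on rectangles, so Fubini's theorem applies; it also yields the
    measurability of [hbar]. *)
Lemma freezing (H : OmG * Xi -> R) (M : R) (hbar : OmG -> R) :
  measurable_fun [set: OmG * Xi] H -> (forall z, `|H z| <= M) ->
  (forall w, (\int[D]_x (H (w, x))%:E)%E = (hbar w)%:E) ->
  [/\ measurable_fun [set: OmG] hbar, forall w, `|hbar w| <= M &
   (\int[P]_w (H (w, xi w))%:E = \int[P]_w (hbar w)%:E)%E].
Proof.
move=> mH HM hE.
pose m1 : probability OmG R := distribution P (mfun_of mid).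
pose m' : probability (OmG * Xi)%type R := distribution P (mfun_of mpair).
have m'E (A : set OmG) (B : set Xi) : measurable A -> measurable B ->
    m' (A `*` B) = (m1 A * D B)%E.
  move=> mA mB; rewrite -law// /m' /m1 /distribution /pushforward/=.
  exact: indep_sigma.
have mE : EFin \o H \o (fun w : Omega => (w : OmG, xi w)) = fun w => (H (w, xi w))%:E by [].
have intH : m'.-integrable setT (EFin \o H) by exact: bounded_integrable HM.
have intH' : (m1 \x D)%E.-integrable setT (EFin \o H).
  apply: measurable_bounded_integrable => //.
    rewrite [X in (X < _)%E](_ : _ = m' setT); last exact: (product_measure_unique m'E).
    by rewrite (le_lt_trans (probability_le1 m' measurableT))// ltry.
  exists M; split; first exact: num_real.
  by move=> x Mx t _ /=; rewrite (le_trans (HM t))// ltW.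
have Fh : fubini_F D (EFin \o H) = fun w => (hbar w)%:E.
  by apply/funext => w; rewrite /fubini_F -hE.
have mh : measurable_fun [set: OmG] hbar.
  by apply/measurable_EFinP; have := measurable_fubini_F intH'; rewrite Fh.
have hM w : `|hbar w| <= M.
  have iH : D.-integrable setT (fun x => (H (w, x))%:E).
    apply: (bounded_integrable D (M := M)) => //.
    exact: measurableT_comp mH (measurable_pair1 w).
  rewrite -lee_fin -abse_EFin -hE (le_trans (le_abse_integral _ _ _))//.
    by case/integrableP: iH.
  apply: (@le_trans _ _ (\int[D]_x M%:E)%E).
    apply: ge0_le_integral => //.
    - by apply: measurableT_comp => //; case/integrableP: iH.
    - by move=> x _; rewrite lee_fin.
  rewrite integral_cst// [X in (_ * X)%E](_ : _ = 1%E) ?mule1//.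
  exact: (probability_setT D).
split=> //.
transitivity (\int[m']_z (H z)%:E)%E.
  rewrite integral_distribution//; first exact/measurable_EFinP.
  by apply: (bounded_integrable P (M := M)); [exact: measurableT_comp mH mpair|].
transitivity (\int[m1 \x D]_z (H z)%:E)%E.
  apply: eq_measure_integral => A mA _; apply/esym.
  exact: (product_measure_unique m'E).
rewrite -(integral12_prod_meas1 intH').
rewrite Fh; rewrite integral_distribution//; first exact/measurable_EFinP.
by apply: (bounded_integrable P (M := M)); [exact: past_measurable|].
Qed.

End Freezing.

(** * The past generated by the samples *)

Section Past.
Context {dO} {Omega : measurableType dO} {R : realType} (P : probability Omega R).
Context {dX} {Xi : measurableType dX} {n : nat} (D : 'I_n -> probability Xi R).
Variables (xix xiy : 'I_n -> nat -> {RV P >-> Xi}).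
Hypothesis iid : iid_samples D xix xiy.

Definition sample (j : bool * 'I_n * nat) : {RV P >-> Xi} :=
  if j.1.1 then xix j.1.2 j.2 else xiy j.1.2 j.2.

Definition past_indices k : seq (bool * 'I_n * nat) :=
  [seq (bi, m) | bi <- enum {: bool * 'I_n}, m <- iota 0 k].

Lemma mem_past_indices k j : (j \in past_indices k) = (j.2 < k)%N.
Proof.
apply/allpairsP/idP => [[[bi m] [_ /= + ->]]|]; first by rewrite mem_iota.
by case: j => bi m /= mk; exists (bi, m); rewrite mem_enum mem_iota.
Qed.

Lemma uniq_past_indices k : uniq (past_indices k).
Proof.
apply: allpairs_uniq; [exact: enum_uniq|exact: iota_uniq|].
by move=> [a b] [a' b'] _ _ [-> ->].
Qed.

(** All samples before iteration [k] are constrained at once, possibly only by [setT]; this makes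
    the family closed under intersections, as [freezing] requires of generators. *)
Definition cylinder k : set (set Omega) := [set A | exists2 B : bool * 'I_n * nat -> set Xi,
  forall j, measurable (B j) & A = \bigcap_(j in [set` past_indices k]) sample j @^-1` B j].

Definition PastType k := g_sigma_algebraType (cylinder k).

Lemma measurable_sample_preimage j B : measurable B -> measurable (sample j @^-1` B).
Proof. by move=> mB; rewrite -[_ @^-1` _]setTI; exact: measurable_funPT. Qed.

Lemma cylinder_measurable k : cylinder k `<=` measurable.
Proof.
move=> _ [B mB ->]; apply: fin_bigcap_measurable; first exact: finite_seq.
by move=> j _; exact: measurable_sample_preimage.
Qed.

Lemma cylinderI k : setI_closed (cylinder k).
Proof.
move=> _ _ [B mB ->] [B' mB' ->]; exists (fun j => B j `&` B' j).
  by move=> j; exact: measurableI.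
rewrite -bigcapI; apply: eq_bigcapr => j _; by rewrite preimage_setI.
Qed.

Lemma cylinderT k : cylinder k setT.
Proof.
exists (fun=> setT) => //; apply/seteqP; split=> // w _ j _; by [].
Qed.

Lemma cylinder_sample k j B : (j.2 < k)%N -> measurable B -> cylinder k (sample j @^-1` B).
Proof.
move=> jk mB; exists (fun j' => if j' == j then B else setT).
  by move=> j'; case: ifP.
apply/seteqP; split=> w /=.
  by move=> Bw j' _; rewrite /=; case: eqP => [->|].
by move=> /(_ j) /=; rewrite eqxx; apply; rewrite mem_past_indices.
Qed.

Lemma sample_measurable k j : (j.2 < k)%N -> measurable_fun [set: PastType k] (sample j).
Proof.
move=> jk _ B mB; rewrite setTI.
by apply: sub_sigma_algebra; exact: cylinder_sample.
Qed.

Lemma past_measurableS k d' (T : measurableType d') (f : Omega -> T) :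
  measurable_fun [set: PastType k] f -> measurable_fun [set: PastType k.+1] f.
Proof.
move=> mf _ B mB; have := mf measurableT B mB; rewrite !setTI.
have cS : cylinder k `<=` <<s cylinder k.+1 >>.
  move=> _ [C mC ->].
  apply: (@fin_bigcap_measurable _ (PastType k.+1)); first exact: finite_seq.
  move=> j /=; rewrite mem_past_indices => jk; apply: sub_sigma_algebra.
  by apply: cylinder_sample => //; exact: ltnW.
exact: (smallest_sub (smallest_sigma_algebra _ _) cS).
Qed.

(** A cylinder together with an event on a sample of iteration [k] is one event of mutual
    independence over [j :: past_indices k], because [j] is a new index. *)
Lemma cylinder_indep k j A B : j.2 = k -> cylinder k A -> measurable B ->
  (P (A `&` sample j @^-1` B) = P A * P (sample j @^-1` B))%E.
Proof.
move=> jk [C mC ->] mB; have [_ _ ind] := iid.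
have smE s (E : bool * 'I_n * nat -> set Xi) : uniq s -> (forall j, measurable (E j)) ->
    (P (\bigcap_(j in [set` s]) sample j @^-1` E j) = \prod_(j <- s) P (sample j @^-1` E j))%E.
  move=> us mE; have := ind s E us mE.
  have sE j' : (if j'.1.1 then xix j'.1.2 j'.2 else xiy j'.1.2 j'.2 : Omega -> Xi) = sample j'.
    by rewrite /sample; case: ifP.
  under eq_bigcapr do rewrite sE.
  by move=> ->; apply: eq_bigr => j' _; rewrite sE.
have jn : j \notin past_indices k by rewrite mem_past_indices jk ltnn.
pose E j' := if j' == j then B else C j'.
have mE j' : measurable (E j') by rewrite /E; case: ifP.
have EC j' : j' \in past_indices k -> E j' = C j'.
  by rewrite /E; case: eqP => // -> jin; rewrite jin in jn.
have -> : \bigcap_(j' in [set` past_indices k]) sample j' @^-1` C j' `&` sample j @^-1` B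
    = \bigcap_(j' in [set` j :: past_indices k]) sample j' @^-1` E j'.
  apply/seteqP; split=> w /=.
    move=> [h1 h2] j'; rewrite /= inE => /orP[/eqP->|j'in]; first by rewrite /E eqxx.
    by rewrite EC//; exact: h1.
  move=> h; split; last by have := h j; rewrite /= inE eqxx /E eqxx; exact.
  by move=> j' j'in; have := h j'; rewrite /= inE j'in orbT EC//; exact.
rewrite smE//; last by rewrite /= jn uniq_past_indices.
rewrite big_cons {1}/E eqxx muleC smE ?uniq_past_indices//; congr (_ * _)%E.
by apply: eq_big_seq => j' j'in; rewrite EC.
Qed.

Lemma sample_law j A : measurable A -> distribution P (sample j) A = D j.1.2 A.
Proof.
have [h1 h2 _] := iid; case: j => -[b i] k mA; rewrite /sample /=.
by case: b; [exact: h1|exact: h2].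
Qed.

Lemma sample_freezing k j (H : PastType k * Xi -> R) (M : R) (hbar : PastType k -> R) :
  j.2 = k -> measurable_fun [set: PastType k * Xi] H -> (forall z, `|H z| <= M) ->
  (forall w, (\int[D j.1.2]_x (H (w, x))%:E)%E = (hbar w)%:E) ->
  [/\ measurable_fun [set: PastType k] hbar, forall w, `|hbar w| <= M &
   (\int[P]_w (H (w, sample j w))%:E = \int[P]_w (hbar w)%:E)%E].
Proof.
move=> jk; apply: freezing.
- exact: cylinder_measurable.
- exact: cylinderI.
- exact: cylinderT.
- exact: sample_law.
- by move=> A B; exact: cylinder_indep.
Qed.

Lemma past_measurable_ambient k (f : Omega -> R) :
  measurable_fun [set: PastType k] f -> measurable_fun [set: Omega] f.
Proof. by apply: past_measurable; exact: cylinder_measurable. Qed.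

End Past.

Section DotMeasurable.
Context {d} {T : measurableType d} {R : realType} {p : nat}.

Lemma measurable_dotp (u w : T -> 'rV[R]_p) : mvec u -> mvec w ->
  measurable_fun [set: T] (fun t => dotp (u t) (w t)).
Proof.
by move=> mu mw; apply: measurable_sum => j; exact: measurable_funM.
Qed.

Lemma integral_dotp (P : probability T R) (a g : 'rV[R]_p) (G : T -> 'rV[R]_p) (C : R) :
  mvec G -> (forall t, l2norm (G t) <= C) ->
  (forall j, (\int[P]_t (G t 0 j)%:E)%E = (g 0 j)%:E) ->
  (\int[P]_t (dotp a (G t))%:E)%E = (dotp a g)%:E.
Proof.
move=> mG GC Gg.
have iG j : P.-integrable [set: T] (fun t => (G t 0 j)%:E).
  apply: (bounded_integrable P (M := C)) => // t.
  exact: le_trans (normr_coord_l2norm _ _) (GC t).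
rewrite /dotp; under eq_integral do rewrite -sumEFin.
rewrite integral_sum//; last first.
  by move=> j; rewrite (_ : (fun t => _) = (fun t => ((a 0 j)%:E * (G t 0 j)%:E)%E))//;
    exact: integrableZl.
rewrite -sumEFin; apply: eq_bigr => j _.
under eq_integral do rewrite EFinM.
by rewrite integralZl// Gg.
Qed.

End DotMeasurable.

Section OracleMeasurability.
Context {dX} {Xi : measurableType dX} {R : realType} {p d : nat}.
Variables (Y : set 'rV[R]_d) (F : Xi -> 'rV[R]_p -> 'rV[R]_d -> R).
Hypothesis mF : measurable_fun [set: borel ('rV[R]_p * 'rV[R]_d)%type * Xi]
  (fun t : borel ('rV[R]_p * 'rV[R]_d)%type * Xi => F t.2 t.1.1 t.1.2).
Hypothesis dF : forall xi x y, Y y ->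
  differentiable (fun t : 'rV[R]_p * 'rV[R]_d => F xi t.1 t.2) (x, y).
Context {dT} {T : measurableType dT}.
Variables (x : T -> 'rV[R]_p) (y : T -> 'rV[R]_d) (xi : T -> Xi).
Hypotheses (mx : mvec x) (my : mvec y) (mxi : measurable_fun [set: T] xi).
Hypothesis yY : forall t, Y (y t).

Let mcomp (u : T -> 'rV[R]_p) (w : T -> 'rV[R]_d) : mvec u -> mvec w ->
  measurable_fun [set: T] (fun t => F (xi t) (u t) (w t)).
Proof.
move=> mu mw.
exact: (measurableT_comp mF (measurable_fun_pair (measurable_borel_pair mu mw) mxi)).
Qed.

Let mshift q (u : T -> 'rV[R]_q) (v : 'rV[R]_q) : mvec u -> mvec (fun t => v + u t).
Proof.
move=> mu j; under eq_fun do rewrite mxE.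
by apply: measurable_funD => //; exact: mu.
Qed.

Lemma measurable_grad_x : mvec (fun t => grad_x (F (xi t)) (x t) (y t)).
Proof.
move=> j; under eq_fun do rewrite mxE.
apply: (@derive_measurable _ T R p (fun t x' => F (xi t) x' (y t))) => [h|t].
  by apply: mcomp => //; exact: mshift.
apply: diff_derivable; apply: differentiable_partial_l.
exact: dF (yY t).
Qed.

Lemma measurable_grad_y : mvec (fun t => grad_y (F (xi t)) (x t) (y t)).
Proof.
move=> j; under eq_fun do rewrite mxE.
apply: (@derive_measurable _ T R d (fun t y' => F (xi t) (x t) y')) => [h|t].
  by apply: mcomp => //; exact: mshift.
apply: diff_derivable; apply: differentiable_partial_r.
exact: dF (yY t).
Qed.

End OracleMeasurability.

(* [S] is a stochastic gradient ([grad_x] or [grad_y]) with mean [m]. *)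
Section Oracle.
Context {dO} {Omega : measurableType dO} {R : realType} (P : probability Omega R).
Context {dX} {Xi : measurableType dX} {n p d q : nat} (D : 'I_n -> probability Xi R).
Variables (xix xiy : 'I_n -> nat -> {RV P >-> Xi}) (Y : set 'rV[R]_d) (C : R).
Variables (S : 'I_n -> Xi -> 'rV[R]_p -> 'rV[R]_d -> 'rV[R]_q).
Variables (m : 'I_n -> 'rV[R]_p -> 'rV[R]_d -> 'rV[R]_q).
Hypothesis iid : iid_samples D xix xiy.
Hypothesis SC : forall i xi x y, Y y -> l2norm (S i xi x y) <= C.
Hypothesis Sm : forall i x y (j : 'I_q), Y y ->
  'E_(D i)[fun xi => (S i xi x y 0 j)%R]%E = (m i x y 0 j)%:E.
Hypothesis mS : forall i dT (T : measurableType dT) (x : T -> 'rV[R]_p)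
  (y : T -> 'rV[R]_d) (xi : T -> Xi), mvec x -> mvec y -> measurable_fun [set: T] xi ->
  (forall t, Y (y t)) -> mvec (fun t => S i (xi t) (x t) (y t)).

Let mcst dT (T : measurableType dT) k (v : 'rV[R]_k) : mvec (fun _ : T => v).
Proof. by move=> j; exact: measurable_cst. Qed.

Let intS i x y a : Y y ->
  (\int[D i]_xi (dotp a (S i xi x y))%:E)%E = (dotp a (m i x y))%:E.
Proof.
move=> Yy; apply: (@integral_dotp _ _ _ _ (D i) _ _ _ C).
- exact: mS.
- by move=> xi; exact: SC.
- by move=> j; have := Sm i x j Yy; rewrite unlock.
Qed.

(** The squared norm of the mean is the expectation of its inner product with the sample, hence at
    most C times its norm. *)
Lemma oracle_mean_bounded i x y : Y y -> l2norm (m i x y) <= C.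
Proof.
move=> Yy; have C0 : 0 <= C by exact: le_trans (l2norm_ge0 _) (SC i point x Yy).
have : ((l2norm (m i x y) ^+ 2)%:E <= (l2norm (m i x y) * C)%:E)%E.
  rewrite sqr_l2norm -(intS i x _ Yy).
  have mf : measurable_fun [set: Xi] (fun xi => dotp (m i x y) (S i xi x y)).
    by apply: measurable_dotp; [exact: mcst|exact: mS].
  apply: (@le_trans _ _ (\int[D i]_xi (l2norm (m i x y) * C)%:E)%E).
    apply: le_integral.
    - exact: measurableT.
    - apply: (bounded_integrable (D i) (M := l2norm (m i x y) * C) mf) => xi.
      by rewrite (le_trans (normr_dotp _ _))// ler_wpM2l ?l2norm_ge0// SC.
    - by apply: (bounded_integrable (D i) (measurable_cst (l2norm (m i x y) * C))
        (M := `|l2norm (m i x y) * C|)).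
    - move=> xi _; rewrite lee_fin (le_trans (cauchy_schwarz _ _))//.
      by rewrite ler_wpM2l ?l2norm_ge0// SC.
  rewrite integral_cst// [X in (_ * X)%E](_ : _ = 1%E) ?mule1//.
  exact: (probability_setT (D i)).
rewrite lee_fin expr2; have [->//|e0] := eqVneq (l2norm (m i x y)) 0.
by rewrite ler_pM2l// lt_def e0 l2norm_ge0.
Qed.

Section Step.
Variables (k : nat) (j : bool * 'I_n * nat).
Hypothesis jk : j.2 = k.
Variables (x : PastType xix xiy k -> 'rV[R]_p) (y : PastType xix xiy k -> 'rV[R]_d).
Variables (a : PastType xix xiy k -> 'rV[R]_q).
Hypotheses (mx : mvec x) (my : mvec y) (ma : mvec a) (yY : forall w, Y (y w)).
Variable M : R.
Hypothesis aM : forall w, l2norm (a w) <= M.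

Let i := j.1.2.

Let MC : 0 <= M * C.
Proof.
rewrite mulr_ge0//; first exact: le_trans (l2norm_ge0 _) (aM point).
exact: le_trans (l2norm_ge0 _) (SC i point (x point) (yY point)).
Qed.

Let H (z : PastType xix xiy k * Xi) := dotp (a z.1) (S i z.2 (x z.1) (y z.1)).

Let mvec_fst r (u : PastType xix xiy k -> 'rV[R]_r) : mvec u ->
  mvec (fun z : PastType xix xiy k * Xi => u z.1).
Proof. by move=> mu b; exact: (measurableT_comp (mu b) measurable_fst). Qed.

Let freeze : [/\ measurable_fun [set: PastType xix xiy k] (fun w => dotp (a w) (m i (x w) (y w))),
   forall w, `|dotp (a w) (m i (x w) (y w))| <= M * C &
   (\int[P]_w (H (w, sample xix xiy j w))%:E
    = \int[P]_w (dotp (a w) (m i (x w) (y w)))%:E)%E].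
Proof.
apply: (@sample_freezing _ _ _ _ _ _ _ D xix xiy iid k j H (M * C)) => //.
- apply: measurable_dotp; first exact: mvec_fst.
  by apply: mS; [exact: mvec_fst|exact: mvec_fst|exact: measurable_snd|].
- move=> z; rewrite (le_trans (normr_dotp _ _))// ler_pM ?l2norm_ge0//.
  exact: SC.
- by move=> w; exact: (@intS i (x w) (y w) (a w) (yY w)).
Qed.

Lemma oracle_mean_measurable :
  measurable_fun [set: PastType xix xiy k] (fun w => dotp (a w) (m i (x w) (y w))).
Proof. by case: freeze. Qed.

(** Integrating out the fresh sample turns the inner product of [a] with [S] into that with [m];
    both integrals are finite and cancel. *)
Lemma oracle_martingale :
  let N w := dotp (a w) (m i (x w) (y w) - S i (sample xix xiy j w) (x w) (y w)) in
  P.-integrable [set: Omega] (EFin \o (N : Omega -> R)) /\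
  (\int[P]_w (N w)%:E = 0)%E.
Proof.
have [h1 h2 h3] := freeze.
have mO (f : PastType xix xiy k -> R) : measurable_fun [set: PastType xix xiy k] f ->
    measurable_fun [set: Omega] f.
  exact: past_measurable_ambient.
have mvO r (u : PastType xix xiy k -> 'rV[R]_r) : mvec u -> mvec (u : Omega -> 'rV[R]_r).
  by move=> mu b; exact: (mO _ (mu b)).
have i1 : P.-integrable [set: Omega] (EFin \o (fun w : Omega => dotp (a w) (m i (x w) (y w)))).
  by apply: (bounded_integrable P (M := M * C)); [exact: mO|].
have i2 : P.-integrable [set: Omega]
    (EFin \o (fun w : Omega => dotp (a w) (S i (sample xix xiy j w) (x w) (y w)))).
  apply: (bounded_integrable P (M := M * C)).
    apply: measurable_dotp; first exact: mvO.
    by apply: mS; [exact: mvO|exact: mvO|exact: measurable_funPT|].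
  move=> w; rewrite (le_trans (normr_dotp _ _))// ler_pM ?l2norm_ge0//.
  exact: SC.
have NE : EFin \o (fun w : Omega =>
    dotp (a w) (m i (x w) (y w) - S i (sample xix xiy j w) (x w) (y w)))
  = ((EFin \o (fun w : Omega => dotp (a w) (m i (x w) (y w)))) \-
    (EFin \o (fun w : Omega => dotp (a w) (S i (sample xix xiy j w) (x w) (y w)))))%E.
  by apply/funext => w /=; rewrite dotpBr EFinB.
split; first by rewrite NE; exact: integrableB.
rewrite -[X in integral _ _ X]/(EFin \o _) NE integralB//.
rewrite [X in (_ - X)%E]h3 subee//.
exact: integrable_fin_num.
Qed.

End Step.

Lemma oracle_mean_mvec k i (x : PastType xix xiy k -> 'rV[R]_p)
    (y : PastType xix xiy k -> 'rV[R]_d) : mvec x -> mvec y -> (forall w, Y (y w)) ->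
  mvec (fun w => m i (x w) (y w)).
Proof.
move=> mx my yY l.
(* A constant basis vector isolates the coordinate [l]. The mean depends only on [D i], the law of
   both kinds of samples of node [i], so [true] is an arbitrary choice. *)
have := @oracle_mean_measurable k (true, i, k) erefl x y (fun=> delta_mx 0 l) mx my
  (mcst _) yY (l2norm (delta_mx 0 l : 'rV[R]_q)) (fun=> lexx _).
congr measurable_fun; apply/funext => w; rewrite /dotp (bigD1 l)//= mxE !eqxx mul1r.
by rewrite big1 ?addr0// => l' l'l; rewrite mxE (negbTE l'l) mul0r.
Qed.

End Oracle.

(** * The run of the algorithm *)

Section Run.
Context {R : realType} {n p d : nat} {Xi : Type}.
Variables (al be gx gy c C : R) (Y : set 'rV[R]_d) (W : 'M[R]_n).
Variables (F : 'I_n -> Xi -> 'rV[R]_p -> 'rV[R]_d -> R).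
Variables (x0 : 'M[R]_(n, p)) (y0 : 'M[R]_(n, d)) (xix xiy : 'I_n -> nat -> Xi).
Hypotheses (n0 : (0 < n)%N) (c0 : 0 < c).
Hypotheses (cvxY : convex_set Y) (compY : compact Y).
Hypothesis y0Y : forall i, Y (row i y0).
Hypothesis dsW : doubly_stochastic W.
Hypothesis FxC : forall i xi u w, Y w -> l2norm (grad_x (F i xi) u w) <= C.
Hypothesis FyC : forall i xi u w, Y w -> l2norm (grad_y (F i xi) u w) <= C.

Definition run k := dtiada (DTiAdaParams al be gx gy) Y W F c x0 y0 xix xiy k.
Definition run_x k i := row i (st_x (run k)).
Definition run_y k i := row i (st_y (run k)).
Definition run_mx k i := st_mx (run k) 0 i.
Definition run_my k i := st_my (run k) 0 i.
Definition run_g k i := grad_x (F i (xix i k)) (run_x k i) (run_y k i).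
Definition run_h k i := grad_y (F i (xiy i k)) (run_x k i) (run_y k i).
Definition run_zx k i :=
  run_x k i - gx *: (Num.max (run_mx k.+1 i) (run_my k.+1 i) `^ (- al) *: run_g k i).
Definition run_zy k i := run_y k i + gy *: (run_my k.+1 i `^ (- be) *: run_h k i).

Let Y0 : Y !=set0. Proof. by exists (row (Ordinal n0) y0). Qed.

Lemma run_mx0 i : run_mx 0 i = c. Proof. by rewrite /run_mx /= mxE. Qed.
Lemma run_my0 i : run_my 0 i = c. Proof. by rewrite /run_my /= mxE. Qed.

Lemma run_mxS k i : run_mx k.+1 i = run_mx k i + l2norm (run_g k i) ^+ 2.
Proof. by rewrite /run_mx /= mxE rowK. Qed.

Lemma run_myS k i : run_my k.+1 i = run_my k i + l2norm (run_h k i) ^+ 2.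
Proof. by rewrite /run_my /= mxE rowK. Qed.

Lemma run_xS k i : run_x k.+1 i = row i (W *m \matrix_l run_zx k l).
Proof.
rewrite /run_x /=; congr (row i (W *m _)); apply/row_matrixP => l; rewrite rowK.
apply/rowP => j; rewrite /run_zx /run_g /run_x /run_y /run_mx /run_my /=.
by rewrite mul_diag_mx !mxE.
Qed.

Lemma run_yS k i : run_y k.+1 i = Defs.proj Y (row i (W *m \matrix_l run_zy k l)).
Proof.
rewrite /run_y /= rowK; congr (Defs.proj Y (row i (W *m _))).
apply/row_matrixP => l; rewrite rowK.
apply/rowP => j; rewrite /run_zy /run_h /run_x /run_y /run_my /=.
by rewrite mul_diag_mx !mxE.
Qed.

Lemma run_yY k i : Y (run_y k i).
Proof.
by case: k => [|k]; [exact: y0Y|rewrite run_yS; exact: (projP compY Y0 _).1].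
Qed.

Lemma run_ybY k : Y (avgv (run_y k)).
Proof. by apply: convex_avgv => // i; exact: run_yY. Qed.

Lemma run_gC k i : l2norm (run_g k i) <= C.
Proof. exact/FxC/run_yY. Qed.

Lemma run_hC k i : l2norm (run_h k i) <= C.
Proof. exact/FyC/run_yY. Qed.

Let avg_rowE q (z : 'I_n -> 'rV[R]_q) : avg_row (\matrix_l z l) = avgv z.
Proof. by apply: eq_avgv => l; rewrite rowK. Qed.

Let rowsE q (z : 'I_n -> 'rV[R]_q) w :
  avg (fun i => l2norm (row i (\matrix_l z l) - w) ^+ 2) = avg (fun i => l2norm (z i - w) ^+ 2).
Proof. by apply: eq_avg => i; rewrite rowK. Qed.

Lemma run_xbS k : avgv (run_x k.+1) = avgv (run_x k) -
  gx *: avgv (fun i => Num.max (run_mx k.+1 i) (run_my k.+1 i) `^ (- al) *: run_g k i).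
Proof.
rewrite -avgvZ -avgvB -[RHS]avg_rowE -(avg_row_mixing dsW).
by apply: eq_avgv => i; rewrite run_xS.
Qed.

Lemma run_xvarS k : var (run_x k.+1) <= rhoW W * var (run_zx k).
Proof.
have := mixing_variance n0 dsW (\matrix_l run_zx k l); rewrite (rowsE (run_zx k)) avg_rowE => h.
apply: le_trans h; rewrite le_eqVlt; apply/orP; left; apply/eqP; apply: eq_avg => i.
rewrite run_xS; congr (l2norm (_ - _) ^+ 2); rewrite -[in RHS]avg_rowE -(avg_row_mixing dsW).
by rewrite (eq_avgv (run_xS k)).
Qed.

Lemma run_ydist k w : Y w ->
  avg (fun i => l2norm (run_y k.+1 i - w) ^+ 2)
  <= avg (fun i => l2norm (run_zy k i - w) ^+ 2) - (1 - rhoW W) * var (run_zy k).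
Proof.
move=> Yw; have := mixing_dist2 n0 dsW (\matrix_l run_zy k l) w.
rewrite !(rowsE (run_zy k)) avg_rowE => h; apply: le_trans h.
apply: (@ler_avg _ _ (fun i => l2norm (run_y k.+1 i - w) ^+ 2)) => i.
rewrite run_yS ler_sqr ?nnegrE ?l2norm_ge0//.
exact: proj_dist.
Qed.

(** The mean of projected rows need not be the projection of the mean. The variance is therefore
    compared with the squared distances to [proj Y zb], to which nonexpansiveness applies. *)
Lemma run_yvarS k : var (run_y k.+1) <= rhoW W * var (run_zy k).
Proof.
pose zb := avgv (run_zy k).
apply: le_trans (avg_var_le n0 (run_y k.+1) (Defs.proj Y zb)) _.
have := mixing_variance n0 dsW (\matrix_l run_zy k l); rewrite (rowsE (run_zy k)) avg_rowE => h.
apply: le_trans h.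
apply: (@ler_avg _ _ (fun i => l2norm (run_y k.+1 i - Defs.proj Y zb) ^+ 2)) => i.
rewrite run_yS ler_sqr ?nnegrE ?l2norm_ge0//.
exact: proj_nonexpansive.
Qed.

End Run.

Section VectorOperations.
Context {dT} {T : measurableType dT} {R : realType} {p q : nat}.
Implicit Types (u v : T -> 'rV[R]_p) (s : T -> R).

Lemma mvecD u v : mvec u -> mvec v -> mvec (fun t => u t + v t).
Proof. by move=> mu mv j; under eq_fun do rewrite mxE; exact: measurable_funD. Qed.

Lemma mvecZ s u : measurable_fun [set: T] s -> mvec u -> mvec (fun t => s t *: u t).
Proof. by move=> ms mu j; under eq_fun do rewrite mxE; exact: measurable_funM. Qed.

Lemma mvecB u v : mvec u -> mvec v -> mvec (fun t => u t - v t).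
Proof.
move=> mu mv j; under eq_fun do rewrite !mxE.
by apply: measurable_funB; [exact: mu|exact: mv].
Qed.

Lemma mvec_sum n (u : 'I_n -> T -> 'rV[R]_p) :
  (forall i, mvec (u i)) -> mvec (fun t => \sum_i u i t).
Proof.
move=> mu j; under eq_fun do rewrite summxE.
by apply: measurable_sum => i; exact: mu.
Qed.

Lemma mvec_avgv n (u : T -> 'I_n -> 'rV[R]_p) :
  (forall i, mvec (u ^~ i)) -> mvec (fun t => avgv (u t)).
Proof. by move=> mu; apply: mvecZ => //; exact: mvec_sum. Qed.

Lemma mvec_row_mulmx n (W : 'M[R]_n) (u : T -> 'I_n -> 'rV[R]_p) i :
  (forall i, mvec (u ^~ i)) -> mvec (fun t => row i (W *m \matrix_l u t l)).
Proof.
move=> mu j; under eq_fun do rewrite !mxE.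
apply: measurable_sum => l; apply: measurable_funM => //.
by under eq_fun do rewrite mxE; exact: mu.
Qed.

Lemma mvec_lipschitz (phi : 'rV[R]_p -> 'rV[R]_q) (M : R) u : 0 <= M ->
  (forall a b, l2norm (phi a - phi b) <= M * l2norm (a - b)) ->
  mvec u -> mvec (fun t => phi (u t)).
Proof.
move=> M0 lip mu j.
apply: (@lipschitz_measurable _ _ _ _ _ (fun a _ => phi a 0 j) M u u) => // a a' b b'.
have -> : phi a 0 j - phi a' 0 j = (phi a - phi a') 0 j by rewrite !mxE.
rewrite (le_trans (normr_coord_l2norm _ _))// (le_trans (lip _ _))//.
by rewrite ler_wpM2l// lerDl l2norm_ge0.
Qed.

End VectorOperations.

Lemma past_mvecS {dO} {Omega : measurableType dO} {R : realType} (P : probability Omega R)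
    {dX} {Xi : measurableType dX} {n p : nat} (xix xiy : 'I_n -> nat -> {RV P >-> Xi}) k
    (u : Omega -> 'rV[R]_p) :
  mvec (u : PastType xix xiy k -> _) -> mvec (u : PastType xix xiy k.+1 -> _).
Proof. by move=> mu j; apply: past_measurableS (mu j). Qed.

Section StochasticRun.
Context {dO} {Omega : measurableType dO} {R : realType} (P : probability Omega R).
Context {dX} {Xi : measurableType dX} {n p d : nat} (D : 'I_n -> probability Xi R).
Variables (xix xiy : 'I_n -> nat -> {RV P >-> Xi}) (Y : set 'rV[R]_d) (W : 'M[R]_n).
Variables (F : 'I_n -> Xi -> 'rV[R]_p -> 'rV[R]_d -> R).
Variables (al be gx gy c C : R) (x0 : 'M[R]_(n, p)) (y0 : 'M[R]_(n, d)).
Hypotheses (n0 : (0 < n)%N) (c0 : 0 < c).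
Hypotheses (cvxY : convex_set Y) (compY : compact Y).
Hypothesis y0Y : forall i, Y (row i y0).
Hypothesis reg : forall i, regular_oracle Y (D i) (F i).
Hypothesis dF : forall i xi x y, Y y ->
  differentiable (fun t : 'rV[R]_p * 'rV[R]_d => F i xi t.1 t.2) (x, y).

Let Y0 : Y !=set0. Proof. by exists (row (Ordinal n0) y0). Qed.

Let past k := PastType xix xiy k.
Let x (w : Omega) := run_x al be gx gy c Y W F x0 y0 (fun i k => xix i k w) (fun i k => xiy i k w).
Let y (w : Omega) := run_y al be gx gy c Y W F x0 y0 (fun i k => xix i k w) (fun i k => xiy i k w).
Let mx (w : Omega) := run_mx al be gx gy c Y W F x0 y0 (fun i k => xix i k w) (fun i k => xiy i k w).
Let my (w : Omega) := run_my al be gx gy c Y W F x0 y0 (fun i k => xix i k w) (fun i k => xiy i k w).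
Let g (w : Omega) := run_g al be gx gy c Y W F x0 y0 (fun i k => xix i k w) (fun i k => xiy i k w).
Let h (w : Omega) := run_h al be gx gy c Y W F x0 y0 (fun i k => xix i k w) (fun i k => xiy i k w).

(** The step from [k] reads the samples of index [k], which belong to the past of [k.+1]. The
    projection preserves measurability because it is 1-Lipschitz. *)
Lemma run_measurable k :
  [/\ forall i, mvec (fun w : past k => x w k i), forall i, mvec (fun w : past k => y w k i),
      forall i, measurable_fun [set: past k] (fun w => mx w k i) &
      forall i, measurable_fun [set: past k] (fun w => my w k i)].
Proof.
elim: k => [|k [mx_x mx_y mx_mx mx_my]].
  split=> i.
  - by move=> j; exact: (measurable_cst (row i x0 0 j)).
  - by move=> j; exact: (measurable_cst (row i y0 0 j)).
  - by under eq_fun do rewrite /mx run_mx0; exact: measurable_cst.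
  - by under eq_fun do rewrite /my run_my0; exact: measurable_cst.
have mgx i : mvec (fun w : past k.+1 => x w k i) by exact: past_mvecS.
have mgy i : mvec (fun w : past k.+1 => y w k i) by exact: past_mvecS.
have yY w i : Y (y w k i) by exact: run_yY.
have mg i : mvec (fun w : past k.+1 => g w k i).
  apply: (@measurable_grad_x _ Xi R p d Y (F i) (reg i).1 (dF i) _ (past k.+1)
    (fun w => x w k i) (fun w => y w k i) (xix i k)) => //.
  exact: (sample_measurable (xix := xix) (xiy := xiy) (j := (true, i, k))).
have mh i : mvec (fun w : past k.+1 => h w k i).
  apply: (@measurable_grad_y _ Xi R p d Y (F i) (reg i).1 (dF i) _ (past k.+1)
    (fun w => x w k i) (fun w => y w k i) (xiy i k)) => //.
  exact: (sample_measurable (xix := xix) (xiy := xiy) (j := (false, i, k))).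
have mmx i : measurable_fun [set: past k.+1] (fun w => mx w k.+1 i).
  under eq_fun do rewrite /mx run_mxS sqr_l2norm.
  by apply: measurable_funD; [exact: past_measurableS (mx_mx i)|exact: measurable_dotp (mg i) (mg i)].
have mmy i : measurable_fun [set: past k.+1] (fun w => my w k.+1 i).
  under eq_fun do rewrite /my run_myS sqr_l2norm.
  by apply: measurable_funD; [exact: past_measurableS (mx_my i)|exact: measurable_dotp (mh i) (mh i)].
have mpow (s : past k.+1 -> R) (a : R) : measurable_fun [set: past k.+1] s ->
    measurable_fun [set: past k.+1] (fun w => s w `^ a).
  by move=> ms; exact: (measurableT_comp (measurable_powR a) ms).
split=> // i.
- under [X in mvec X]eq_fun do rewrite /x run_xS.
  apply: mvec_row_mulmx => l; apply: mvecB; first exact: mgx.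
  apply: mvecZ => //; apply: mvecZ; last exact: mg.
  by apply: mpow; apply: measurable_maxr; [exact: mmx|exact: mmy].
- under [X in mvec X]eq_fun do rewrite /y run_yS.
  apply: (mvec_lipschitz (M := 1)) => // [a b|].
    by rewrite mul1r; exact: proj_nonexpansive.
  apply: mvec_row_mulmx => l; apply: mvecD; first exact: mgy.
  apply: mvecZ => //; apply: mvecZ; last exact: mh.
  by apply: mpow; exact: mmy.
Qed.

End StochasticRun.

(** * Expectations *)

Section IntegralAlmostEverywhere.
Context {d} {T : measurableType d} {R : realType} (P : probability T R).

Lemma integral_le_cst (f M : T -> R) (b : R) :
  measurable_fun [set: T] f -> (forall t, 0 <= f t) ->
  P.-integrable [set: T] (EFin \o M) -> (\int[P]_t (M t)%:E = 0)%E ->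
  (\forall t \ae P, f t <= b + M t) ->
  (\int[P]_t (f t)%:E <= b%:E)%E.
Proof.
move=> mf f0 iM M0 fb.
have mM : measurable_fun [set: T] M by apply/measurable_EFinP; case/integrableP: iM.
have mbM : measurable_fun [set: T] (fun t => b + M t) by exact: measurable_funD.
(* [f] is not assumed integrable. The maximum [g] dominates it everywhere, so monotonicity for
   nonnegative functions applies, and equals [b + M] almost everywhere, so its integral is known. *)
pose g t := Num.max (f t) (b + M t).
have mg : measurable_fun [set: T] g by exact: measurable_maxr.
apply: (@le_trans _ _ (\int[P]_t (g t)%:E)%E).
  apply: ge0_le_integral => //.
  - by move=> t _; rewrite lee_fin.
  - exact/measurable_EFinP.
  - exact/measurable_EFinP.
  - by move=> t _; rewrite lee_fin le_max lexx.
rewrite (@ae_eq_integral _ _ _ P setT (fun t => (b + M t)%:E))//; last 3 first.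
- exact/measurable_EFinP.
- exact/measurable_EFinP.
- by apply: filterS fb => t ft _; rewrite /g max_r.
under eq_integral do rewrite EFinD.
rewrite integralD//; last by apply: (bounded_integrable P (measurable_cst b) (M := `|b|)).
rewrite M0 adde0 integral_cst// [X in (_ * X)%E](_ : _ = 1%E) ?mule1//.
exact: (probability_setT P).
Qed.

End IntegralAlmostEverywhere.

Lemma inconsistency_ae {dO} {Omega : measurableType dO} {R : realType}
    (P : probability Omega R) (n : nat) (b : Omega -> nat -> 'I_n -> R) (e z : R) :
  0 <= z -> (forall w k, 0 < avg (b w k)) -> (forall w i, b w 0 i = avg (b w 0)) ->
  inconsistency_sq P e b = (z ^+ 2)%:E ->
  \forall w \ae P, forall k i,
    `|b w k i `^ (- e) - avg (b w k) `^ (- e)| <= z * avg (b w k) `^ (- e).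
Proof.
move=> z0 b0 bc bz.
have : (inconsistency_sq P e b <= (z ^+ 2)%:E)%E by rewrite bz.
rewrite /inconsistency_sq => /ess_supP; apply: filterS => w h [|k] i.
  (* The supremum excludes iteration 0, where all nodes agree with their average. *)
  by rewrite bc subrr normr0 mulr_ge0 ?powR_ge0.
have q0 : 0 < avg (b w k.+1) `^ (- e) by rewrite powR_gt0.
have {}h : (((b w k.+1 i `^ (- e) - avg (b w k.+1) `^ (- e)) ^+ 2
    / (avg (b w k.+1) `^ (- e)) ^+ 2)%:E <= (z ^+ 2)%:E)%E.
  by apply: le_trans h; apply: ereal_sup_ubound; exists (i, k.+1).
move: h; rewrite lee_fin /= ler_pdivrMr ?exprn_gt0// -exprMn => h.
rewrite -ler_sqr ?nnegrE ?mulr_ge0 ?(ltW q0)//.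
by rewrite real_normK ?num_real.
Qed.

Section Expectation.
Context {dO} {Omega : measurableType dO} {R : realType} (P : probability Omega R).
Context {dX} {Xi : measurableType dX} {n p d : nat} (D : 'I_n -> probability Xi R).
Variables (xix xiy : 'I_n -> nat -> {RV P >-> Xi}) (Y : set 'rV[R]_d) (W : 'M[R]_n).
Variables (F : 'I_n -> Xi -> 'rV[R]_p -> 'rV[R]_d -> R).
Variables (L mu C c al be gx gy zv zu Delta m0 : R) (x0 : 'M[R]_(n, p)) (y0 : 'M[R]_(n, d)).
Hypotheses (n0 : (0 < n)%N) (L0 : 0 <= L) (mu0 : 0 < mu) (c0 : 0 < c).
Hypotheses (be0 : 0 < be) (beal : be < al) (al1 : al < 1) (gx0 : 0 < gx) (gy0 : 0 < gy).
Hypotheses (zv0 : 0 <= zv) (zu0 : 0 <= zu).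
Hypotheses (clY : closed Y) (cvxY : convex_set Y) (y0Y : forall i, Y (row i y0)).

Let f := local_obj D F.
Let G := global_obj f.
Let ys := ystar Y G.
Let Gx i := grad_x (f i).
Let Gy i := grad_y (f i).
Let kap := 2 * L / mu.
Let PhiY := Phi Y G.

Hypothesis reg : forall i, regular_oracle Y (D i) (F i).
Hypothesis sc : forall i, strongly_concave_y Y mu (f i).
Hypothesis sm : forall i, smooth Y L (f i).
Hypothesis ub : forall i, unbiased_bounded Y C (D i) (F i) (f i).
Hypothesis iid : iid_samples D xix xiy.
Hypotheses (dsW : doubly_stochastic W) (rho1 : rhoW W < 1).
Hypothesis Phi_bd : forall u, m0 <= PhiY u <= m0 + Delta.

Let past k := PastType xix xiy k.
Let x (w : Omega) := run_x al be gx gy c Y W F x0 y0 (fun i k => xix i k w) (fun i k => xiy i k w).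
Let y (w : Omega) := run_y al be gx gy c Y W F x0 y0 (fun i k => xix i k w) (fun i k => xiy i k w).
Let mx (w : Omega) := run_mx al be gx gy c Y W F x0 y0 (fun i k => xix i k w) (fun i k => xiy i k w).
Let my (w : Omega) := run_my al be gx gy c Y W F x0 y0 (fun i k => xix i k w) (fun i k => xiy i k w).
Let g (w : Omega) := run_g al be gx gy c Y W F x0 y0 (fun i k => xix i k w) (fun i k => xiy i k w).
Let h (w : Omega) := run_h al be gx gy c Y W F x0 y0 (fun i k => xix i k w) (fun i k => xiy i k w).

Let Y0 : Y !=set0. Proof. by exists (row (Ordinal n0) y0). Qed.

Let FxC i xi u w : Y w -> l2norm (grad_x (F i xi) u w) <= C.
Proof. by move=> Yw; have [_ _ _ + _] := ub i u Yw; exact. Qed.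

Let FyC i xi u w : Y w -> l2norm (grad_y (F i xi) u w) <= C.
Proof. by move=> Yw; have [_ _ _ _] := ub i u Yw; exact. Qed.

Let C0 : 0 <= C.
Proof.
by case: Y0 => w Yw; exact: le_trans (l2norm_ge0 _) (FxC (Ordinal n0) point 0 Yw).
Qed.

Let dF i xi u w : Y w -> differentiable (fun t : 'rV[R]_p * 'rV[R]_d => F i xi t.1 t.2) (u, w).
Proof. by move=> Yw; have [+ _ _ _ _] := ub i u Yw; exact. Qed.

Let hder i : has_derivatives Y (f i). Proof. by case: (sm i). Qed.

Let gx_lip i u u' w w' : Y w -> Y w' ->
  l2norm (Gx i u w - Gx i u' w') ^+ 2
  <= L ^+ 2 * (l2norm (u - u') ^+ 2 + l2norm (w - w') ^+ 2).
Proof. by move=> Yw Yw'; have [_ /(_ u u' w w' Yw Yw') []] := sm i. Qed.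

Let gy_lip i u u' w w' : Y w -> Y w' ->
  l2norm (Gy i u w - Gy i u' w') ^+ 2
  <= L ^+ 2 * (l2norm (u - u') ^+ 2 + l2norm (w - w') ^+ 2).
Proof. by move=> Yw Yw'; have [_ /(_ u u' w w' Yw Yw') []] := sm i. Qed.

Let Sx i xi := grad_x (F i xi).
Let Sy i xi := grad_y (F i xi).

Let Sx_mean i u w (j : 'I_p) : Y w ->
  'E_(D i)[fun xi => (Sx i xi u w 0 j)%R]%E = (Gx i u w 0 j)%:E.
Proof. by move=> Yw; have [_ + _ _ _] := ub i u Yw; exact. Qed.

Let Sy_mean i u w (j : 'I_d) : Y w ->
  'E_(D i)[fun xi => (Sy i xi u w 0 j)%R]%E = (Gy i u w 0 j)%:E.
Proof. by move=> Yw; have [_ _ + _ _] := ub i u Yw; exact. Qed.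

Let mSx i dT (T : measurableType dT) (u : T -> 'rV[R]_p) (w : T -> 'rV[R]_d) (xi : T -> Xi) :
  mvec u -> mvec w -> measurable_fun [set: T] xi -> (forall t, Y (w t)) ->
  mvec (fun t => Sx i (xi t) (u t) (w t)).
Proof. exact: (@measurable_grad_x _ Xi R p d Y (F i) (reg i).1 (dF i) _ T u w xi). Qed.

Let mSy i dT (T : measurableType dT) (u : T -> 'rV[R]_p) (w : T -> 'rV[R]_d) (xi : T -> Xi) :
  mvec u -> mvec w -> measurable_fun [set: T] xi -> (forall t, Y (w t)) ->
  mvec (fun t => Sy i (xi t) (u t) (w t)).
Proof. exact: (@measurable_grad_y _ Xi R p d Y (F i) (reg i).1 (dF i) _ T u w xi). Qed.

Let Gx_bd i u w : Y w -> l2norm (Gx i u w) <= C.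
Proof. exact: oracle_mean_bounded FxC Sx_mean mSx i u w. Qed.

Let Gy_bd i u w : Y w -> l2norm (Gy i u w) <= C.
Proof. exact: oracle_mean_bounded FyC Sy_mean mSy i u w. Qed.

Let ysY u : Y (ys u). Proof. exact: (ystar_in n0 mu0 clY Y0 hder sc Gy_bd). Qed.

Let ys_lip u u' : l2norm (ys u - ys u') <= kap * l2norm (u - u').
Proof. exact: (ystar_lip n0 L0 mu0 clY cvxY Y0 hder sc gy_lip Gy_bd). Qed.

Let Ydiam w w' : Y w -> Y w' -> l2norm (w - w') <= 2 * C / mu.
Proof. exact: (feasible_diam n0 mu0 sc Gy_bd). Qed.

Let compY : compact Y. Proof. exact: (feasible_compact n0 mu0 clY sc Gy_bd). Qed.

Let kap0 : 0 <= kap. Proof. by rewrite /kap divr_ge0 ?mulr_ge0// ltW. Qed.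

Let yY w k i : Y (y w k i). Proof. exact: run_yY. Qed.

Let ms k := run_measurable xix xiy W al be gx gy c x0 n0 cvxY compY y0Y reg dF k.

Let mpow k (s : past k -> R) (a : R) : measurable_fun [set: past k] s ->
  measurable_fun [set: past k] (fun w => s w `^ a).
Proof. by move=> ms'; exact: (measurableT_comp (measurable_powR a) ms'). Qed.

Let mavg k (s : past k -> 'I_n -> R) : (forall i, measurable_fun [set: past k] (s ^~ i)) ->
  measurable_fun [set: past k] (fun w => avg (s w)).
Proof. by move=> ms'; apply: measurable_funM => //; apply: measurable_sum => i; exact: ms'. Qed.

Let mxb k : mvec (fun w : past k => avgv (x w k)).
Proof. by have [h1 _ _ _] := ms k; apply: mvec_avgv => i; exact: h1. Qed.

Let myb k : mvec (fun w : past k => avgv (y w k)).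
Proof. by have [_ h1 _ _] := ms k; apply: mvec_avgv => i; exact: h1. Qed.

Let mys k (u : past k -> 'rV[R]_p) : mvec u -> mvec (fun w => ys (u w)).
Proof. exact: (mvec_lipschitz kap0 ys_lip). Qed.

Let mub k : measurable_fun [set: past k] (fun w => avg (my w k)).
Proof. by have [_ _ _ h1] := ms k; apply: mavg => i; exact: h1. Qed.

Let mvb k : measurable_fun [set: past k]
  (fun w => avg (fun i => Num.max (mx w k i) (my w k i))).
Proof.
have [_ _ h1 h2] := ms k; apply: mavg => i.
by apply: measurable_maxr; [exact: h1|exact: h2].
Qed.

Let mxh k : mvec (fun w : past k => xh c be (x w) (my w) k).
Proof.
elim: k => [|k IH]; first exact: mxb.
(* [xh k.+1] is already determined by the samples before [k]. *)
apply: past_mvecS; apply: mvecD => //; apply: mvecZ.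
  by apply: measurable_funM => //; apply: mpow; exact: mub.
by apply: mvecB => //; exact: mxb.
Qed.

Let mGx k i (u : past k -> 'rV[R]_p) (w : past k -> 'rV[R]_d) : mvec u -> mvec w ->
  (forall t, Y (w t)) -> mvec (fun t => Gx i (u t) (w t)).
Proof. exact: (oracle_mean_mvec iid FxC Sx_mean mSx). Qed.

Let mD1 k : mvec (fun w : past k => gPhi (x w) Gx ys k).
Proof.
apply: mvec_avgv => i; apply: mGx; [exact: mxb|by apply: mys; exact: mxb|by move=> t; exact: ysY].
Qed.

Let mcofx k i : mvec (fun w : past k =>
  cofx L mu c al be gx gy kap (x w) (y w) (mx w) (my w) Gx ys k i).
Proof.
have [h1 h2 h3 h4] := ms k.
have mth : measurable_fun [set: past k] (fun w => th0 c be * avg (my w k) `^ (- be)).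
  by apply: measurable_funM => //; apply: mpow; exact: mub.
rewrite /cofx; apply: mvecD; first apply: mvecD; first exact: mD1.
  apply: mvecZ; last by apply: mvecB; [exact: mxb|exact: mxh].
  apply: measurable_funM => //; apply: measurable_funM.
    by apply: measurable_funM => //; apply: measurable_funB.
  (* Division by [th k] becomes multiplication by a power of [ub], whose measurability is at
     hand. *)
  under eq_fun do rewrite invfM -powRN opprK.
  apply: measurable_funM; first by apply: measurable_funM => //; apply: mpow; exact: mvb.
  by apply: measurable_funM => //; apply: mpow; exact: mub.
apply: mvecZ; last by apply: mGx; [exact: h1|exact: h2|move=> w; exact: yY].
apply: measurable_funM => //; apply: measurable_funM => //.
set V := V0 _ _ _ _ _ _ _ _.
rewrite (_ : (fun w => _) = (fun w => if
  avg (fun i => Num.max (mx w k i) (my w k i)) < V then 1 else 0)); last first.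
  by apply/funext => w; case: ifP.
by apply: measurable_fun_ifT => //; apply: measurable_fun_ltr => //; exact: mvb.
Qed.

Let mcofy k : mvec (fun w : past k => cofy L mu c be gy kap (x w) (y w) (my w) ys k).
Proof.
apply: mvecZ => //; apply: mvecB; first exact: myb.
by apply: mys; exact: mxh.
Qed.

Let gC w k i : l2norm (g w k i) <= C. Proof. by apply: run_gC. Qed.
Let hC w k i : l2norm (h w k i) <= C. Proof. by apply: run_hC. Qed.

Let mx_0 w i : mx w 0 i = c. Proof. exact: run_mx0. Qed.
Let my_0 w i : my w 0 i = c. Proof. exact: run_my0. Qed.
Let mxS w k i : mx w k.+1 i = mx w k i + l2norm (g w k i) ^+ 2. Proof. exact: run_mxS. Qed.
Let myS w k i : my w k.+1 i = my w k i + l2norm (h w k i) ^+ 2. Proof. exact: run_myS. Qed.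
Let xbS w k : avgv (x w k.+1) = avgv (x w k) -
  gx *: avgv (fun i => Num.max (mx w k.+1 i) (my w k.+1 i) `^ (- al) *: g w k i).
Proof. exact: run_xbS. Qed.
Let ybY w k : Y (avgv (y w k)). Proof. exact: run_ybY. Qed.

Let cx_bd w k i := cofx_bd L kap n0 mu0 c0 be0 beal gx0 gy0 (mx_0 w) (my_0 w) (mxS w) (myS w)
  (gC w) (hC w) (xbS w) (yY w) ysY Gx_bd k i.
Let cy_bd w k := cofy_bd L mu c be gy kap (x w) (my w) (ybY w) ysY Ydiam k.

Let M w k := mart L mu c al be gx gy kap (x w) (g w) (y w) (h w) (mx w) (my w) Gx Gy ys k.

(** [martE] writes the term through bounded coefficients determined by the past; the samples of
    index [k] marked [true] and [false] drive the noise in x and in y. *)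
Lemma mart_integral k :
  P.-integrable [set: Omega] (fun w => (M w k)%:E) /\ (\int[P]_w (M w k)%:E = 0)%E.
Proof.
have [h1 h2 _ _] := ms k; have yY' i w : Y (y w k i) := yY w k i.
have Hx i := oracle_martingale iid FxC Sx_mean mSx
  (j := (true, i, k)) erefl (h1 i) (h2 i) (@mcofx k i) (yY' i) (fun w => cx_bd w k i).
have Hy i := oracle_martingale iid FyC Sy_mean mSy
  (j := (false, i, k)) erefl (h1 i) (h2 i) (@mcofy k) (yY' i) (fun w => cy_bd w k).
have ME : (fun w => (M w k)%:E) = (fun w => ((n%:R^-1)%:E * \sum_i
    ((dotp (cofx L mu c al be gx gy kap (x w) (y w) (mx w) (my w) Gx ys k i)
        (Gx i (x w k i) (y w k i) - Sx i (sample xix xiy (true, i, k) w) (x w k i) (y w k i)))%:E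
   + (dotp (cofy L mu c be gy kap (x w) (y w) (my w) ys k)
        (Gy i (x w k i) (y w k i) - Sy i (sample xix xiy (false, i, k) w) (x w k i) (y w k i)))%:E))%E).
  by apply/funext => w; rewrite /M martE /avg EFinM -sumEFin.
have iN i : P.-integrable [set: Omega] (fun w =>
    ((dotp (cofx L mu c al be gx gy kap (x w) (y w) (mx w) (my w) Gx ys k i)
        (Gx i (x w k i) (y w k i) - Sx i (sample xix xiy (true, i, k) w) (x w k i) (y w k i)))%:E
   + (dotp (cofy L mu c be gy kap (x w) (y w) (my w) ys k)
        (Gy i (x w k i) (y w k i) - Sy i (sample xix xiy (false, i, k) w) (x w k i) (y w k i)))%:E)%E).
  by apply: integrableD => //; [exact: (Hx i).1|exact: (Hy i).1].
rewrite ME; split; first by apply: integrableZl => //; exact: integrable_sum.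
rewrite integralZl//; last exact: integrable_sum.
rewrite integral_sum// big1 ?mule0// => i _.
by rewrite integralD ?(Hx i).2 ?(Hy i).2 ?adde0//; [exact: (Hx i).1|exact: (Hy i).1].
Qed.

Lemma expected_gradient_bound K : (0 < K)%N ->
  inconsistency_sq P al (fun w k i => Num.max (mx w k i) (my w k i)) = (zv ^+ 2)%:E ->
  inconsistency_sq P be my = (zu ^+ 2)%:E ->
  (\sum_(k < K) 'E_P[fun w => (l2norm (grad PhiY (avgv (x w k))) ^+ 2)%R]
   <= (2 * (term1 C c al gx zv Delta (L + L * kap) K
     + 2 * cr L mu c be gy kap * term3 L mu C c al be gx gy zv kap K
     + 2 * (ctrack L mu * term2 mu C c be gy zu (2 * C / mu) (rhoW W) K)
     + 2 * (cx L mu * term_var C c (rhoW W) gx al (var (fun i => row i x0)) K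
          + cy L mu * term_var C c (rhoW W) gy be (var (fun i => row i y0)) K)
     + 108 * ((zv ^+ 2 + (L / mu) ^+ 2 * zu ^+ 2) * C ^+ 2) * K%:R))%:E)%E.
Proof.
move=> K0 hv hu; set T := 2 * _.
have gradE u : grad PhiY u = avgv (fun i => Gx i u (ys u)).
  exact: (grad_Phi n0 L0 mu0 clY cvxY Y0 hder sc gx_lip gy_lip Gy_bd).
have mD k : measurable_fun [set: Omega] (fun w => l2norm (gPhi (x w) Gx ys k) ^+ 2).
  under eq_fun do rewrite sqr_l2norm.
  by apply: (@past_measurable_ambient _ _ _ P _ _ _ xix xiy k); exact: measurable_dotp.
have -> : (\sum_(k < K) 'E_P[fun w => (l2norm (grad PhiY (avgv (x w k))) ^+ 2)%R]
    = \int[P]_w (\sum_(k < K) l2norm (gPhi (x w) Gx ys k) ^+ 2)%:E)%E.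
  under [RHS]eq_integral do rewrite -sumEFin.
  rewrite ge0_integral_sum//=; last 2 first.
  - by move=> k; exact/measurable_EFinP.
  - by move=> k w _; rewrite lee_fin sqr_ge0.
  apply: eq_bigr => k _; rewrite unlock; apply: eq_integral => w _.
  by rewrite gradE.
apply: (@integral_le_cst _ _ _ P _ (fun w => 2 * \sum_(k < K) M w k)).
- by apply: measurable_sum => k; exact: mD.
- by move=> w; apply: sumr_ge0 => k _; exact: sqr_ge0.
- rewrite (_ : _ \o _ = fun w => (2%:E * \sum_(k < K) (M w k)%:E)%E); last first.
    by apply/funext => w; rewrite sumEFin.
  apply: integrableZl => //; apply: integrable_sum => // k _.
  exact: (mart_integral k).1.
- under eq_integral do rewrite EFinM -sumEFin.
  rewrite integralZl//; last by apply: integrable_sum => // k _; exact: (mart_integral k).1.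
  rewrite integral_sum//; last by move=> k; exact: (mart_integral k).1.
  by rewrite big1 ?mule0// => k _; exact: (mart_integral k).2.
have mxSb w k i : 0 <= mx w k.+1 i - mx w k i <= C ^+ 2.
  by rewrite mxS addrAC subrr add0r sqr_ge0 lerXn2r ?nnegrE ?l2norm_ge0 ?C0 ?gC.
have mySb w k i : 0 <= my w k.+1 i - my w k i <= C ^+ 2.
  by rewrite myS addrAC subrr add0r sqr_ge0 lerXn2r ?nnegrE ?l2norm_ge0 ?C0 ?hC.
have v_0 w i : Num.max (mx w 0 i) (my w 0 i) = c by rewrite mx_0 my_0 maxxx.
have vSb w k i := maxB_bounds (mxSb w k i) (mySb w k i).
have aev : \forall w \ae P, forall k i,
    `|Num.max (mx w k i) (my w k i) `^ (- al)
      - avg (fun i => Num.max (mx w k i) (my w k i)) `^ (- al)|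
    <= zv * avg (fun i => Num.max (mx w k i) (my w k i)) `^ (- al).
  apply: (inconsistency_ae (b := fun w k i => Num.max (mx w k i) (my w k i))) => //.
    by move=> w k; exact: (acc_avg_gt0 n0 c0 (v_0 w) (vSb w)).
  by move=> w i; rewrite v_0 (eq_avg (b := fun=> c) (v_0 w)) avg_cst.
have aeu : \forall w \ae P, forall k i,
    `|my w k i `^ (- be) - avg (my w k) `^ (- be)| <= zu * avg (my w k) `^ (- be).
  apply: inconsistency_ae => //.
    by move=> w k; exact: (acc_avg_gt0 n0 c0 (my_0 w) (mySb w)).
  by move=> w i; rewrite my_0 (eq_avg (b := fun=> c) (my_0 w)) avg_cst.
apply: filterS2 aev aeu => w vz uz.
have D0 : 0 <= 2 * C / mu by rewrite divr_ge0 ?mulr_ge0// ltW.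
have LP0 : 0 <= L + L * kap := addr_ge0 L0 (mulr_ge0 L0 kap0).
have xv k : var (x w k.+1) <= rhoW W * var (fun i => x w k i -
    gx *: (Num.max (mx w k.+1 i) (my w k.+1 i) `^ (- al) *: g w k i)) by exact: run_xvarS.
have yv k : var (y w k.+1) <= rhoW W * var (fun i => y w k i +
    gy *: (my w k.+1 i `^ (- be) *: h w k i)).
  exact: (run_yvarS al be gx gy c F x0 (fun i k => xix i k w) (fun i k => xiy i k w)
    n0 cvxY compY y0Y dsW k).
have yd k v : Y v -> avg (fun i => l2norm (y w k.+1 i - v) ^+ 2)
  <= avg (fun i => l2norm (y w k i + gy *: (my w k.+1 i `^ (- be) *: h w k i) - v) ^+ 2)
     - (1 - rhoW W) * var (fun i => y w k i + gy *: (my w k.+1 i `^ (- be) *: h w k i)).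
  move=> Yv; exact: (run_ydist al be gx gy c F x0 (fun i k => xix i k w)
    (fun i k => xiy i k w) n0 cvxY compY y0Y dsW k Yv).
have Gm u v : Y v -> dotp (avgv (fun i => Gy i u v)) (v - ys u)
    <= - (mu / 2) * l2norm (v - ys u) ^+ 2.
  exact: (Gy_monotone n0 mu0 clY Y0 hder sc Gy_bd).
have Pd := Phi_descent n0 L0 mu0 clY cvxY Y0 hder sc gx_lip gy_lip Gy_bd.
have := path_bound n0 mu0 C0 c0 be0 beal al1 gx0 gy0 zv0 zu0 D0 kap0 LP0 (rhoW_ge0 W) rho1
  (mx_0 w) (my_0 w) (mxS w) (myS w) (gC w) (hC w) vz uz (xbS w) xv yv yd (yY w) (ybY w) ysY
  Ydiam ys_lip gx_lip gy_lip Gx_bd Gm Pd Phi_bd K0.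
rewrite -(ler_pM2l (ltr0n R 2)) => H; apply: le_trans (le_trans _ H) _.
  by rewrite mulVKf// pnatr_eq0.
by rewrite mulrDr.
Qed.

End Expectation.

Lemma rate_div (R : realType) (al be rho : R) (K : nat) : (0 < K)%N ->
  rate al be rho K / K%:R
  = 1 / K%:R `^ (1 - al) + 1 / ((1 - rho) * K%:R `^ be).
Proof.
move=> K0; have Kp : 0 < K%:R :> R by rewrite ltr0n.
have powB (a b : R) : a - b = 1 -> K%:R `^ a / K%:R = K%:R `^ b :> R.
  move=> ab; rewrite -[in X in _ / X](powRr1 (ltW Kp)) -powRN -powRD_gt0//.
  by congr (_ `^ _); lra.
rewrite /rate mulrDl !div1r invfM -!powRN; congr (_ + _).
  by apply: powB; lra.
by rewrite mulrAC mulrC (@powB _ (- be))//; lra.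
Qed.

(** The base (1 - rho)^-2 is at least 1, so its power with the larger exponent dominates the one
    with 1 / be; raising to the power be gives the form in [admissible]. *)
Lemma admissibleP (R : realType) (al be rho : R) (K : nat) : 0 < be ->
  0 <= rho -> rho < 1 -> (0 < K)%N ->
  (1 / (1 - rho) ^+ 2) `^ Num.max (1 / al) (1 / be) <= K%:R -> admissible be rho K.
Proof.
move=> be0 r0 r1 K0; rewrite !div1r -exprVn; set t := _ ^+ 2 => tK; split=> //.
have t1 : 1 <= t by rewrite exprn_ege1// invf_ge1; lra.
have tbK : t `^ be^-1 <= K%:R by rewrite (le_trans _ tK)// ler_powR// le_max lexx orbT.
rewrite -/t (_ : t = (t `^ be^-1) `^ be); last first.
  by rewrite -powRrM mulVf ?powRr1 ?gt_eqF// (le_trans ler01).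
by apply: ge0_ler_powR; rewrite ?nnegrE ?powR_ge0// ltW.
Qed.

Theorem corollary1 (R : realType) :
  (* absolute constants *)
  exists (c3 : R) (q3 : nat),
  forall (n p d : nat) (L mu C c al be gx gy Delta zeta_v zeta_u : R)
    (x0 : 'M[R]_(n, p)) (y0 : 'M[R]_(n, d)),
  (0 < n)%N -> 0 <= L -> 0 < mu -> 0 < c ->
  0 < be -> be < al -> al < 1 -> 0 < gx -> 0 < gy ->
  (* hidden factors, depending only on the parameters above *)
  exists (A B1 B2 : R) (q1 q2 : nat),
  0 < A /\
  forall (Y : set 'rV[R]_d) (dXi dO : measure_display)
    (Xi : measurableType dXi) (Omega : measurableType dO)
    (P : probability Omega R) (D : 'I_n -> probability Xi R)
    (F : 'I_n -> Xi -> 'rV[R]_p -> 'rV[R]_d -> R)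
    (xix xiy : 'I_n -> nat -> {RV P >-> Xi}) (W : 'M[R]_n) (K : nat),
  let f := local_obj D F in
  let PhiY := Phi Y (global_obj f) in
  let kappa := L / mu in
  let rho := rhoW W in
  let s (w : Omega) (k : nat) :=
    dtiada (DTiAdaParams al be gx gy) Y W F c x0 y0
      (fun i k' => xix i k' w) (fun i k' => xiy i k' w) k in
  closed Y -> convex_set Y -> (forall i, Y (row i y0)) ->
  (forall i, regular_oracle Y (D i) (F i)) ->
  (forall i, strongly_concave_y Y mu (f i)) ->
  (forall i, smooth Y L (f i)) ->
  (forall i, unbiased_bounded Y C (D i) (F i) (f i)) ->
  iid_samples D xix xiy ->
  doubly_stochastic W -> rho < 1 ->
  has_ubound (range PhiY) -> has_lbound (range PhiY) ->
  Delta = sup (range PhiY) - inf (range PhiY) ->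
  inconsistency_sq P al (fun w k => st_v (s w k)) = (zeta_v ^+ 2)%:E ->
  inconsistency_sq P be (fun w k => st_u (s w k)) = (zeta_u ^+ 2)%:E ->
  (0 < K)%N ->
  A * Num.max ((gx ^+ 2 * kappa ^+ 4 / gy ^+ 2) `^ (1 / (al - be)))
              ((1 / (1 - rho) ^+ 2) `^ Num.max (1 / al) (1 / be)) <= K%:R ->
  ((K%:R^-1)%:E *
     \sum_(k < K) 'E_P[fun w => (l2norm (grad PhiY (avg_row (st_x (s w k)))) ^+ 2)%R]
   <= (B1 * polylog R q1 K *
         (1 / K%:R `^ (1 - al) + 1 / ((1 - rho) `^ al * K%:R `^ al))
       + B2 * polylog R q2 K *
         (1 / K%:R `^ (1 - be) + 1 / ((1 - rho) * K%:R `^ be))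
       + c3 * polylog R q3 K *
         ((zeta_v ^+ 2 + kappa ^+ 2 * zeta_u ^+ 2) * C ^+ 2))%:E)%E.
Proof.
(* 216 is twice the 108 of [path_bound], whose left side carries the factor 1/2. The exponent 0
   means that no logarithm multiplies the zeta term. *)
exists 216, 0%N => n p d L mu C c al be gx gy Delta zeta_v zeta_u x0 y0.
move=> n0 L0 mu0 c0 be0 beal al1 gx0 gy0.
pose kap := 2 * L / mu.
have kap0 : 0 <= kap by rewrite divr_ge0 ?mulr_ge0// ltW.
(* The constant must be fixed before the hypotheses that determine the signs of [C] and [Delta] are
   available, hence the absolute values. The zetas enter those hypotheses and the bound to be shown
   only through their squares. *)
have [B B0 hB] := @rate_bound R `|C| c al be (normr_ge0 C) c0 be0 beal
  L mu gx gy `|zeta_v| `|zeta_u| `|Delta| (2 * `|C| / mu) kap (L + L * kap)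
  (var (fun i => row i x0)) (var (fun i => row i y0)) mu0 gx0 gy0
  (normr_ge0 _) (normr_ge0 _) (normr_ge0 _)
  (divr_ge0 (mulr_ge0 (ler0n R 2) (normr_ge0 C)) (ltW mu0)) (addr_ge0 L0 (mulr_ge0 L0 kap0))
  (var_ge0 _) (var_ge0 _).
exists 1, (2 * B), (2 * B), 1%N, 1%N; split=> //.
move=> Y dXi dO Xi Omega P D F xix xiy W K f PhiY kappa rho s clY cvxY y0Y reg sc sm ub iid
  dsW rho1 hsup hinf DeltaE hv hu K0.
rewrite mul1r ge_max => /andP[_ hK].
have r0 : 0 <= rho := rhoW_ge0 W.
have adm := admissibleP be0 r0 rho1 K0 hK.
have C0 : 0 <= C.
  have [_ _ _ h _] := ub (Ordinal n0) (0 : 'rV[R]_p) _ (y0Y (Ordinal n0)).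
  exact: le_trans (l2norm_ge0 _) (h point).
have le_sup u : PhiY u <= sup (range PhiY) by apply: sup_ubound => //; exists u.
have ge_inf u : inf (range PhiY) <= PhiY u by apply: inf_lbound => //; exists u.
have Delta0 : 0 <= Delta by rewrite DeltaE subr_ge0 (le_trans (ge_inf 0) (le_sup 0)).
have Phi_bd u : inf (range PhiY) <= PhiY u <= inf (range PhiY) + Delta.
  by rewrite ge_inf DeltaE addrC subrK le_sup.
have sqE (a : R) : `|a| ^+ 2 = a ^+ 2 by rewrite real_normK ?num_real.
have := hB rho K adm; rewrite (ger0_norm C0) (ger0_norm Delta0) => {}hB.
have := expected_gradient_bound n0 L0 mu0 c0 be0 beal al1 gx0 gy0 (normr_ge0 zeta_v)
  (normr_ge0 zeta_u) clY cvxY y0Y reg sc sm ub iid dsW rho1 Phi_bd K0.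
rewrite !sqE => /(_ x0 hv hu).
move=> hE.
have Kp : 0 < K%:R :> R by rewrite ltr0n.
have iK0 : 0 <= K%:R^-1 :> R by rewrite invr_ge0 ltW.
have lnK : 0 <= ln K%:R :> R by rewrite ln_ge0// ler1n.
have rate0 : (1 + ln K%:R) * (1 / K%:R `^ (1 - al) + 1 / ((1 - rho) * K%:R `^ be))
   = (1 + ln K%:R) * rate al be rho K / K%:R :> R by rewrite -rate_div// mulrA.
have iK0E : (0 <= (K%:R^-1)%:E :> \bar R)%E by rewrite lee_fin.
apply: (le_trans (lee_wpmul2l iK0E hE)); rewrite -EFinM lee_fin.
set T := _ + _ + _ + _ in hB; set Z := (_ ^+ 2 + _) * C ^+ 2.
have -> : K%:R^-1 * (2 * (T + 108 * Z * K%:R)) = 2 * (K%:R^-1 * T) + 216 * Z.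
  by field; rewrite gt_eqF.
rewrite /polylog !expr1 expr0 mulr1 lerD2r.
have {}hB : 2 * (K%:R^-1 * T) <= 2 * B * ((1 + ln K%:R) * (1 / K%:R `^ (1 - al)
    + 1 / ((1 - rho) * K%:R `^ be))).
  rewrite rate0 (_ : 2 * B * _ = 2 * (K%:R^-1 * (B * ((1 + ln K%:R) * rate al be rho K)))).
    by rewrite ler_wpM2l// ler_wpM2l.
  by ring.
apply: le_trans hB _.
(* The other two powers of the claim are nonnegative and only enlarge the bound. *)
have a0 : 0 <= 1 / ((1 - rho) `^ al * K%:R `^ al) by rewrite divr_ge0 ?mulr_ge0 ?powR_ge0.
have b0 : 0 <= 1 / K%:R `^ (1 - be) by rewrite divr_ge0 ?powR_ge0.
have c20 : 0 <= 2 * B * (1 + ln K%:R) by rewrite !mulr_ge0// addr_ge0.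
rewrite -[leRHS]mulrDr [leLHS]mulrA; apply: ler_wpM2l => //; lra.
Qed.
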